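(* Let $u(t)$ be the solution of the initial value problem $u_t=f(t,u)=\sum_{\nu=1}^{\Lambda}f_\nu(t,u)$, $u(0)=u_0$. Assume $u(t)$, $f(t,u)$ and $f_\nu(t,u)$ are at least $\sigma$ times differentiable with respect to each argument, where $\sigma\ge M+2$. Consider one time interval $t\in[0,H]$ of an IDC method with $M+1$ uniformly distributed quadrature points, $h=H/M$. Suppose an $r_0$-th order additive Runge–Kutta (ARK) method is used in the prediction step and ARK methods of orders $r_1,r_2,\dots,r_{c_s}$ are used in the $c_s$ successive correction steps. Let $s_k=\sum_{j=0}^{k}r_j$. If $s_{c_s}\le M+1$, then the local truncation error after $c_s$ correction steps satisfies $$\|u(H)-\upsilon^{[c_s]}_M\|=\mathcal{O}(h^{s_{c_s}+1})\quad\text{as }h\to0.$$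
   Context: Here $u(t)\in\mathbb{R}^n$ and $f,f_\nu:\mathbb{R}^+\times\mathbb{R}^n\to\mathbb{R}^n$. ARK method: a $p$-stage ARK method with step $h$ for $w'=\sum_{\nu=1}^{\Lambda}g_\nu(t,w)$ is $$w^{m+1}=w^m+h\sum_{\nu=1}^{\Lambda}\sum_{i=1}^p b_i^{[\nu]}g_\nu(t_m+c_i^{[\nu]}h,\tilde w_i),\qquad \tilde w_i=w^m+h\sum_{\nu=1}^{\Lambda}\sum_{j=1}^p a_{ij}^{[\nu]}g_\nu(t_m+c_j^{[\nu]}h,\tilde w_j),$$ with real coefficients. It has order $r$ if its one-step (local) error is $\mathcal{O}(h^{r+1})$ for sufficiently smooth problems. IDC method on $[0,H]$: let $t_m=mh$, $m=0,\dots,M$, with $M$ fixed, and $u_m=u(t_m)$. Prediction: apply the $r_0$-th order ARK method with step $h$ to the initial value problem (with $g_\nu=f_\nu$), starting from $\upsilon_0^{[0]}=u_0$, to get $\upsilon^{[0]}=(\upsilon^{[0]}_0,\dots,\upsilon^{[0]}_M)$. Correction $k=1,\dots,c_s$: let $\upsilon^{(k-1)}(t)$ be the polynomial of degree at most $M$ interpolating $\upsilon^{[k-1]}$ at $t_0,\dots,t_M$, and let $e^{(k-1)}(t)=u(t)-\upsilon^{(k-1)}(t)$ and $\epsilon^{(k-1)}(t)=(\upsilon^{(k-1)})'(t)-f(t,\upsilon^{(k-1)}(t))$. Then $Q^{(k-1)}(t)=e^{(k-1)}(t)+\int_{t_0}^t\epsilon^{(k-1)}(\tau)\,d\tau$ solves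 $$(Q^{(k-1)})'=\sum_{\nu=1}^{\Lambda}G_\nu^{(k-1)}(t,Q^{(k-1)}),\quad Q^{(k-1)}(t_0)=0,$$ $$G_\nu^{(k-1)}(t,Q)=f_\nu\Big(t,\upsilon^{(k-1)}(t)+Q-\int_{t_0}^t\epsilon^{(k-1)}(\tau)\,d\tau\Big)-f_\nu(t,\upsilon^{(k-1)}(t)).$$ In the numerical method the integral of the residual is computed by interpolatory quadrature on the $M+1$ nodes, $\int_{t_0}^{t}\epsilon^{(k-1)}\approx I^{(k-1)}(t):=\upsilon^{(k-1)}(t)-u_0-\sum_{j=0}^M f(t_j,\upsilon^{[k-1]}_j)\int_{t_0}^{t}c_j(\tau)\,d\tau$, where $c_j(t)=\prod_{i\ne j}\frac{t-t_i}{t_j-t_i}$. Apply the $r_k$-th order ARK method with step $h$ to the error equation (with $g_\nu=G_\nu^{(k-1)}$, the integral replaced by $I^{(k-1)}$), starting from $\vartheta_0^{[k]}=0$, to get $\vartheta^{[k]}_m\approx Q^{(k-1)}(t_m)$. Set $\delta^{[k]}_m=\vartheta^{[k]}_m-I^{(k-1)}(t_m)$ and $\upsilon^{[k]}=\upsilon^{[k-1]}+\delta^{[k]}$. $\mathcal{O}$-bounds are as $h\to0$ with $M$, $c_s$ and the methods fixed. *)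

(* Defs.v *)
From HB Require Import structures.
From mathcomp Require Import all_boot all_order all_algebra.
From mathcomp Require Import all_classical all_reals all_analysis.
Set Implicit Arguments.
Unset Strict Implicit.
Unset Printing Implicit Defensive.
Import Order.TTheory GRing.Theory Num.Theory.
Import numFieldNormedType.Exports.
Local Open Scope classical_set_scope.
Local Open Scope ring_scope.

(* Frechet derivative relative to a domain D: one-sided on the boundary of D,
   and independent of the values of f outside D. *)
Definition has_diff_within (R : realType) (V W : normedModType R)
    (D : set V) (f : V -> W) (x : V) (df : {linear V -> W}) : Prop :=
  continuous df /\
  (fun y => f y - f x - df (y - x)) =o_ (within D (nbhs x)) (fun y => y - x).

(* f is k times (jointly) differentiable on D.  All the mixed partial
   derivatives of order <= k exist; those of order < k are continuous. *)
Fixpoint times_differentiable (R : realType) (V W : normedModType R)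
    (k : nat) (D : set V) (f : V -> W) : Prop :=
  if k is k'.+1 then
    exists df : V -> {linear V -> W},
      (forall x, D x -> has_diff_within D f x (df x)) /\
      (forall v, times_differentiable k' D (fun x => df x v))
  else True.

(* The right-hand sides are functions on R^+ x R^n: their values at negative
   times are never used. *)
Definition field_times_differentiable (R : realType) (n k : nat)
    (g : R -> 'rV[R]_n -> 'rV[R]_n) : Prop :=
  times_differentiable k
    [set x : R^o * 'rV[R]_n | 0 <= x.1] (fun x => g x.1 x.2).

Definition solves_ivp (R : realType) (n : nat) (g : R -> 'rV[R]_n -> 'rV[R]_n)
    (t0 T : R) (w0 : 'rV[R]_n) (w : R -> 'rV[R]_n) : Prop :=
  w t0 = w0 /\
  forall t : R, t0 <= t <= t0 + T ->
    (fun x : R => w x - w t - (x - t) *: g t (w t))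
      =o_ (within `[t0, t0 + T] (nbhs t)) (fun x : R => x - t : R^o).

Record ark_method (R : realType) (L : nat) := ARKMethod {
  ark_stages : nat;
  ark_a : 'I_L -> 'I_ark_stages -> 'I_ark_stages -> R;
  ark_b : 'I_L -> 'I_ark_stages -> R;
  ark_c : 'I_L -> 'I_ark_stages -> R }.
Arguments ark_a {R L} S nu i j : rename.
Arguments ark_b {R L} S nu i : rename.
Arguments ark_c {R L} S nu i : rename.

(* One step of size h from (t, w) to w'.  The stage equations may be implicit
   and may then have spurious solutions, unbounded as h -> 0; the solution
   meant is the one close to w, which for small h is the only one within any
   fixed distance rho of w.  For an explicit method the bound by rho holds
   automatically once h is small.  The abscissae must lie in R^+, where the
   right-hand sides are defined. *)
Definition ark_step (R : realType) (L : nat) (S : ark_method R L) (rho : R)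
    (n : nat) (g : 'I_L -> R -> 'rV[R]_n -> 'rV[R]_n)
    (h t : R) (w w' : 'rV[R]_n) : Prop :=
  exists z : 'I_(ark_stages S) -> 'rV[R]_n,
    [/\ forall nu i, 0 <= t + ark_c S nu i * h,
        forall i, `|z i - w| <= rho,
        forall i, z i = w + h *: \sum_(nu < L) \sum_(j < ark_stages S)
                    ark_a S nu i j *: g nu (t + ark_c S nu j * h) (z j)
      & w' = w + h *: \sum_(nu < L) \sum_(i < ark_stages S)
                    ark_b S nu i *: g nu (t + ark_c S nu i * h) (z i)].

Definition ark_run (R : realType) (L : nat) (S : ark_method R L) (rho : R)
    (n : nat) (g : 'I_L -> R -> 'rV[R]_n -> 'rV[R]_n)
    (h : R) (M : nat) (w0 : 'rV[R]_n) (w : nat -> 'rV[R]_n) : Prop :=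
  w 0%N = w0 /\
  forall m, (m < M)%N -> ark_step S rho g h (m%:R * h) (w m) (w m.+1).

(* "Sufficiently smooth" is: K times differentiable, for some K depending on
   the method only.  The problems have arbitrary dimension d. *)
Definition ark_has_order (R : realType) (L : nat) (S : ark_method R L)
    (r : nat) : Prop :=
  exists K : nat,
    forall (d : nat) (g : 'I_L -> R -> 'rV[R]_d -> 'rV[R]_d) (t0 T : R)
      (w0 : 'rV[R]_d) (w : R -> 'rV[R]_d) (rho : R) (w1 : R -> 'rV[R]_d),
    0 <= t0 -> 0 < T ->
    (forall nu, field_times_differentiable K (g nu)) ->
    times_differentiable K (`[t0, t0 + T] : set R^o) w ->
    solves_ivp (fun t x => \sum_(nu < L) g nu t x) t0 T w0 w ->
    (\forall h \near 0^'+, ark_step S rho g h t0 w0 (w1 h)) ->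
    (fun h : R => `|w (t0 + h) - w1 h| : R^o)
      =O_ (0^'+) (fun h : R => h ^+ r.+1 : R^o).

Definition idc_node (R : realType) (h : R) (m : nat) : R := m%:R * h.

Definition lagrange_basis (R : realType) (M : nat) (h : R) (j : 'I_M.+1)
    (t : R) : R :=
  \prod_(i < M.+1 | i != j)
    ((t - idc_node h i) / (idc_node h j - idc_node h i)).

Definition interpolant (R : realType) (n M : nat) (h : R)
    (v : nat -> 'rV[R]_n) (t : R) : 'rV[R]_n :=
  \sum_(j < M.+1) lagrange_basis h j t *: v j.

Lemma interpolant_node (R : realType) (n M : nat) (h : R)
    (v : nat -> 'rV[R]_n) (m : nat) :
  h != 0 -> (m <= M)%N -> interpolant M h v (idc_node h m) = v m.
Proof.
move=> h0 mM; have mM1 : (m < M.+1)%N by [].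
rewrite /interpolant (bigD1 (Ordinal mM1)) //= big1 => [|j jm].
  rewrite addr0 /lagrange_basis big1 ?scale1r// => i im.
  rewrite divff// /idc_node -mulrBl mulf_neq0// subr_eq0 eqr_nat eq_sym.
  by apply: contra im => /eqP im; apply/eqP/val_inj.
rewrite /lagrange_basis (bigD1 (Ordinal mM1)) 1?eq_sym//=.
by rewrite subrr !mul0r scale0r.
Qed.

(* The quadrature value I(t) of the integral of the residual, for t >= 0. *)
Definition residual_quadrature (R : realType) (n M : nat) (h : R)
    (f : R -> 'rV[R]_n -> 'rV[R]_n) (u0 : 'rV[R]_n) (v : nat -> 'rV[R]_n)
    (t : R) : 'rV[R]_n :=
  interpolant M h v t - u0
  - \sum_(j < M.+1)
      (\int[lebesgue_measure]_(x in `[0, t]) lagrange_basis h j x)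
        *: f (idc_node h j) (v j).

Definition error_field (R : realType) (L n M : nat) (h : R)
    (f : R -> 'rV[R]_n -> 'rV[R]_n) (fnu : 'I_L -> R -> 'rV[R]_n -> 'rV[R]_n)
    (u0 : 'rV[R]_n) (v : nat -> 'rV[R]_n)
    (nu : 'I_L) (t : R) (Q : 'rV[R]_n) : 'rV[R]_n :=
  fnu nu t (interpolant M h v t + Q - residual_quadrature M h f u0 v t)
  - fnu nu t (interpolant M h v t).

(* ups k m is the approximation of u (m h) after k corrections; meth 0 is the
   prediction method and meth k the method of the k-th correction. *)
Definition idc_run (R : realType) (L n M cs : nat)
    (meth : nat -> ark_method R L) (rho : R)
    (f : R -> 'rV[R]_n -> 'rV[R]_n) (fnu : 'I_L -> R -> 'rV[R]_n -> 'rV[R]_n)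
    (u0 : 'rV[R]_n) (h : R) (ups : nat -> nat -> 'rV[R]_n) : Prop :=
  ark_run (meth 0%N) rho fnu h M u0 (ups 0%N) /\
  forall k, (k < cs)%N ->
    exists theta : nat -> 'rV[R]_n,
      ark_run (meth k.+1) rho (error_field M h f fnu u0 (ups k)) h M 0 theta /\
      forall m, (m <= M)%N ->
        ups k.+1 m = ups k m +
          (theta m - residual_quadrature M h f u0 (ups k) (idc_node h m)).

(* Main.v *)
Require Import Defs.
From HB Require Import structures.
From mathcomp Require Import all_boot all_order all_algebra.
From mathcomp Require Import all_classical all_reals all_analysis.
From mathcomp Require Import ring lra.
Set Implicit Arguments.
Unset Strict Implicit.
Unset Printing Implicit Defensive.
Import Order.TTheory GRing.Theory Num.Theory.
Import numFieldNormedType.Exports.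
Local Open Scope classical_set_scope.
Local Open Scope ring_scope.

(* Since H = M h with M fixed, only the Taylor polynomials of the data at (0, u0)
   matter, up to O(h^(M+2)).  The claim propagated through the corrections is that
   the k-th approximation at t_m is U(t_m) + h^(s_k) eta(t_m, h) with U the Taylor
   polynomial of u and eta a polynomial in (t, h) vanishing at t = 0; this is the
   smoothness of the rescaled error.  Dividing the error equation by h^(s_k) then
   gives a polynomial initial value problem depending polynomially on a parameter
   e, to be taken equal to h, with polynomial exact solution.  For each fixed e the
   order hypothesis bounds the one-step defect, and as this defect is a polynomial
   (up to high powers of h) in the step, the base point and e, the factor h^(r+1)
   comes out uniformly in e.  Summing the defects by antidifferences shows that the
   numerical error is again h^r times a polynomial in (t, h).  The interpolation
   error, only O(h^(M+1)) between the nodes, enters the fields multiplied by h and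
   is therefore harmless. *)

(** * Polynomial maps between spaces with coordinates *)

(** The order hypothesis is the only information about the methods, and it is awkward to use: the
    problem is fixed before the constant, and the smoothness [K] it demands may exceed [sigma]. So
    it cannot be applied to the [fnu] themselves, nor to the error equations, which change with h
    and with the computed data. Polynomial fields satisfy every [K], and a parameter e separate from
    the step keeps the problem fixed while the step tends to 0. The scaling explains why the orders
    add. Let p be the sum of the model fields, h^s D = p(t, U + h^s eta) - p(t, U), and ID the
    primitive of D vanishing at t = 0. The integrated residual is modelled by h^s (eta - ID), hence
    Q by -h^s ID. The method thus approximates -ID, which no longer carries the factor h^s, with an
    error h^r eta'. In U + h^s eta + theta - I all terms with the bare factor h^s cancel and h^(s+r)
    eta' remains. The last power of h in the theorem comes from eta' vanishing at t = 0, because all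
    times are O(h). *)

Class coords (R T : Type) := Coords {
  coord_ix : Type;
  coord : coord_ix -> T -> R }.

#[local] Instance coords_scalar (R : realType) : coords R R :=
  {| coord_ix := unit; coord := fun=> id |}.

#[local] Instance coords_row (R : realType) n : coords R 'rV[R]_n :=
  {| coord_ix := 'I_n; coord := fun (j : 'I_n) (x : 'rV[R]_n) => x 0 j |}.

(** A tuple gets a disjoint sum of index types: in [(h, t, x, e)] the j-th entry of the state x is
    [inl (inr j)]. The increments prescribed further on are pattern matches on such indices. *)
#[local] Instance coords_prod (R A B : Type) (a : coords R A) (b : coords R B) :
    coords R (A * B) :=
  {| coord_ix := @coord_ix _ _ a + @coord_ix _ _ b;
     coord := fun i x => match i with
                         | inl i => coord i x.1
                         | inr i => coord i x.2
                         end |}.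

Section PolynomialMaps.
Context {R : realType}.

(** Being polynomial is closure under sums and products, not a choice of coefficients, so that
    bounds, Lipschitz constants, increments and derivatives each come from one induction. *)
Inductive polyfun (T : Type) {cT : coords R T} : (T -> R) -> Prop :=
| Polyfun_cst a : polyfun (fun=> a)
| Polyfun_coord i : polyfun (coord i)
| Polyfun_add F G : polyfun F -> polyfun G -> polyfun (fun x => F x + G x)
| Polyfun_mul F G : polyfun F -> polyfun G -> polyfun (fun x => F x * G x).

Definition polymap (S T : Type) {cS : coords R S} {cT : coords R T}
    (F : S -> T) : Prop :=
  forall i, polyfun (fun x => coord i (F x)).

(** Bounds are stated coordinate by coordinate since index types are not assumed finite; for rows
    this is the maximum norm. *)
Definition box (T : Type) {cT : coords R T} (C : R) (x : T) : Prop :=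
  forall i, `|coord i x| <= C.

Definition close (T : Type) {cT : coords R T} (d : R) (x y : T) : Prop :=
  forall i, `|coord i x - coord i y| <= d.

Section Closure.
Context {S : Type} {cS : coords R S}.

Lemma polymapP (F : S -> R) : polymap F <-> polyfun F.
Proof. by split=> [/(_ tt)|FP []]. Qed.

Lemma eq_polymap {T} {cT : coords R T} (F G : S -> T) :
  F =1 G -> polymap G -> polymap F.
Proof. by move=> /funext ->. Qed.

Lemma polymap_id : polymap (@id S).
Proof. by move=> i; constructor. Qed.

Lemma polymap_cst {T} {cT : coords R T} (a : T) : polymap (fun _ : S => a).
Proof. by move=> i; exact: Polyfun_cst. Qed.

Lemma polymap_pair {A B} {cA : coords R A} {cB : coords R B}
    (F : S -> A) (G : S -> B) :
  polymap F -> polymap G -> polymap (fun x => (F x, G x)).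
Proof. by move=> FP GP [i|i]; [exact: FP|exact: GP]. Qed.

Lemma polymap_fst {A B} {cA : coords R A} {cB : coords R B} (F : S -> A * B) :
  polymap F -> polymap (fun x => (F x).1).
Proof. by move=> FP i; exact: (FP (inl i)). Qed.

Lemma polymap_snd {A B} {cA : coords R A} {cB : coords R B} (F : S -> A * B) :
  polymap F -> polymap (fun x => (F x).2).
Proof. by move=> FP i; exact: (FP (inr i)). Qed.

Lemma polymap_comp {A B} {cA : coords R A} {cB : coords R B}
    (F : A -> B) (G : S -> A) :
  polymap F -> polymap G -> polymap (fun x => F (G x)).
Proof.
move=> FP GP i.
have H (f : A -> R) : polyfun f -> polyfun (fun x => f (G x)); last first.
  exact: (H _ (FP i)).
elim=> {f}.
- by move=> a; exact: Polyfun_cst.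
- by move=> k; exact: GP.
- by move=> F1 F2 _ h1 _ h2; exact: Polyfun_add.
- by move=> F1 F2 _ h1 _ h2; exact: Polyfun_mul.
Qed.

Lemma polymapD (F G : S -> R) :
  polymap F -> polymap G -> polymap (fun x => F x + G x).
Proof.
by move=> /polymapP FP /polymapP GP; apply/polymapP; exact: Polyfun_add.
Qed.

Lemma polymapM (F G : S -> R) :
  polymap F -> polymap G -> polymap (fun x => F x * G x).
Proof.
by move=> /polymapP FP /polymapP GP; apply/polymapP; exact: Polyfun_mul.
Qed.

Lemma polymapN (F : S -> R) : polymap F -> polymap (fun x => - F x).
Proof.
move=> FP; rewrite (_ : (fun _ => _) = fun x => -1 * F x).
  exact/polymapM/FP/polymap_cst.
by apply/funext => x; rewrite mulN1r.
Qed.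

Lemma polymapB (F G : S -> R) :
  polymap F -> polymap G -> polymap (fun x => F x - G x).
Proof. by move=> FP GP; apply: polymapD => //; exact: polymapN. Qed.

Lemma polymapX (F : S -> R) k : polymap F -> polymap (fun x => F x ^+ k).
Proof.
move=> FP; elim: k => [|k IH]; first exact: polymap_cst.
rewrite (_ : (fun _ => _) = fun x => F x * F x ^+ k); first exact: polymapM.
by apply/funext => x; rewrite exprS.
Qed.

Lemma polymap_sum (I : Type) (s : seq I) (P : pred I) (F : I -> S -> R) :
  (forall i, P i -> polymap (F i)) -> polymap (fun x => \sum_(i <- s | P i) F i x).
Proof.
move=> FP; elim: s => [|i s IH].
  by apply: (eq_polymap (G := fun=> 0)) (polymap_cst _) => x; rewrite big_nil.
case: (boolP (P i)) => Pi.
  apply: (eq_polymap _ (polymapD (FP i Pi) IH)) => x.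
  by rewrite big_cons Pi.
by apply: (eq_polymap _ IH) => x; rewrite big_cons (negPf Pi).
Qed.

Section Rows.
Context {n : nat}.
Implicit Types F G : S -> 'rV[R]_n.

Lemma polymap_row F : (forall j, polymap (fun x => F x 0 j)) -> polymap F.
Proof. by move=> FP j; exact: (FP j tt). Qed.

Lemma polymap_entry F j : polymap F -> polymap (fun x => F x 0 j).
Proof. by move=> FP []; exact: (FP j). Qed.

Lemma polymapDv F G : polymap F -> polymap G -> polymap (fun x => F x + G x).
Proof.
move=> FP GP; apply: polymap_row => j.
apply: (eq_polymap _ (polymapD (polymap_entry j FP) (polymap_entry j GP))) => x.
by rewrite mxE.
Qed.

Lemma polymapZv (a : S -> R) F :
  polymap a -> polymap F -> polymap (fun x => a x *: F x).
Proof.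
move=> aP FP; apply: polymap_row => j.
by apply: (eq_polymap _ (polymapM aP (polymap_entry j FP))) => x; rewrite mxE.
Qed.

Lemma polymapBv F G : polymap F -> polymap G -> polymap (fun x => F x - G x).
Proof.
move=> FP GP; apply: polymap_row => j.
apply: (eq_polymap _ (polymapB (polymap_entry j FP) (polymap_entry j GP))) => x.
by rewrite !mxE.
Qed.

Lemma polymap_sumv (I : Type) (s : seq I) (P : pred I) (F : I -> S -> 'rV[R]_n) :
  (forall i, P i -> polymap (F i)) -> polymap (fun x => \sum_(i <- s | P i) F i x).
Proof.
move=> FP; elim: s => [|i s IH].
  by apply: (eq_polymap (G := fun=> 0)) (polymap_cst _) => x; rewrite big_nil.
case: (boolP (P i)) => Pi.
  apply: (eq_polymap _ (polymapDv (FP i Pi) IH)) => x.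
  by rewrite big_cons Pi.
by apply: (eq_polymap _ IH) => x; rewrite big_cons (negPf Pi).
Qed.

End Rows.
End Closure.

Lemma norm_row_le n (x : 'rV[R]_n) (C : R) :
  0 <= C -> (forall j, `|x 0 j| <= C) -> `|x| <= C.
Proof.
move=> C0 xC; rewrite /Num.norm /= mx_normrE; apply: bigmax_le => //= -[i j] _.
by rewrite /= (ord1 i).
Qed.

Lemma norm_entry_le n (x : 'rV[R]_n) j : `|x 0 j| <= `|x|.
Proof.
rewrite [leRHS]/Num.norm /= mx_normrE.
by apply/bigmax_geP; right; exists (0, j).
Qed.

Section Bounds.
Context {T : Type} {cT : coords R T}.

Lemma polyfun_bounded (F : T -> R) (C : R) : polyfun F ->
  exists2 K, 0 <= K & forall x, box C x -> `|F x| <= K.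
Proof.
elim=> [a|i|F1 F2 _ [K1 K10 h1] _ [K2 K20 h2]|F1 F2 _ [K1 K10 h1] _ [K2 K20 h2]].
- by exists `|a|.
- by exists `|C| => // x /(_ i) /le_trans; apply; exact: ler_norm.
- exists (K1 + K2) => [|x xC]; first exact: addr_ge0.
  by apply: (le_trans (ler_normD _ _)); apply: lerD; [exact: h1|exact: h2].
- exists (K1 * K2) => [|x xC]; first exact: mulr_ge0.
  by rewrite normrM; apply: ler_pM => //; [exact: h1|exact: h2].
Qed.

Lemma polyfun_lipschitz (F : T -> R) (C : R) : polyfun F ->
  exists2 K, 0 <= K &
    forall x y d, box C x -> box C y -> 0 <= d -> close d x y ->
      `|F x - F y| <= K * d.
Proof.
elim=> [a|i|F1 F2 _ [K1 K10 h1] _ [K2 K20 h2]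
        |F1 F2 P1 [K1 K10 h1] P2 [K2 K20 h2]].
- by exists 0 => // x y d _ _ d0 _; rewrite subrr normr0 mul0r.
- by exists 1 => // x y d _ _ _ /(_ i); rewrite mul1r.
- exists (K1 + K2) => [|x y d xC yC d0 xy]; first exact: addr_ge0.
  rewrite (_ : _ - _ = (F1 x - F1 y) + (F2 x - F2 y)); last by ring.
  apply: (le_trans (ler_normD _ _)); rewrite [leRHS]mulrDl.
  by apply: lerD; [exact: h1|exact: h2].
- have [B1 B10 b1] := polyfun_bounded C P1.
  have [B2 B20 b2] := polyfun_bounded C P2.
  exists (K1 * B2 + B1 * K2) => [|x y d xC yC d0 xy].
    by rewrite addr_ge0 ?mulr_ge0.
  rewrite (_ : _ - _ = (F1 x - F1 y) * F2 x + F1 y * (F2 x - F2 y)); last by ring.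
  apply: (le_trans (ler_normD _ _)); rewrite [leRHS]mulrDl !normrM; apply: lerD.
    by rewrite mulrAC; apply: ler_pM => //; [exact: h1|exact: b2].
  by rewrite -mulrA; apply: ler_pM => //; [exact: b1|exact: h2].
Qed.

Context {n : nat}.

Lemma polymap_bounded (F : T -> 'rV[R]_n) (C : R) : polymap F ->
  exists2 K, 0 <= K & forall x, box C x -> `|F x| <= K.
Proof.
move=> FP.
have /choice[K KP] : forall j, exists K : R,
    0 <= K /\ forall x, box C x -> `|F x 0 j| <= K.
  by move=> j; have [K K0 KP] := polyfun_bounded C (FP j); exists K.
exists (\sum_j K j) => [|x xC]; first by apply: sumr_ge0 => j _; case: (KP j).
apply: norm_row_le => [|j]; first by apply: sumr_ge0 => j _; case: (KP j).
rewrite (bigD1 j)//= ler_wpDr//; first by apply: sumr_ge0 => i _; case: (KP i).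
by case: (KP j) => _; exact.
Qed.

Lemma polymap_lipschitz (F : T -> 'rV[R]_n) (C : R) : polymap F ->
  exists2 K, 0 <= K &
    forall x y d, box C x -> box C y -> 0 <= d -> close d x y ->
      `|F x - F y| <= K * d.
Proof.
move=> FP.
have /choice[K KP] : forall j, exists K : R, 0 <= K /\
    forall x y d, box C x -> box C y -> 0 <= d -> close d x y ->
      `|F x 0 j - F y 0 j| <= K * d.
  by move=> j; have [K K0 KP] := polyfun_lipschitz C (FP j); exists K.
have K0 j : 0 <= K j by case: (KP j).
exists (\sum_j K j) => [|x y d xC yC d0 xy]; first exact: sumr_ge0.
apply: norm_row_le => [|j]; first by rewrite mulr_ge0// sumr_ge0.
rewrite !mxE; case: (KP j) => _ /(_ _ _ _ xC yC d0 xy) /le_trans; apply.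
by rewrite ler_wpM2r// (bigD1 j)//= ler_wpDr// sumr_ge0.
Qed.

End Bounds.

Lemma box_scalar (C x : R) : `|x| <= C -> box C x.
Proof. by move=> xC []. Qed.

Lemma box_row n C (x : 'rV[R]_n) : `|x| <= C -> box C x.
Proof. by move=> xC j; exact: le_trans (norm_entry_le _ _) xC. Qed.

Lemma box_pair A B {cA : coords R A} {cB : coords R B} C (a : A) (b : B) :
  box C a -> box C b -> box C (a, b).
Proof. by move=> aC bC [i|i]; [exact: aC|exact: bC]. Qed.

Lemma close_refl A {cA : coords R A} d (a : A) : 0 <= d -> close d a a.
Proof. by move=> d0 i; rewrite subrr normr0. Qed.

Lemma close_scalar (d x y : R) : `|x - y| <= d -> close d x y.
Proof. by move=> xy []. Qed.

Lemma close_row n d (x y : 'rV[R]_n) : `|x - y| <= d -> close d x y.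
Proof.
by move=> xy j /=; have := norm_entry_le (x - y) j; rewrite !mxE => /le_trans; exact.
Qed.

Lemma close_pair A B {cA : coords R A} {cB : coords R B} d (a a' : A) (b b' : B) :
  close d a a' -> close d b b' -> close d (a, b) (a', b').
Proof. by move=> aC bC [i|i]; [exact: aC|exact: bC]. Qed.

(** Singles out one variable, the step or the time. Divisibility by a power of the step, primitives
    and antidifferences are then read off the coefficients [G i], which stay polynomial in the other
    variables. *)
Lemma polyfun_expand T {cT : coords R T} (F : R * T -> R) : polyfun F ->
  exists m (G : nat -> T -> R), (forall i, polyfun (G i)) /\
    forall h x, F (h, x) = \sum_(i < m) h ^+ i * G i x.
Proof.
elim=> [a|[i|i]|F1 F2 _ [m1 [G1 [P1 E1]]] _ [m2 [G2 [P2 E2]]]|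
        F1 F2 _ [m1 [G1 [P1 E1]]] _ [m2 [G2 [P2 E2]]]].
- exists 1%N, (fun _ _ => a); split=> [_|h x]; first exact: Polyfun_cst.
  by rewrite big_ord1 expr0 mul1r.
- exists 2%N, (fun i _ => (i == 1%N)%:R); split=> [j|h x]; first exact: Polyfun_cst.
  by rewrite !big_ord_recl big_ord0 /= mulr0 add0r mulr1 addr0.
- exists 1%N, (fun _ => coord i); split=> [_|h x]; first exact: Polyfun_coord.
  by rewrite big_ord1 expr0 mul1r.
- exists (m1 + m2)%N, (fun i x => (if (i < m1)%N then G1 i x else 0) +
      (if (i < m2)%N then G2 i x else 0)); split=> [i|h x].
    apply: Polyfun_add; [case: (i < m1)%N|case: (i < m2)%N] => //;
      exact: Polyfun_cst.
  rewrite E1 E2; rewrite [RHS](eq_bigr _ (fun i _ => mulrDr _ _ _)).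
  rewrite big_split /=; congr +%R.
    rewrite big_split_ord /= [X in _ = _ + X]big1 ?addr0 => [|i _].
      by apply: eq_bigr => i _; rewrite ltn_ord.
    by rewrite ltnNge leq_addr mulr0.
  rewrite addnC big_split_ord /= [X in _ = _ + X]big1 ?addr0 => [|i _].
    by apply: eq_bigr => i _; rewrite ltn_ord.
  by rewrite ltnNge leq_addr mulr0.
(* For fixed x both factors are univariate polynomials, whose product supplies the Cauchy
   convolution; [m1 + m2] bounds its size. *)
- pose P G m (x : T) := \poly_(i < m) (G i x : R).
  exists (m1 + m2)%N, (fun i x => \sum_(j < i.+1)
    (if (j < m1)%N then G1 j x else 0) *
    (if (i - j < m2)%N then G2 (i - j)%N x else 0)); split=> [i|h x].
    apply/polymapP/polymap_sum => j _; apply/polymapP/Polyfun_mul.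
      by case: (j < m1)%N => //; exact: Polyfun_cst.
    by case: (i - j < m2)%N => //; exact: Polyfun_cst.
  have E (G : nat -> T -> R) m : \sum_(i < m) h ^+ i * (G i x : R) = (P G m x).[h].
    by rewrite horner_poly; apply: eq_bigr => i _; rewrite mulrC.
  rewrite E1 E2 !E -hornerM (@horner_coef_wide _ (m1 + m2)).
    by apply: eq_bigr => i _; rewrite mulrC coefM; congr (_ * _);
       apply: eq_bigr => j _; rewrite !coef_poly.
  apply: (leq_trans (size_polyMleq _ _)).
  by apply: (leq_trans (leq_pred _)); rewrite leq_add// size_poly.
Qed.

(* Applied with [d = h ^+ s], this divides the increment of [F] by a power of
   the step while staying polynomial in the step. *)
Lemma polyfun_increment S T {cS : coords R S} {cT : coords R T}
    (F : T -> R) (a b : S -> T) (d : S -> R) (c : coord_ix -> S -> R) :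
  polyfun F -> polymap a -> polymap b -> polymap d -> (forall i, polyfun (c i)) ->
  (forall i s, coord i (b s) - coord i (a s) = d s * c i s) ->
  exists H : S -> R, polyfun H /\ forall s, F (b s) - F (a s) = d s * H s.
Proof.
move=> FP aP bP dP cP E; elim: FP => {F}
  [r|i|F1 F2 _ [H1 [P1 E1]] _ [H2 [P2 E2]]|F1 F2 P1' [H1 [P1 E1]] P2' [H2 [P2 E2]]].
- exists (fun=> 0); split; first exact: Polyfun_cst.
  by move=> s; rewrite subrr mulr0.
- by exists (c i); split.
- exists (fun s => H1 s + H2 s); split; first exact: Polyfun_add.
  by move=> s; rewrite mulrDr -E1 -E2; ring.
- exists (fun s => H1 s * F2 (b s) + F1 (a s) * H2 s); split.
    apply/polymapP; apply: polymapD; apply: polymapM; try exact/polymapP.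
      by apply: polymap_comp => //; exact/polymapP.
    by apply: polymap_comp => //; exact/polymapP.
  move=> s; transitivity ((F1 (b s) - F1 (a s)) * F2 (b s) + F1 (a s) * (F2 (b s) - F2 (a s))).
    by ring.
  by rewrite E1 E2; ring.
Qed.

Lemma polymap_increment S T {cS : coords R S} {cT : coords R T} n
    (F : T -> 'rV[R]_n) (a b : S -> T) (d : S -> R) (c : coord_ix -> S -> R) :
  polymap F -> polymap a -> polymap b -> polymap d -> (forall i, polyfun (c i)) ->
  (forall i s, coord i (b s) - coord i (a s) = d s * c i s) ->
  exists H : S -> 'rV[R]_n, polymap H /\ forall s, F (b s) - F (a s) = d s *: H s.
Proof.
move=> FP aP bP dP cP E.
have /choice[H HP] := fun j => polyfun_increment (FP j) aP bP dP cP E.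
exists (fun s => \row_j H j s); split=> [|s].
  apply: polymap_row => j; case: (HP j) => /polymapP + _.
  by apply: eq_polymap => x; rewrite mxE.
by apply/rowP => j; rewrite !mxE; case: (HP j) => _ /(_ s).
Qed.

End PolynomialMaps.

(** * Antiderivatives and antidifferences of polynomials *)

Ltac polymap_step :=
  match goal with
  | H : ?P |- ?P => exact H
  | |- polymap (fun _ => ?a) => exact (polymap_cst a)
  | |- polymap (fun x => x) => exact polymap_id
  | |- polymap fst => exact (polymap_fst polymap_id)
  | |- polymap snd => exact (polymap_snd polymap_id)
  | H : polymap ?F |- polymap (fun x => ?F (@?G x)) =>
      apply (polymap_comp H (G := G))
  | H : forall i, polymap (?F i) |- polymap (?F ?i) => exact (H i)
  | H : forall i, polymap (?F i) |- polymap (fun x => ?F ?i (@?G x)) =>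
      apply (polymap_comp (H i) (G := G))
  | |- polymap (fun x => fun_of_matrix _ _ _) => apply polymap_entry
  | |- polymap (fun x => (_, _)) => apply polymap_pair
  | |- polymap (fun x => fst _) => apply polymap_fst
  | |- polymap (fun x => snd _) => apply polymap_snd
  | |- polymap (fun x => _ ^+ _) => apply polymapX
  | |- polymap (fun x => _ * _) => apply polymapM
  | |- polymap (fun x => _ *: _) => apply polymapZv
  | |- @polymap _ _ ?T _ _ (fun x => _ - _) =>
      let T' := eval hnf in T in
      match T' with matrix _ _ _ => apply polymapBv | _ => apply polymapB end
  | |- @polymap _ _ ?T _ _ (fun x => _ + _) =>
      let T' := eval hnf in T in
      match T' with matrix _ _ _ => apply polymapDv | _ => apply polymapD end
  | |- polymap (fun x => - _) => apply polymapN
  end.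
Ltac polymap_tac := repeat polymap_step.

Section Calculus.
Context {R : realType}.

Lemma is_derive_horner (p : {poly R}) (t : R) :
  is_derive t 1 (horner p : R -> R) p^`().[t].
Proof.
apply: DeriveDef; first exact: derivable_horner.
by rewrite derivE derive1E.
Qed.

Definition primitive_poly (p : {poly R}) : {poly R} :=
  \poly_(i < (size p).+1) (p`_i.-1 / i%:R).

Lemma deriv_primitive_poly p : (primitive_poly p)^`() = p.
Proof.
apply/polyP => i; rewrite coef_deriv coef_poly ltnS.
case: ltnP => [_|/(nth_default 0) -> //]; last by rewrite mul0rn.
by rewrite -[LHS]mulr_natr divfK// pnatr_eq0.
Qed.

Lemma primitive_poly0 p : (primitive_poly p).[0] = 0.
Proof. by rewrite horner_coef0 coef_poly /= invr0 mulr0. Qed.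

Lemma polyfun_horner_expand T {cT : coords R T} (F : R * T -> R) : polyfun F ->
  exists m (G : nat -> T -> R), (forall i, polyfun (G i)) /\
    forall t x, F (t, x) = (\poly_(i < m) G i x).[t].
Proof.
move=> /polyfun_expand[m [G [GP E]]]; exists m, G; split=> // t x.
by rewrite E horner_poly; apply: eq_bigr => i _; rewrite mulrC.
Qed.

Lemma polyfun_primitive T {cT : coords R T} (A : R * T -> R) : polyfun A ->
  exists B : R * T -> R, [/\ polyfun B, forall x, B (0, x) = 0 &
    forall (t : R) x, is_derive t 1 (fun s : R => B (s, x)) (A (t, x))].
Proof.
move=> /polyfun_horner_expand[m [G [GP E]]].
pose P x := \sum_(i < m) (G i x / i.+1%:R) *: 'X^(i.+1).
exists (fun z => \sum_(i < m) z.1 ^+ i.+1 * (G i z.2 / i.+1%:R)); split.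
- apply/polymapP/polymap_sum => i _.
  have Gi : polymap (G i) by exact/polymapP.
  by polymap_tac.
- by move=> x; rewrite /= big1// => i _; rewrite expr0n mul0r.
- move=> t x; rewrite (_ : (fun _ => _) = horner (P x)); last first.
    apply/funext => s; rewrite /P horner_sum; apply: eq_bigr => i _ /=.
    by rewrite hornerZ hornerXn mulrC.
  rewrite (_ : A (t, x) = (P x)^`().[t]); first exact: is_derive_horner.
  rewrite E; congr (_.[t]); rewrite poly_def /P raddf_sum /=; apply: eq_bigr => i _.
  by rewrite derivZ derivXn /= -scalerMnr scalerMnl -mulr_natr divfK// pnatr_eq0.
Qed.

Lemma polymap_primitive T {cT : coords R T} n (A : R * T -> 'rV[R]_n) : polymap A ->
  exists B : R * T -> 'rV[R]_n, [/\ polymap B, forall x, B (0, x) = 0 &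
    forall (t : R) x j, is_derive t 1 (fun s : R => B (s, x) 0 j) (A (t, x) 0 j)].
Proof.
move=> AP; have /choice[B BP] := fun j => polyfun_primitive (AP j).
exists (fun z => \row_j B j z); split.
- apply: polymap_row => j; case: (BP j) => /polymapP + _ _.
  by apply: eq_polymap => z; rewrite mxE.
- by move=> x; apply/rowP => j; rewrite !mxE; case: (BP j).
- move=> t x j; case: (BP j) => _ _ /(_ t x).
  by rewrite (_ : (fun s => (\row_k B k (s, x)) 0 j) = fun s => B j (s, x))//;
     apply/funext => s; rewrite mxE.
Qed.

(** Up to a term constant in t, this is the homogenized Bernoulli polynomial h^(a+1) B_(a+1)(t/h) /
    (a+1). In (t+h)^(a+1) - t^(a+1) the term of degree a in t is (a+1) h t^a, and the lower ones are
    multiples of h t^i with i < a, which the earlier antidifferences remove. *)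
Lemma polyfun_antidifference_pow a :
  exists S : R * R -> R, [/\ polyfun S, forall h, S (0, h) = 0 &
    forall t h, S (t + h, h) - S (t, h) = h * t ^+ a].
Proof.
elim/ltn_ind: a => a IH.
have /choice[S SP] : forall i : 'I_a, exists S : R * R -> R, [/\ polyfun S, forall h, S (0, h) = 0 &
    forall t h, S (t + h, h) - S (t, h) = h * t ^+ i].
  by move=> i; exact: IH.
exists (fun z => (z.1 ^+ a.+1 -
  \sum_(i < a) (z.2 ^+ (a - i) *+ 'C(a.+1, i)) * S i z) / a.+1%:R); split.
- apply/polymapP; apply: polymapM; last exact: polymap_cst.
  apply: polymapB; first by polymap_tac.
  apply: polymap_sum => i _; apply: polymapM; last by apply/polymapP; case: (SP i).
  apply: (eq_polymap (G := fun z => z.2 ^+ (a - i) * 'C(a.+1, i)%:R)).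
    by move=> z; rewrite mulr_natr.
  by polymap_tac.
- move=> h; rewrite /= expr0n /= sub0r big1 ?oppr0 ?mul0r// => i _.
  by case: (SP i) => _ -> _; rewrite mulr0.
- move=> t h; rewrite -mulrBl /=.
  apply: (canLR (mulfK _)); first by rewrite pnatr_eq0.
  transitivity ((t + h) ^+ a.+1 - t ^+ a.+1 -
    \sum_(i < a) h ^+ (a - i) *+ 'C(a.+1, i) * (h * t ^+ i)).
    have E (a1 b1 a2 b2 : R) : a1 - b1 - (a2 - b2) = a1 - a2 - (b1 - b2) by ring.
    rewrite {}E; congr (_ - _).
    rewrite -sumrB; apply: eq_bigr => i _.
    by rewrite -mulrBr; case: (SP i) => _ _ ->.
  rewrite [t + h]addrC exprDn big_ord_recr /= subnn expr0 mul1r binn mulr1n addrK.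
  rewrite big_ord_recr /= subSn// subnn expr1 binSn mulr_natr addrAC.
  rewrite -sumrB big1 ?add0r ?mulrnAr// => i _.
  rewrite subSn; last exact: ltnW.
  by rewrite exprS mulrnAl -mulrnBl; rewrite (_ : _ - _ = 0) ?mul0rn//; ring.
Qed.

Lemma polyfun_antidifference (A : R * R -> R) : polyfun A ->
  exists S : R * R -> R, [/\ polyfun S, forall h, S (0, h) = 0 &
    forall t h, S (t + h, h) - S (t, h) = h * A (t, h)].
Proof.
move=> /polyfun_expand[m [G [GP E]]].
have /choice[S SP] := polyfun_antidifference_pow.
exists (fun z => \sum_(i < m) G i z.2 * S i z); split.
- apply/polymapP/polymap_sum => i _; apply: polymapM.
    by apply: polymap_comp; [exact/polymapP|polymap_tac].
  by apply/polymapP; case: (SP i).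
- by move=> h; rewrite /= big1// => i _; case: (SP i) => _ -> _; rewrite mulr0.
- move=> t h; rewrite E mulr_sumr -sumrB; apply: eq_bigr => i _ /=.
  by rewrite -mulrBr; case: (SP i) => _ _ ->; ring.
Qed.

Lemma polymap_antidifference n (A : R * R -> 'rV[R]_n) : polymap A ->
  exists S : R * R -> 'rV[R]_n, [/\ polymap S, forall h, S (0, h) = 0 &
    forall t h, S (t + h, h) - S (t, h) = h *: A (t, h)].
Proof.
move=> AP; have /choice[S SP] := fun j => polyfun_antidifference (AP j).
exists (fun z => \row_j S j z); split.
- apply: polymap_row => j; case: (SP j) => /polymapP + _ _.
  by apply: eq_polymap => z; rewrite mxE.
- by move=> x; apply/rowP => j; rewrite !mxE; case: (SP j).
- by move=> t h; apply/rowP => j; rewrite !mxE; case: (SP j) => _ _ /(_ t h).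
Qed.

(* Discrete Picard iteration: one more antidifference gains one more power of
   the step in the defect. *)
Lemma one_step_expansion n (F : (R * R) * 'rV[R]_n -> 'rV[R]_n) (M N : nat) :
  polymap F ->
  exists eta : R * R -> 'rV[R]_n, [/\ polymap eta, forall h, eta (0, h) = 0 &
    exists2 C, 0 <= C & forall h m, 0 < h <= 1 -> (m <= M)%N ->
      `|eta (m.+1%:R * h, h) - eta (m%:R * h, h)
         - h *: F (m%:R * h, h, eta (m%:R * h, h))| <= C * h ^+ N.+1].
Proof.
move=> FP; elim: N => [|N [eta [etaP eta0 [C C0 etaC]]]].
  exists (fun=> 0); split=> //; first exact: polymap_cst.
  have [K K0 FK] := polymap_bounded (M%:R + 1) FP.
  exists K => // h m /andP[h0 h1] mM; rewrite subrr add0r normrN normrZ expr1.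
  rewrite mulrC gtr0_norm// ler_wpM2r ?(ltW h0)// FK//.
  have mh : `|m%:R * h| <= M%:R + 1.
    rewrite ger0_norm ?mulr_ge0 ?(ltW h0)// -[leRHS]mulr1.
    by rewrite ler_pM ?(ltW h0)// ler_wpDr// ler_nat.
  apply: box_pair; first apply: box_pair; try exact: box_scalar.
    by apply: box_scalar; rewrite gtr0_norm// (le_trans h1)// lerDr.
  by apply: box_row; rewrite normr0 addr_ge0.
have GP : polymap (fun z => F (z, eta z)) by polymap_tac.
have [S [SP S0 SE]] := polymap_antidifference GP.
exists S; split => //.
have [K1 K10 etaK] := polymap_bounded (M%:R + 1) etaP.
have [K2 K20 SK] := polymap_bounded (M%:R + 1) SP.
have [L L0 FL] := polymap_lipschitz (M%:R + 1 + K1 + K2) FP.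
exists (L * (M%:R * C)) => [|h m /andP[h0 h1] mM]; first by rewrite !mulr_ge0.
(* Both functions vanish at t = 0 and the increments of their difference are minus the old defects,
   so at most [M] defects accumulate. The new defect is h times a difference of values of [F],
   whence the gained power and the constant [L * (M%:R * C)]. *)
have dS k : (k <= M)%N -> `|S (k%:R * h, h) - eta (k%:R * h, h)| <= k%:R * C * h ^+ N.+1.
  elim: k => [|k IH] kM.
    by rewrite mul0r S0 eta0 subrr normr0 !mul0r.
  rewrite (_ : _ - _ = (S (k%:R * h, h) - eta (k%:R * h, h)) -
    (eta (k.+1%:R * h, h) - eta (k%:R * h, h) - h *: F (k%:R * h, h, eta (k%:R * h, h)))).
    apply: (@le_trans _ _ (k%:R * C * h ^+ N.+1 + C * h ^+ N.+1)); last first.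
      by rewrite -[in leRHS]natr1 !mulrDl mul1r.
    apply: (le_trans (ler_normB _ _)).
    by apply: lerD; [exact/IH/ltnW|apply: etaC; [rewrite h0|exact: ltnW]].
  have -> : k.+1%:R * h = k%:R * h + h by rewrite -natr1 mulrDl mul1r.
  have /(canRL (subrK _)) -> := SE (k%:R * h) h.
  by apply/rowP => j; rewrite !mxE; ring.
have -> : S (m.+1%:R * h, h) = h *: F (m%:R * h, h, eta (m%:R * h, h)) + S (m%:R * h, h).
  by rewrite -SE -natr1 mulrDl mul1r subrK.
rewrite addrK -scalerBr normrZ gtr0_norm// [h ^+ _]exprS mulrCA ler_wpM2l ?(ltW h0)//.
have mh : `|m%:R * h| <= M%:R + 1.
  rewrite ger0_norm ?mulr_ge0 ?(ltW h0)// -[leRHS]mulr1.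
  by rewrite ler_pM ?(ltW h0)// ler_wpDr// ler_nat.
have hB : `|h| <= M%:R + 1 by rewrite gtr0_norm// (le_trans h1)// lerDr.
have zB : box (M%:R + 1) (m%:R * h, h) by apply: box_pair; exact: box_scalar.
have zB' : box (M%:R + 1 + K1 + K2) (m%:R * h, h).
  by apply: box_pair; apply: box_scalar; rewrite -addrA ler_wpDr// addr_ge0.
rewrite -mulrA; apply: FL.
- apply: box_pair => //; apply: box_row; apply: (le_trans (etaK _ zB)).
  by rewrite addrAC lerDr !addr_ge0.
- apply: box_pair => //; apply: box_row; apply: (le_trans (SK _ zB)).
  by rewrite lerDr !addr_ge0.
- by rewrite !mulr_ge0// exprn_ge0// ltW.
- apply: close_pair; first by apply: close_refl; rewrite !mulr_ge0// exprn_ge0// ltW.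
  apply: close_row; rewrite distrC; apply: (le_trans (dS _ mM)).
  by rewrite ler_wpM2r ?exprn_ge0 ?(ltW h0)// ler_wpM2r// ler_nat.
Qed.

End Calculus.

(** * Picard iteration for the stages of an ARK step *)

Section ArkStep.
Context {R : realType} {L : nat} (S : ark_method R L) {n : nat}.
Notation p := (ark_stages S).
Implicit Types g : 'I_L -> R * 'rV[R]_n * R -> 'rV[R]_n.

(* Arguments are packed as [((h, t), x, e)]: step, time, state, parameter. *)
Fixpoint picard_stage g (k : nat) (i : 'I_p) (z : R * R * 'rV[R]_n * R) : 'rV[R]_n :=
  if k is k'.+1 then
    z.1.2 + z.1.1.1 *: \sum_(nu < L) \sum_(j < p) ark_a S nu i j *:
      g nu (z.1.1.2 + ark_c S nu j * z.1.1.1, picard_stage g k' j z, z.2)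
  else z.1.2.

Definition picard_slope g k (z : R * R * 'rV[R]_n * R) : 'rV[R]_n :=
  \sum_(nu < L) \sum_(i < p) ark_b S nu i *:
    g nu (z.1.1.2 + ark_c S nu i * z.1.1.1, picard_stage g k i z, z.2).

Definition picard_step g k (z : R * R * 'rV[R]_n * R) : 'rV[R]_n :=
  z.1.2 + z.1.1.1 *: picard_slope g k z.

Lemma polymap_picard_stage g k i :
  (forall nu, polymap (g nu)) -> polymap (picard_stage g k i).
Proof.
move=> gP; elim: k i => [|k IH] i /=; first by polymap_tac.
apply: polymapDv; first by polymap_tac.
apply: polymapZv; first by polymap_tac.
apply: polymap_sumv => nu _; apply: polymap_sumv => j _.
have gnu := gP nu; have IHj := IH j.
by polymap_tac.
Qed.

Lemma polymap_picard_slope g k :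
  (forall nu, polymap (g nu)) -> polymap (picard_slope g k).
Proof.
move=> gP; apply: polymap_sumv => nu _; apply: polymap_sumv => j _.
have gnu := gP nu; have IHj := polymap_picard_stage k j gP.
by polymap_tac.
Qed.

Lemma polymap_picard_step g k :
  (forall nu, polymap (g nu)) -> polymap (picard_step g k).
Proof.
move=> gP; have slopeP := polymap_picard_slope k gP.
rewrite /picard_step; by polymap_tac.
Qed.

Lemma norm_lincomb_le (a : 'I_L -> 'I_p -> R) (v : 'I_L -> 'I_p -> 'rV[R]_n) D :
  (forall nu j, `|v nu j| <= D) ->
  `|\sum_(nu < L) \sum_(j < p) a nu j *: v nu j|
    <= (\sum_(nu < L) \sum_(j < p) `|a nu j|) * D.
Proof.
move=> vD; rewrite mulr_suml; apply: (le_trans (ler_norm_sum _ _ _)).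
apply: ler_sum => nu _; rewrite mulr_suml; apply: (le_trans (ler_norm_sum _ _ _)).
by apply: ler_sum => j _; rewrite normrZ ler_wpM2l.
Qed.

Lemma ark_abscissa_le h nu j : 0 < h <= 1 ->
  `|ark_c S nu j * h| <= \sum_(mu < L) \sum_(k < p) `|ark_c S mu k|.
Proof.
move=> /andP[h0 h1]; rewrite normrM (gtr0_norm h0).
apply: (@le_trans _ _ `|ark_c S nu j|); first by rewrite ler_piMr.
rewrite (bigD1 nu)//= (bigD1 j)//= -addrA lerDl addr_ge0//.
  by rewrite sumr_ge0.
by rewrite sumr_ge0// => mu _; rewrite sumr_ge0.
Qed.

(* An ARK step whose slopes [gam] are only approximately those of the field
   [G], compared with the Picard polynomials of the field [g] obtained from [G]
   by the scaling [x |-> e ^+ s *: x]. *)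
Lemma ark_step_picard (G g : 'I_L -> R * 'rV[R]_n * R -> 'rV[R]_n) s N C :
  (forall nu, polymap (G nu)) -> (forall nu, polymap (g nu)) ->
  (forall nu t x e, G nu (t, e ^+ s *: x, e) = e ^+ s *: g nu (t, x, e)) ->
  0 <= C ->
  exists2 C', 0 <= C' & forall h t e x theta w z gam,
    0 < h <= 1 -> `|t| <= C -> `|e| <= C -> `|x| <= C ->
    `|theta - e ^+ s *: x| <= C * h ^+ N.+1 ->
    (forall i, `|z i - theta| <= C * h) ->
    (forall nu i, `|gam nu i - G nu (t + ark_c S nu i * h, z i, e)| <= C * h ^+ N) ->
    (forall i, z i = theta + h *: \sum_(nu < L) \sum_(j < p) ark_a S nu i j *: gam nu j) ->
    w = theta + h *: \sum_(nu < L) \sum_(i < p) ark_b S nu i *: gam nu i ->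
    `|w - e ^+ s *: picard_step g N (h, t, x, e)| <= C' * h ^+ N.+1.
Proof.
move=> GP gP Gg C0.
pose c := \sum_(nu < L) \sum_(j < p) `|ark_c S nu j|.
have c0 : 0 <= c by rewrite sumr_ge0// => nu _; rewrite sumr_ge0.
have /choice[B BP] : forall ki : 'I_N.+1 * 'I_p, exists B, 0 <= B /\
    forall z, box (C + 1) z -> `|picard_stage g ki.1 ki.2 z| <= B.
  move=> -[k i]; have [B B0 BP] := polymap_bounded (C + 1) (polymap_picard_stage k i gP).
  by exists B.
have B0 ki : 0 <= B ki by case: (BP ki).
(* One box for every point where [G] is compared: [C + c] bounds the abscissae, [C ^+ s * C + C + C]
   the actual stages, and the last summand the scaled Picard stages of all levels. *)
pose D := C + c + C ^+ s * C + C + C + C ^+ s * \sum_ki B ki.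
have D1 : 0 <= C ^+ s * C by rewrite mulr_ge0// exprn_ge0.
have D2 : 0 <= C ^+ s * \sum_ki B ki by rewrite mulr_ge0 ?exprn_ge0// sumr_ge0.
have /choice[K KP] : forall nu, exists K, 0 <= K /\ forall x y d, box D x -> box D y ->
    0 <= d -> close d x y -> `|G nu x - G nu y| <= K * d.
  by move=> nu; have [K K0 KP] := polymap_lipschitz D (GP nu); exists K.
have K0 nu : 0 <= K nu by case: (KP nu).
pose lip := \sum_nu K nu.
have lip0 : 0 <= lip by rewrite sumr_ge0.
pose a i := \sum_(nu < L) \sum_(j < p) `|ark_a S nu i j|.
have a0 i : 0 <= a i by rewrite sumr_ge0// => nu _; rewrite sumr_ge0.
pose A := \sum_i a i; have A0 : 0 <= A by rewrite sumr_ge0.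
pose b := \sum_(nu < L) \sum_(j < p) `|ark_b S nu j|.
have b0 : 0 <= b by rewrite sumr_ge0// => nu _; rewrite sumr_ge0.
(* Stage error constants: at level k the stages differ by at most [E k * h ^+ k.+1]. Each iteration
   multiplies the previous error by h, up to the errors of [theta] and of the slopes. *)
pose E := fix E k := if k is k'.+1 then C + A * (C + lip * E k') else C + C.
have E0 k : 0 <= E k.
  by elim: k => [|k IH] /=; rewrite ?addr_ge0 ?mulr_ge0 ?addr_ge0 ?mulr_ge0.
exists (C + b * (C + lip * E N)) => [|h t e x theta w z gam h01 tC eC xC thetaC zC gamC zE ->].
  by rewrite ?addr_ge0 ?mulr_ge0 ?addr_ge0 ?mulr_ge0.
have /andP[h0 h1] := h01.
have hN0 k : 0 <= h ^+ k by rewrite exprn_ge0// ltW.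
have hle k : h ^+ k <= 1 by rewrite exprn_ile1// ltW.
have es : `|e ^+ s| <= C ^+ s by rewrite normrX lerXn2r// nnegrE.
have boxz : box (C + 1) (h, t, x, e).
  have C1 : C <= C + 1 by rewrite lerDl.
  apply: box_pair; first apply: box_pair; first apply: box_pair.
  - by apply: box_scalar; rewrite gtr0_norm// (le_trans h1)// lerDr.
  - by apply: box_scalar; exact: le_trans C1.
  - by apply: box_row; exact: le_trans C1.
  - by apply: box_scalar; exact: le_trans C1.
have boxt nu j : `|t + ark_c S nu j * h| <= D.
  apply: (le_trans (ler_normD _ _)).
  apply: (@le_trans _ _ (C + c)); first by rewrite lerD// ark_abscissa_le.
  by rewrite /D -!addrA lerD2l lerDl !addr_ge0.
have boxe : `|e| <= D by apply: le_trans eC _; rewrite /D -!addrA lerDl !addr_ge0.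
have boxzi i : `|z i| <= D.
  rewrite (_ : z i = (z i - theta) + (theta - e ^+ s *: x) + e ^+ s *: x); last first.
    by rewrite addrA !subrK.
  apply: (@le_trans _ _ (C + C + C ^+ s * C)).
    apply: (le_trans (ler_normD _ _)); apply: lerD; last first.
      by rewrite normrZ ler_pM.
    apply: (le_trans (ler_normD _ _)); apply: lerD.
      by apply: (le_trans (zC i)); rewrite ler_piMr.
    by apply: (le_trans thetaC); rewrite ler_piMr.
  rewrite /D (_ : _ + _ + _ = C ^+ s * C + C + C); last by ring.
  rewrite (_ : C + c + _ + _ + _ + _ = C ^+ s * C + C + C + (C + c + C ^+ s * \sum_ki B ki)); last by ring.
  by rewrite lerDl !addr_ge0.
have boxst k i : (k <= N)%N -> `|e ^+ s *: picard_stage g k i (h, t, x, e)| <= D.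
  move=> kN; rewrite normrZ; apply: (@le_trans _ _ (C ^+ s * \sum_ki B ki)).
    apply: ler_pM => //; have kN1 : (k < N.+1)%N by [].
    case: (BP (Ordinal kN1, i)) => _ /(_ _ boxz) /le_trans; apply.
    by rewrite (bigD1 (Ordinal kN1, i))//= lerDl sumr_ge0.
  by rewrite /D lerDr !addr_ge0.
(* The homogeneity [Gg] moves the factor [e ^+ s] inside [G], so only the Lipschitz constant of [G]
   enters. Nothing is divided by [e ^+ s], and the estimate is uniform as e tends to 0. *)
have cmp k nu i d : (k <= N)%N -> 0 <= d ->
    `|z i - e ^+ s *: picard_stage g k i (h, t, x, e)| <= d ->
    `|gam nu i - e ^+ s *: g nu (t + ark_c S nu i * h, picard_stage g k i (h, t, x, e), e)|
      <= C * h ^+ N + lip * d.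
  move=> kN d0 dd; rewrite -Gg.
  apply: (le_trans (ler_distD (G nu (t + ark_c S nu i * h, z i, e)) _ _)).
  apply: lerD; first exact: gamC.
  case: (KP nu) => _ Knu; apply: (@le_trans _ _ (K nu * d)).
    apply: Knu => //.
    - apply: box_pair; last exact: box_scalar.
      by apply: box_pair; [exact: box_scalar|exact: box_row].
    - apply: box_pair; last exact: box_scalar.
      by apply: box_pair; [exact: box_scalar|apply: box_row; exact: boxst].
    - apply: close_pair; last exact: close_refl.
      by apply: close_pair; [exact: close_refl|exact: close_row].
  by rewrite ler_wpM2r// /lip (bigD1 nu)//= lerDl sumr_ge0.
have stE k : (k <= N)%N -> forall i,
    `|z i - e ^+ s *: picard_stage g k i (h, t, x, e)| <= E k * h ^+ k.+1.
  elim: k => [|k IH] kN i /=.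
    rewrite mulrDl; apply: (le_trans (ler_distD theta _ _)); apply: lerD; first exact: zC.
    apply: (le_trans thetaC); rewrite ler_wpM2l//.
    by rewrite exprS expr1 ler_piMr// ltW.
  rewrite zE scalerDr scalerA [e ^+ s * h]mulrC -scalerA opprD addrACA -scalerBr.
  rewrite mulrDl; apply: (le_trans (ler_normD _ _)); apply: lerD.
    apply: (le_trans thetaC); rewrite ler_wpM2l//.
    by rewrite ler_wiXn2l// ltW.
  rewrite normrZ (gtr0_norm h0) [h ^+ _]exprS mulrCA ler_wpM2l ?(ltW h0)//.
  rewrite scaler_sumr -sumrB.
  under eq_bigr => nu _ do (rewrite scaler_sumr -sumrB;
    under eq_bigr => j _ do rewrite scalerA mulrC -scalerA -scalerBr).
  apply: (le_trans (norm_lincomb_le _ _)) => [nu j|].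
    exact: (cmp k nu j _ (ltnW kN) (mulr_ge0 (E0 k) (hN0 k.+1)) (IH (ltnW kN) j)).
  rewrite -/(a i) -mulrA; apply: ler_pM => //.
  - by rewrite addr_ge0 ?mulr_ge0.
  - by rewrite /A (bigD1 i)//= lerDl sumr_ge0.
  - by rewrite mulrDl -mulrA lerD// ler_wpM2l// ler_wiXn2l// ltW.
rewrite /picard_step /= scalerDr scalerA [e ^+ s * h]mulrC -scalerA opprD addrACA -scalerBr.
rewrite mulrDl; apply: (le_trans (ler_normD _ _)); apply: lerD => //.
rewrite normrZ (gtr0_norm h0) [h ^+ _]exprS mulrCA ler_wpM2l ?(ltW h0)//.
rewrite /picard_slope scaler_sumr -sumrB /=.
under eq_bigr => nu _ do (rewrite scaler_sumr -sumrB;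
  under eq_bigr => j _ do rewrite scalerA mulrC -scalerA -scalerBr).
apply: (le_trans (norm_lincomb_le _ _)) => [nu j|].
  exact: (cmp N nu j _ (leqnn N) (mulr_ge0 (E0 N) (hN0 N.+1)) (stE N (leqnn N) j)).
rewrite -/b -mulrA ler_wpM2l// mulrDl -mulrA lerD// ler_wpM2l// ler_wpM2l//.
by rewrite ler_wiXn2l// ltW.
Qed.

End ArkStep.

(** * Differentiability of polynomial maps *)

Section Differentiability.
Context {R : realType}.

Lemma entry_linear n (j : 'I_n) : exists2 l : {linear 'rV[R]_n -> R},
  continuous l & (fun x : 'rV[R]_n => x 0 j) = l.
Proof.
have lin : linear (fun x : 'rV[R]_n => x 0 j : R^o) by move=> a x y; rewrite !mxE.
pose l : {linear 'rV[R]_n -> R} :=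
  HB.pack (fun x : 'rV[R]_n => x 0 j) (GRing.isLinear.Build _ _ _ _ _ lin).
by exists l => //; exact: coord_continuous.
Qed.

Definition linear_coords (V : normedModType R) (cV : coords R V) : Prop :=
  forall i, exists2 l : {linear V -> R}, continuous l & coord i = l :> (V -> R).

Lemma differentiable_diff_within (V W : normedModType R) (D : set V) (f : V -> W) x :
  differentiable f x -> has_diff_within D f x ('d f x).
Proof.
move=> df; split; first exact: diff_continuous.
apply/eqoP => e e0.
have H : \forall h \near (0 : V), `|f (h + x) - (f x + 'd f x h)| <= e * `|h|.
  by have /eqaddoP /(_ _ e0) := diff_locally df.
apply: cvg_within; move: H; rewrite (near_shift x) sub0r; apply: filterS => y /=.
by rewrite subrK opprD addrA.
Qed.

Lemma diff_entry (V : normedModType R) n (F : V -> 'rV[R]_n) x v j :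
  differentiable F x -> 'd F x v 0 j = 'd (fun y => F y 0 j) x v.
Proof.
move=> dF.
have := @diff_comp _ _ _ _ F (fun M : 'rV[R]_n => M 0 j) x dF (differentiable_coord _ _ _).
rewrite (_ : (fun M : 'rV[R]_n => M 0 j) \o F = fun y => F y 0 j)// => ->.
have [l lc E] := entry_linear j; rewrite E diff_lin//= -E.
by [].
Qed.

Section PolyDiff.
Context {V : normedModType R} {cV : coords R V}.
Hypothesis cVlin : linear_coords cV.

Lemma polyfun_diff (F : V -> R) : polyfun F ->
  (forall x, differentiable F x) /\ forall v, polyfun (fun x => 'd F x v).
Proof.
elim=> {F} [a|i|F G _ [dF PF] _ [dG PG]|F G FP [dF PF] GP [dG PG]].
- split=> [x|v]; first exact: differentiable_cst.
  rewrite (_ : (fun _ => _) = fun=> 0); first exact: Polyfun_cst.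
  by apply/funext => x; rewrite diff_cst.
- have [l lc ->] := cVlin i; split=> [x|v]; first exact: linear_differentiable.
  rewrite (_ : (fun _ => _) = fun=> l v); first exact: Polyfun_cst.
  by apply/funext => x; rewrite diff_lin.
- split=> [x|v]; first exact: differentiableD.
  rewrite (_ : (fun _ => _) = fun x => 'd F x v + 'd G x v); first exact: Polyfun_add.
  by apply/funext => x; rewrite (diffD (dF x) (dG x)).
- split=> [x|v]; first exact: differentiableM.
  apply/polymapP; apply: (eq_polymap (G := fun x => F x * 'd G x v + G x * 'd F x v)).
    by move=> x; rewrite (diffM (dF x) (dG x)).
  by apply: polymapD; apply: polymapM; exact/polymapP.
Qed.

Lemma polymap_diff n (F : V -> 'rV[R]_n) : polymap F ->
  (forall x, differentiable F x) /\ forall v, polymap (fun x => 'd F x v).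
Proof.
move=> FP.
have dFj j x : differentiable (fun y => F y 0 j) x by case: (polyfun_diff (FP j)).
have dF x : differentiable F x.
  rewrite (_ : F = \sum_j (fun y => F y 0 j *: delta_mx 0 j)).
    by apply: differentiable_sum => j; exact: differentiableZl.
  apply/funext => y; rewrite fct_sumE {1}[F y]matrix_sum_delta big_ord1.
  by [].
split=> // v; apply: polymap_row => j; apply/polymapP.
have [_ /(_ v)] := polyfun_diff (FP j).
rewrite (_ : (fun _ => _) = fun x => 'd F x v 0 j)//; apply/funext => x.
by rewrite diff_entry.
Qed.

(** Directional derivatives of polynomial maps are polynomial maps, so the recursion never stops.
    Polynomial problems are therefore smooth enough for any [K] that the order hypothesis asks
    for. *)
Lemma times_differentiable_polymap n (D : set V) k (F : V -> 'rV[R]_n) :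
  polymap F -> times_differentiable k D F.
Proof.
elim: k F => // k IH F /polymap_diff[dF PF] /=.
exists (fun x => 'd F x); split=> [x _|v]; last exact: IH.
exact: differentiable_diff_within.
Qed.

End PolyDiff.

Lemma linear_coords_scalar : @linear_coords R^o (coords_scalar R).
Proof.
rewrite /linear_coords => -[].
have lin : linear (fun x : R^o => x : R^o) by [].
pose l : {linear R^o -> R} :=
  HB.pack (fun x : R^o => x : R) (GRing.isLinear.Build _ _ _ _ _ lin).
by exists l => // x; exact: cvg_id.
Qed.

Lemma linear_coords_time_state n :
  @linear_coords (R^o * 'rV[R]_n)%type (coords_prod (coords_scalar R) (coords_row R n)).
Proof.
rewrite /linear_coords => -[i|j].
  have lin : linear (fun x : R^o * 'rV[R]_n => x.1 : R^o) by [].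
  pose l : {linear (R^o * 'rV[R]_n)%type -> R} :=
    HB.pack (fun x : R^o * 'rV[R]_n => x.1 : R) (GRing.isLinear.Build _ _ _ _ _ lin).
  by exists l => // x; exact: cvg_fst.
have [l lc E] := entry_linear j.
have lin : linear (fun x : R^o * 'rV[R]_n => l x.2 : R^o).
  by move=> a x y; rewrite /= linearP.
pose l' : {linear (R^o * 'rV[R]_n)%type -> R} :=
  HB.pack (fun x : R^o * 'rV[R]_n => l x.2) (GRing.isLinear.Build _ _ _ _ _ lin).
exists l'; last by apply/funext => x; rewrite /= -E.
by move=> x; apply: continuous_comp; [exact: cvg_snd|exact: lc].
Qed.

(** Translates entrywise derivatives, which the constructions of primitives provide, into the
    first-order expansion required by [solves_ivp]. *)
Lemma polymap_curve_expansion n (w : R -> 'rV[R]_n) (D : set R) (t : R) (v : 'rV[R]_n) :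
  polymap w -> (forall j, is_derive t 1 (fun s => w s 0 j) (v 0 j)) ->
  (fun s : R => w s - w t - (s - t) *: v) =o_ (within D (nbhs t)) (fun s : R => s - t : R^o).
Proof.
move=> wP wd.
have [dw _] := polymap_diff linear_coords_scalar wP.
have [_] := differentiable_diff_within D (dw t).
rewrite (_ : (fun y => w y - w t - 'd w t (y - t)) = fun s : R => w s - w t - (s - t) *: v)//.
apply/funext => s; congr (_ - _).
transitivity ((s - t) *: 'd w t (1 : R^o)).
  by rewrite -linearZ; congr ('d w t _); rewrite /GRing.scale /= mulr1.
congr (_ *: _).
apply/rowP => j; rewrite (diff_entry _ _ (dw t)) -deriveE.
  exact: derive_val.
by have [/(_ t)] := polyfun_diff linear_coords_scalar (wP j).
Qed.

Lemma horner_drop_poly (P : {poly R}) k h : (forall i, (i < k)%N -> P`_i = 0) ->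
  P.[h] = h ^+ k * (drop_poly k P).[h].
Proof.
move=> Pk; rewrite -{1}(poly_take_drop k P) hornerD hornerM hornerXn mulrC.
rewrite (_ : take_poly k P = 0) ?horner0 ?add0r//.
by apply/polyP => l; rewrite coef_take_poly coef0; case: ifP => // /Pk.
Qed.

(** Once the coefficients below k are known to vanish, a bound C h^(k+1) on P gives a bound C h on P
    / h^k, whose limit at 0 is the coefficient of index k. *)
Lemma horner_coef_eq0 (P : {poly R}) k C :
  (\forall h \near 0^'+, `|P.[h]| <= C * h ^+ k) -> forall i, (i < k)%N -> P`_i = 0.
Proof.
elim: k => // k IH PC.
have Pk : forall i, (i < k)%N -> P`_i = 0.
  apply: IH; near=> h.
  have h0 : 0 < h by near: h; exact: nbhs_right_gt.
  have h1 : h <= 1 by near: h; exact: nbhs_right_le.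
  have PCh : `|P.[h]| <= C * h ^+ k.+1 by near: h.
  have C0 : 0 <= C by rewrite -(pmulr_lge0 _ (exprn_gt0 k.+1 h0)) (le_trans _ PCh).
  by apply: (le_trans PCh); rewrite ler_wpM2l// ler_wiXn2l// ltW.
move=> i; rewrite ltnS leq_eqVlt => /predU1P[->|]; last exact: Pk.
pose Q := drop_poly k P.
have PQ h : P.[h] = h ^+ k * Q.[h] by exact: horner_drop_poly.
have -> : P`_k = Q.[0] by rewrite horner_coef0 coef_drop_poly.
have Qc : `|Q.[h]| @[h --> 0^'+] --> `|Q.[0]|.
  apply: cvg_norm; apply: cvg_within_filter; exact: continuous_horner.
have Cc : C * h @[h --> 0^'+] --> C * 0.
  by apply: cvgMr; apply: cvg_within_filter; exact: cvg_id.
apply/eqP; rewrite -normr_le0; rewrite mulr0 in Cc.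
apply: (ler_cvg_to Qc Cc).
near=> h.
have h0 : 0 < h by near: h; exact: nbhs_right_gt.
have PCh : `|P.[h]| <= C * h ^+ k.+1 by near: h.
move: PCh; rewrite PQ normrM gtr0_norm ?exprn_gt0// exprS mulrA mulrC.
by rewrite ler_pM2r ?exprn_gt0.
Unshelve. all: by end_near. Qed.

End Differentiability.

(** * Solvability of the stage equations *)

(** The stages of one step are stacked into a matrix, and Banach's fixed point theorem is applied in
    the complete space of such matrices. *)
HB.instance Definition _ (R : realType) m n :=
  Uniform_isComplete.Build 'M[R]_(m, n) (@cauchy_cvg 'M[R]_(m, n)).

Section ArkOrder.
Context {R : realType} {L : nat} (S : ark_method R L) {n : nat}.
Notation p := (ark_stages S).
Implicit Types g : 'I_L -> R * 'rV[R]_n * R -> 'rV[R]_n.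

Lemma norm_mx_le m k (Z : 'M[R]_(m, k)) C :
  0 <= C -> (forall i, `|row i Z| <= C) -> `|Z| <= C.
Proof.
move=> C0 ZC; rewrite /Num.norm /= mx_normrE; apply: bigmax_le => //= -[i j] _ /=.
by have := le_trans (norm_entry_le (row i Z) j) (ZC i); rewrite mxE.
Qed.

Lemma norm_mx_row_le m k (Z : 'M[R]_(m, k)) i : `|row i Z| <= `|Z|.
Proof.
apply: norm_row_le => // j; rewrite mxE [leRHS]/Num.norm /= mx_normrE.
by apply/bigmax_geP; right; exists (i, j).
Qed.

(** The order hypothesis says something only about steps that exist, so implicit stages must first
    be solved. The bound 1 serves as the radius in [ark_step]; the bound [C * h] is what the
    comparison with Picard polynomials needs. *)
Lemma ark_stages_exist g t e (w : 'rV[R]_n) : (forall nu, polymap (g nu)) ->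
  exists2 h0, 0 < h0 <= 1 & exists2 C, 0 <= C & forall h, 0 < h < h0 ->
  exists z : 'I_p -> 'rV[R]_n, [/\ forall i, `|z i - w| <= 1,
    forall i, `|z i - w| <= C * h &
    forall i, z i = w + h *: \sum_(nu < L) \sum_(j < p) ark_a S nu i j *:
      g nu (t + ark_c S nu j * h, z j, e)].
Proof.
move=> gP.
pose c := \sum_(nu < L) \sum_(j < p) `|ark_c S nu j|.
have c0 : 0 <= c by rewrite sumr_ge0// => nu _; rewrite sumr_ge0.
pose D := `|t| + c + (`|w| + 1) + `|e|.
have /choice[B BP] : forall nu, exists B, 0 <= B /\
    forall z, box D z -> `|g nu z| <= B.
  by move=> nu; have [B B0 BP] := polymap_bounded D (gP nu); exists B.
have /choice[K KP] : forall nu, exists K, 0 <= K /\ forall x y d, box D x -> box D y ->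
    0 <= d -> close d x y -> `|g nu x - g nu y| <= K * d.
  by move=> nu; have [K K0 KP] := polymap_lipschitz D (gP nu); exists K.
have B0 nu : 0 <= B nu by case: (BP nu).
have K0 nu : 0 <= K nu by case: (KP nu).
pose a i := \sum_(nu < L) \sum_(j < p) `|ark_a S nu i j|.
have a0 i : 0 <= a i by rewrite sumr_ge0// => nu _; rewrite sumr_ge0.
pose A := \sum_i a i; have A0 : 0 <= A by rewrite sumr_ge0.
pose b := \sum_nu B nu; have b0 : 0 <= b by rewrite sumr_ge0.
pose lip := \sum_nu K nu; have lip0 : 0 <= lip by rewrite sumr_ge0.
(* The three summands of this denominator yield h <= 1, then h A b <= 1 (the unit ball is
   preserved), then h A lip <= 1/2 (the map is a contraction). *)
have h00 : 0 < 1 + A * b + 2 * (A * lip) by rewrite -addrA ltr_wpDr// addr_ge0 ?mulr_ge0.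
exists (1 + A * b + 2 * (A * lip))^-1.
  by rewrite invr_gt0 h00/= invf_le1// -addrA lerDl addr_ge0 ?mulr_ge0.
exists (A * b) => [|h /andP[hgt0 hlt]]; first by rewrite mulr_ge0.
have hD : h * (1 + A * b + 2 * (A * lip)) <= 1.
  by rewrite -ler_pdivlMr// mul1r ltW.
have hAb : h * (A * b) <= 1.
  apply: le_trans hD; rewrite ler_wpM2l ?(ltW hgt0)// -addrA addrCA lerDl.
  by rewrite addr_ge0 ?mulr_ge0.
have hAl : h * (A * lip) <= 2^-1.
  rewrite -[leRHS]mul1r ler_pdivlMr// -mulrA; apply: le_trans hD.
  by rewrite ler_wpM2l ?(ltW hgt0)// [leLHS]mulrC lerDr addr_ge0 ?mulr_ge0.
have h1 : h <= 1.
  apply: le_trans hD; rewrite ler_peMr ?(ltW hgt0)// -addrA lerDl.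
  by rewrite addr_ge0 ?mulr_ge0.
have h01 : 0 < h <= 1 by rewrite hgt0.
pose slope (Z : 'M[R]_(p, n)) i := \sum_(nu < L) \sum_(j < p) ark_a S nu i j *:
      g nu (t + ark_c S nu j * h, row j Z, e).
pose W : 'M[R]_(p, n) := \matrix_(i < p) w.
pose U := closed_ball_ Num.norm W 1.
pose T (Z : 'M[R]_(p, n)) : 'M[R]_(p, n) := \matrix_(i < p) (w + h *: slope Z i).
have boxU Z nu j : U Z -> box D (t + ark_c S nu j * h, row j Z, e).
  move=> UZ.
  have D1 : 0 <= `|w| + 1 by rewrite addr_ge0.
  have D2 : 0 <= `|t| + c by rewrite addr_ge0.
  apply: box_pair; first apply: box_pair.
  - apply: box_scalar; apply: (le_trans (ler_normD _ _)).
    rewrite /D -!addrA lerD2l; apply: (le_trans (ark_abscissa_le nu j h01)).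
    by rewrite -/c lerDl !addr_ge0.
  - apply: box_row; apply: (@le_trans _ _ (`|w| + 1)).
      rewrite (_ : row j Z = w - row j (W - Z)).
        apply: (le_trans (ler_normB _ _)); rewrite lerD2l.
        exact: le_trans (norm_mx_row_le _ _) UZ.
      by apply/rowP => k; rewrite !mxE; ring.
    by rewrite /D addrAC lerDr addr_ge0.
  - by apply: box_scalar; rewrite /D lerDr addr_ge0.
have slope_le Z i : U Z -> `|slope Z i| <= A * b.
  move=> UZ; apply: (le_trans (norm_lincomb_le (D := b) _ _)) => [nu j|].
    case: (BP nu) => _ /(_ _ (boxU _ nu j UZ)) /le_trans; apply.
    by rewrite /b (bigD1 nu)//= lerDl sumr_ge0.
  by rewrite ler_wpM2r// -/(a i) /A (bigD1 i)//= lerDl sumr_ge0.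
have TU : set_fun U U T.
  move=> Z UZ; rewrite /U /closed_ball_ /=; apply: norm_mx_le => // i.
  rewrite linearB /= !rowK opprD addrA subrr add0r normrN normrZ (gtr0_norm hgt0).
  by apply: le_trans hAb; rewrite ler_wpM2l ?(ltW hgt0)// slope_le.
pose f : {fun U >-> U} := HB.pack T (isFun.Build _ _ U U T TU).
have [|||Z UZ ZE] := @banach_fixed_point R 'M[R]_(p, n) U f.
- exists (2^-1)%:nng; split; first by rewrite /= invf_lt1// ltr1n.
  move=> [X Y] /= [UX UY]; apply: norm_mx_le => [|i]; first by rewrite mulr_ge0.
  rewrite linearB /= /T !rowK opprD addrACA subrr add0r -scalerBr normrZ (gtr0_norm hgt0).
  apply: (@le_trans _ _ (h * (A * lip * `|X - Y|))); last first.
    by rewrite mulrA ler_wpM2r.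
  rewrite ler_wpM2l ?(ltW hgt0)// /slope -sumrB.
  under eq_bigr => nu _ do (rewrite -sumrB;
    under eq_bigr => j _ do rewrite -scalerBr).
  apply: (le_trans (norm_lincomb_le (D := lip * `|X - Y|) _ _)) => [nu j|].
    case: (KP nu) => _ Knu; apply: (@le_trans _ _ (K nu * `|X - Y|)).
      apply: Knu => //; try exact: boxU.
      apply: close_pair; last exact: close_refl.
      apply: close_pair; first exact: close_refl.
      apply: close_row; apply: le_trans (norm_mx_row_le _ j).
      by rewrite linearB.
    by rewrite ler_wpM2r// /lip (bigD1 nu)//= lerDl sumr_ge0.
  by rewrite mulrA ler_wpM2r// ler_wpM2r// -/(a i) /A (bigD1 i)//= lerDl sumr_ge0.
- exact: closed_closed_ball_.
- by exists W; rewrite /U /closed_ball_ /= subrr normr0.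
have zE i : row i Z = w + h *: slope Z i by rewrite {1}ZE /= /T rowK.
exists (fun i => row i Z); split => // i.
- rewrite zE addrAC subrr add0r normrZ (gtr0_norm hgt0).
  by apply: le_trans hAb; rewrite ler_wpM2l ?(ltW hgt0)// slope_le.
- by rewrite zE addrAC subrr add0r normrZ (gtr0_norm hgt0) mulrC ler_wpM2r ?(ltW hgt0)// slope_le.
Qed.

End ArkOrder.

(** * Uniformity of the order condition *)

Section UniformOrder.
Context {R : realType} {L : nat} (S : ark_method R L) {n : nat}.
Notation p := (ark_stages S).

Lemma field_times_differentiable_poly k (g : R -> 'rV[R]_n -> 'rV[R]_n) :
  polymap (fun x : R * 'rV[R]_n => g x.1 x.2) -> field_times_differentiable k g.
Proof.
move=> gP; exact: (times_differentiable_polymap (@linear_coords_time_state R n)).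
Qed.

(** The exact stages give a genuine step [w1], to which the order hypothesis applies with e frozen.
    The Picard step differs from [w1] by O(h^(N+1)), which is harmless because r <= N, and unlike
    [w1] it is a polynomial. *)
Lemma ark_order_at r N (g : 'I_L -> R * 'rV[R]_n * R -> 'rV[R]_n) (q : R -> 'rV[R]_n) e t :
  ark_has_order S r -> (forall nu i, 0 <= ark_c S nu i) ->
  (forall nu, polymap (g nu)) -> polymap q ->
  (forall (s : R) j, is_derive s 1 (fun y => q y 0 j) ((\sum_(nu < L) g nu (s, q s, e)) 0 j)) ->
  (r <= N)%N -> 0 <= t ->
  exists C, \forall h \near 0^'+,
    `|picard_step S g N (h, t, q t, e) - q (t + h)| <= C * h ^+ r.+1.
Proof.
move=> [K Sr] c0 gP qP qd rN t0.
have [h0 /andP[h00 h0le1] [C C0 hz]] := ark_stages_exist S t e (q t) gP.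
have /choice[z zP] : forall h, exists z : 'I_p -> 'rV[R]_n, 0 < h < h0 ->
    [/\ forall i, `|z i - q t| <= 1,
    forall i, `|z i - q t| <= C * h &
    forall i, z i = q t + h *: \sum_(nu < L) \sum_(j < p) ark_a S nu i j *:
      g nu (t + ark_c S nu j * h, z j, e)].
  move=> h; case: (boolP (0 < h < h0)) => [/hz[z zP]|_]; first by exists z.
  by exists (fun=> 0).
pose w1 h := q t + h *: \sum_(nu < L) \sum_(i < p) ark_b S nu i *:
  g nu (t + ark_c S nu i * h, z h i, e).
have step : \forall h \near 0^'+, ark_step S 1 (fun nu s x => g nu (s, x, e)) h t (q t) (w1 h).
  near=> h.
  have hh : 0 < h < h0.
    by apply/andP; split; near: h; [exact: nbhs_right_gt|exact: nbhs_right_lt].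
  have [z1 z2 z3] := zP h hh.
  exists (z h); split => // nu i.
  by rewrite addr_ge0// mulr_ge0// ltW//; case/andP: hh.
have gP' nu : polymap (fun x : R * 'rV[R]_n => g nu (x.1, x.2, e)).
  by have gnu := gP nu; polymap_tac.
(* Interval length 1 and stage radius 1 are arbitrary choices: the conclusion is local at t, and the
   constructed stages respect that radius. *)
have /eqO_exP[k k0 qk] := Sr n (fun nu s x => g nu (s, x, e)) t 1 (q t) q 1 w1 t0 ltr01
  (fun nu => field_times_differentiable_poly K (gP' nu))
  (times_differentiable_polymap linear_coords_scalar _ _ qP)
  (conj erefl (fun s _ => polymap_curve_expansion _ qP (qd s))) step.
pose D := C + `|t| + `|e| + `|q t|.
have D0 : 0 <= D by rewrite !addr_ge0.
have gg nu (s : R) x (y : R) : g nu (s, y ^+ 0 *: x, y) = y ^+ 0 *: g nu (s, x, y).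
  by rewrite expr0 !scale1r.
have [C' C'0 P] := ark_step_picard S N gP gP gg D0.
exists (C' + k); near=> h.
have hh : 0 < h < h0.
  by apply/andP; split; near: h; [exact: nbhs_right_gt|exact: nbhs_right_lt].
have [z1 z2 z3] := zP h hh.
case/andP: (hh) => hgt0 hlt.
have h1 : h <= 1 by rewrite (le_trans (ltW hlt)).
have := P h t e (q t) (q t) (w1 h) (z h) (fun nu i => g nu (t + ark_c S nu i * h, z h i, e)).
rewrite hgt0 h1 expr0 !scale1r subrr normr0 => /(_ isT) H.
have {}H : `|w1 h - picard_step S g N (h, t, q t, e)| <= C' * h ^+ N.+1.
  apply: H => //.
  - by rewrite -/D; move: C0 (normr_ge0 t) (normr_ge0 e) (normr_ge0 (q t)); rewrite /D; lra.
  - by rewrite -/D; move: C0 (normr_ge0 t) (normr_ge0 e) (normr_ge0 (q t)); rewrite /D; lra.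
  - by rewrite /D lerDr !addr_ge0.
  - by rewrite mulr_ge0// exprn_ge0// ltW.
  - move=> i; apply: (le_trans (z2 i)); rewrite ler_wpM2r ?(ltW hgt0)//.
    by rewrite /D -!addrA lerDl !addr_ge0.
  - by move=> nu i; rewrite subrr normr0 mulr_ge0// exprn_ge0// ltW.
apply: (le_trans (ler_distD (w1 h) _ _)); rewrite mulrDl; apply: lerD.
  rewrite distrC; apply: (le_trans H); rewrite ler_wpM2l//.
  by rewrite ler_wiXn2l// ltW.
have : `| `|q (t + h) - w1 h| : R| <= k * `|h ^+ r.+1| by near: h; exact: qk.
by rewrite normr_id distrC [`|h ^+ _|]gtr0_norm// exprn_gt0.
Unshelve. all: by end_near. Qed.

(* The order hypothesis is a statement about each fixed problem.  It becomes
   uniform in the base point and in the parameter because the defect is a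
   polynomial, whose low-order coefficients must vanish pointwise. *)
Lemma ark_order_uniform r N (g : 'I_L -> R * 'rV[R]_n * R -> 'rV[R]_n)
    (q : R * R -> 'rV[R]_n) :
  ark_has_order S r -> (forall nu i, 0 <= ark_c S nu i) ->
  (forall nu, polymap (g nu)) -> polymap q ->
  (forall (t e : R) j, 0 < e -> is_derive t 1 (fun s => q (s, e) 0 j)
     ((\sum_(nu < L) g nu (t, q (t, e), e)) 0 j)) ->
  (r <= N)%N ->
  exists l : R * (R * R) -> 'rV[R]_n, polymap l /\
    forall h t e : R, 0 <= t -> 0 < e ->
      picard_step S g N (h, t, q (t, e), e) - q (t + h, e) = h ^+ r.+1 *: l (h, (t, e)).
Proof.
move=> Sr c0 gP qP qd rN.
pose D (x : R * (R * R)) : 'rV[R]_n := picard_step S g N (x.1, x.2.1, q x.2, x.2.2) - q (x.2.1 + x.1, x.2.2).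
have DP : polymap D.
  by have stepP := polymap_picard_step S N gP; rewrite /D; polymap_tac.
have H : forall j : 'I_n, exists l : R * (R * R) -> R, polyfun l /\
    forall h t e : R, 0 <= t -> 0 < e -> D (h, (t, e)) 0 j = h ^+ r.+1 * l (h, (t, e)); last first.
  have /choice[l lP] := H.
  exists (fun x => \row_j l j x); split.
    apply: polymap_row => j; case: (lP j) => /polymapP + _.
    by apply: eq_polymap => x; rewrite mxE.
  move=> h t e t0 e0; apply/rowP => j; case: (lP j) => _ lE.
  by rewrite [RHS]mxE [X in _ * X]mxE -lE.
move=> j; have [m [G [GP E]]] := polyfun_horner_expand (DP j).
(* The quotient by h^(r+1) is formed from the coefficient functions themselves. It is thus a
   polynomial in all variables, although the divisibility is only known for t >= 0 and e > 0. *)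
exists (fun x => \sum_(i < m - r.+1) x.1 ^+ i * G (i + r.+1)%N x.2); split.
  apply/polymapP/polymap_sum => i _; have Gi : polymap (G (i + r.+1)%N) by exact/polymapP.
  by polymap_tac.
move=> h t e t0 e0; rewrite [LHS]E.
have PC : exists C, \forall h \near 0^'+, `|(\poly_(i < m) G i (t, e)).[h]| <= C * h ^+ r.+1.
  have qP' : polymap (fun s => q (s, e)) by polymap_tac.
  have [C CP] := ark_order_at Sr c0 gP qP' (fun s j => qd s e j e0) rN t0.
  exists C; near=> k.
  rewrite -(E k (t, e)); apply: (le_trans (norm_entry_le _ _)).
  by near: k; exact: CP.
case: PC => C /horner_coef_eq0 P0.
rewrite (horner_drop_poly _ P0); congr (_ * _).
transitivity (\poly_(i < m - r.+1) G (i + r.+1)%N (t, e)).[h].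
  congr (_.[h]); apply/polyP => i; rewrite coef_drop_poly !coef_poly.
  by rewrite addnC -ltn_subRL.
by rewrite horner_poly; apply: eq_bigr => i _; rewrite mulrC.
Unshelve. all: by end_near. Qed.

End UniformOrder.

(** * Polynomial expansion of the numerical solution *)

Section NumericalExpansion.
Context {R : realType} {L : nat} (S : ark_method R L) {n : nat}.
Notation p := (ark_stages S).
Implicit Types G g : 'I_L -> R * 'rV[R]_n * R -> 'rV[R]_n.

(** Inserting q + h^r eta into the Picard recursion, the defect of q contributes h^(r+1) [l] and the
    increment of the slope contributes h^(r+1) [psi]. After removing h^r, what is left is a one-step
    recursion for [eta] with slope [l + psi], solved by [one_step_expansion]. *)
Lemma ark_expansion r N M g (q : R * R -> 'rV[R]_n) :
  ark_has_order S r -> (forall nu i, 0 <= ark_c S nu i) ->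
  (forall nu, polymap (g nu)) -> polymap q ->
  (forall (t e : R) j, 0 < e -> is_derive t 1 (fun s => q (s, e) 0 j)
     ((\sum_(nu < L) g nu (t, q (t, e), e)) 0 j)) ->
  (r <= N)%N ->
  exists eta : R * R -> 'rV[R]_n, [/\ polymap eta, forall h, eta (0, h) = 0 &
    exists2 C, 0 <= C & forall h m, 0 < h <= 1 -> (m <= M)%N ->
      `|q (m.+1%:R * h, h) + h ^+ r *: eta (m.+1%:R * h, h) -
        picard_step S g N
          (h, m%:R * h, q (m%:R * h, h) + h ^+ r *: eta (m%:R * h, h), h)|
      <= C * h ^+ N.+1].
Proof.
move=> Sr c0 gP qP qd rN.
have [l [lP lE]] := ark_order_uniform Sr c0 gP qP qd rN.
have slopeP := polymap_picard_slope S N gP.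
(* The point s is ((t, h), value of [eta]), whereas Picard arguments put the step first. From here
   on the parameter e equals the step h. *)
pose a (s : R * R * 'rV[R]_n) : R * R * 'rV[R]_n * R := (s.1.2, s.1.1, q s.1, s.1.2).
pose b (s : R * R * 'rV[R]_n) : R * R * 'rV[R]_n * R := (s.1.2, s.1.1, q s.1 + s.1.2 ^+ r *: s.2, s.1.2).
have aP : polymap a by rewrite /a; polymap_tac.
have bP : polymap b by rewrite /b; polymap_tac.
have dP : polymap (fun s : R * R * 'rV[R]_n => s.1.2 ^+ r) by polymap_tac.
pose c (i : coord_ix (T := R * R * 'rV[R]_n * R)) (s : R * R * 'rV[R]_n) : R :=
  if i is inl (inr j) then s.2 0 j else 0.
have cP i : polyfun (c i).
  case: i => [[i|j]|i] /=; try exact: Polyfun_cst.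
  by apply/polymapP; rewrite /c; polymap_tac.
have [|psi [psiP psiE]] := polymap_increment slopeP aP bP dP cP.
  move=> [[[[]|[]]|j]|[]] s /=; rewrite ?subrr ?mulr0//.
  by rewrite !mxE addrAC subrr add0r.
pose F (s : R * R * 'rV[R]_n) : 'rV[R]_n := l (s.1.2, (s.1.1, s.1.2)) + psi s.
have FP : polymap F by rewrite /F; polymap_tac.
have [eta [etaP eta0 [C C0 etaC]]] := one_step_expansion M N FP.
exists eta; split => //; exists C => // h m h01 mM.
have /andP[h0 h1] := h01.
apply: le_trans (etaC h m h01 mM).
have t0 : 0 <= m%:R * h by rewrite mulr_ge0// ltW.
have := lE h (m%:R * h) h t0 h0; rewrite /picard_step /=.
have tE : m%:R * h + h = m.+1%:R * h by rewrite -natr1 mulrDl mul1r.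
rewrite tE => /eqP; rewrite subr_eq => /eqP lE'.
have := psiE (m%:R * h, h, eta (m%:R * h, h)); rewrite /a /b /= => /eqP.
rewrite subr_eq => /eqP ->.
set e1 := eta (m.+1%:R * h, h); set e0 := eta (m%:R * h, h).
set q1 := q (m.+1%:R * h, h) in lE' *; set q0 := q (m%:R * h, h) in lE' *.
set P := picard_slope _ _ _ _ in lE' *.
rewrite (_ : _ - _ = h ^+ r *: (e1 - e0 - h *: F (m%:R * h, h, e0))).
  rewrite normrZ ger0_norm ?exprn_ge0 ?(ltW h0)//.
  by rewrite ler_piMl// exprn_ile1// ltW.
have -> : q1 = q0 + h *: P - h ^+ r.+1 *: l (h, (m%:R * h, h)) by rewrite lE' addrC addKr.
rewrite /F /=; apply/rowP => j; rewrite !mxE exprS.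
by ring.
Qed.

(** Stages are a priori known only within [rho] of the current value, where the model says nothing
    about the actual fields. The crude bound on [Gact] upgrades this to a distance O(h), and there
    the sharp approximation of [Gact] by [G] holds. An error h^N in the fields costs only h^(N+1),
    since a step multiplies them by h. *)
Lemma ark_run_expansion s N M rho (Gact : R -> 'I_L -> R -> 'rV[R]_n -> 'rV[R]_n)
    G g (X : R * R -> 'rV[R]_n) (w0 : 'rV[R]_n) :
  (forall nu, polymap (G nu)) -> (forall nu, polymap (g nu)) -> polymap X ->
  (forall nu (t : R) (x : 'rV[R]_n) (e : R), G nu (t, e ^+ s *: x, e) = e ^+ s *: g nu (t, x, e)) ->
  (exists2 C, 0 <= C & forall h m, 0 < h <= 1 -> (m <= M)%N ->
      `|X (m.+1%:R * h, h) - picard_step S g N (h, m%:R * h, X (m%:R * h, h), h)|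
      <= C * h ^+ N.+1) ->
  (forall h, 0 < h -> h ^+ s *: X (0, h) = w0) ->
  (forall C : R, exists B : R, \forall h \near 0^'+, forall nu (t : R) (z : 'rV[R]_n), 0 <= t <= C * h ->
     `|z - w0| <= C -> `|Gact h nu t z| <= B) ->
  (forall C : R, exists B : R, \forall h \near 0^'+, forall nu (t : R) (z : 'rV[R]_n), 0 <= t <= C * h ->
     `|z - w0| <= C * h -> `|Gact h nu t z - G nu (t, z, h)| <= B * h ^+ N) ->
  exists2 C, 0 <= C & \forall h \near 0^'+, forall theta, ark_run S rho (Gact h) h M w0 theta ->
    forall m, (m <= M)%N -> `|theta m - h ^+ s *: X (m%:R * h, h)| <= C * h ^+ N.+1.
Proof.
move=> GP gP XP Gg [CX CX0 hX] X0 Gbounded Gapprox.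
have [KX KX0 XK] := polymap_bounded (M%:R + 1) XP.
have [LX LX0 XL] := polymap_lipschitz (M%:R + 1) XP.
pose c := \sum_(nu < L) \sum_(j < p) `|ark_c S nu j|.
have c0 : 0 <= c by rewrite sumr_ge0// => nu _; rewrite sumr_ge0.
pose a i := \sum_(nu < L) \sum_(j < p) `|ark_a S nu i j|.
have a0 i : 0 <= a i by rewrite sumr_ge0// => nu _; rewrite sumr_ge0.
pose A := \sum_i a i; have A0 : 0 <= A by rewrite sumr_ge0.
(* The constant and the threshold on h may depend on m: there are only [M] steps, so no stability
   estimate uniform in the number of steps is required. *)
suff H m : (m <= M)%N -> exists2 C, 0 <= C & \forall h \near 0^'+, forall theta,
    ark_run S rho (Gact h) h M w0 theta -> forall k, (k <= m)%N ->
    `|theta k - h ^+ s *: X (k%:R * h, h)| <= C * h ^+ N.+1 by exact: H.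
elim: m => [|m IH] mM.
  exists 0 => //; near=> h.
  have h0 : 0 < h by near: h; exact: nbhs_right_gt.
  move=> theta [th0 _] k; rewrite leqn0 => /eqP ->.
  by rewrite mul0r th0 X0// subrr normr0 mul0r.
have [C C0 HC] := IH (ltnW mM).
pose D1 := C + LX * M%:R.
have D10 : 0 <= D1 by rewrite addr_ge0// mulr_ge0.
(* Current values lie within [D1 * h] of [w0], stages within [rho] of those, and abscissae below
   [(M%:R + c) * h]. *)
have [B1 HB1] := Gbounded (D1 + `|rho| + (M%:R + c)).
pose B := `|B1|.
(* With fields bounded by [B], a stage moves by at most [A * B * h], so [rho] disappears from the
   radius. *)
have [B2 HB2] := Gapprox (D1 + A * B + (M%:R + c)).
pose D := M%:R + 1 + KX + C + A * B + `|B2|.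
have AB0 : 0 <= A * B by apply: mulr_ge0 => //; exact: normr_ge0.
have D0 : 0 <= D by rewrite !addr_ge0.
have [C' C'0 HP] := ark_step_picard S N GP gP Gg D0.
exists (C + (C' + CX)); first by rewrite !addr_ge0.
near=> h.
have h0 : 0 < h by near: h; exact: nbhs_right_gt.
have h1 : h <= 1 by near: h; exact: nbhs_right_le.
have h01 : 0 < h <= 1 by rewrite h0.
have hN0 i : 0 <= h ^+ i by rewrite exprn_ge0// ltW.
have hN1 i : h ^+ i <= 1 by rewrite exprn_ile1// ltW.
have hCh : forall theta, ark_run S rho (Gact h) h M w0 theta -> forall k, (k <= m)%N ->
    `|theta k - h ^+ s *: X (k%:R * h, h)| <= C * h ^+ N.+1 by near: h.
have HB1h : forall nu (t : R) (z : 'rV[R]_n), 0 <= t <= (D1 + `|rho| + (M%:R + c)) * h ->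
    `|z - w0| <= D1 + `|rho| + (M%:R + c) -> `|Gact h nu t z| <= B1 by near: h.
have HB2h : forall nu (t : R) (z : 'rV[R]_n), 0 <= t <= (D1 + A * B + (M%:R + c)) * h ->
    `|z - w0| <= (D1 + A * B + (M%:R + c)) * h ->
    `|Gact h nu t z - G nu (t, z, h)| <= B2 * h ^+ N by near: h.
move=> theta run k; have hC := hCh theta run.
rewrite leq_eqVlt ltnS => /predU1P[->{k}|/hC /le_trans]; last first.
  by apply; rewrite ler_wpM2r// lerDl addr_ge0.
have [_ /(_ m mM)] := run; move=> [z [zc zrho zE thE]].
have mh0 : 0 <= m%:R * h by rewrite mulr_ge0// ltW.
have mh : m%:R * h <= M%:R * h by rewrite ler_wpM2r ?(ltW h0)// ler_nat ltnW.
have boxh i : (i <= M)%N -> box (M%:R + 1) (i%:R * h, h).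
  move=> iM; apply: box_pair; apply: box_scalar.
    rewrite ger0_norm ?mulr_ge0 ?(ltW h0)// -[leRHS]mulr1.
    by rewrite ler_pM ?(ltW h0)// ler_wpDr// ler_nat.
  by rewrite gtr0_norm// (le_trans h1)// lerDr.
have thw : `|theta m - w0| <= D1 * h.
  apply: (le_trans (ler_distD (h ^+ s *: X (m%:R * h, h)) _ _)).
  rewrite mulrDl; apply: lerD.
    by apply: (le_trans (hC m (leqnn m))); rewrite ler_wpM2l// exprS ler_piMr// ltW.
  rewrite -(X0 h h0) -scalerBr normrZ ger0_norm// -mulrA.
  apply: (@le_trans _ _ (`|X (m%:R * h, h) - X (0, h)|)); first by rewrite ler_piMl.
  apply: XL => //.
  - exact/boxh/ltnW.
  - by have := boxh 0%N (leq0n M); rewrite mul0r.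
  - by rewrite mulr_ge0// ltW.
  - apply: close_pair; last by apply: close_refl; rewrite mulr_ge0// ltW.
    by apply: close_scalar; rewrite subr0 ger0_norm.
have tch nu i : m%:R * h + ark_c S nu i * h <= (M%:R + c) * h.
  rewrite mulrDl lerD// ler_wpM2r ?(ltW h0)//.
  have := @ark_abscissa_le _ _ S 1 nu i; rewrite mulr1 ltr01 lexx => /(_ isT).
  exact/le_trans/ler_norm.
have zB nu i : `|Gact h nu (m%:R * h + ark_c S nu i * h) (z i)| <= B.
  apply: (@le_trans _ _ B1); last exact: ler_norm.
  apply: HB1h.
    rewrite zc/=; apply: (le_trans (tch nu i)); rewrite ler_wpM2r ?(ltW h0)//.
    by rewrite lerDr addr_ge0.
  apply: (le_trans (ler_distD (theta m) _ _)); rewrite addrC.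
  rewrite -addrA lerD//.
    by apply: (le_trans thw); rewrite ler_piMr.
  apply: (le_trans (zrho i)); apply: (le_trans (ler_norm _)).
  by rewrite lerDl addr_ge0.
have zth i : `|z i - theta m| <= (A * B) * h.
  rewrite {1}zE addrAC subrr add0r normrZ (gtr0_norm h0) mulrC ler_wpM2r ?(ltW h0)//.
  apply: (le_trans (norm_lincomb_le (D := B) _ _)) => [nu j|]; first exact: zB.
  by rewrite ler_wpM2r ?normr_ge0// -/(a i) /A (bigD1 i)//= lerDl sumr_ge0.
have zw i : `|z i - w0| <= (D1 + A * B) * h.
  by apply: (le_trans (ler_distD (theta m) _ _)); rewrite addrC mulrDl lerD.
have gapp nu i : `|Gact h nu (m%:R * h + ark_c S nu i * h) (z i) -
    G nu (m%:R * h + ark_c S nu i * h, z i, h)| <= D * h ^+ N.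
  apply: (@le_trans _ _ (B2 * h ^+ N)).
    apply: HB2h.
      rewrite zc/=; apply: (le_trans (tch nu i)); rewrite ler_wpM2r ?(ltW h0)//.
      by rewrite lerDr addr_ge0.
    apply: (le_trans (zw i)); rewrite ler_wpM2r ?(ltW h0)//.
    by rewrite lerDl addr_ge0.
  rewrite ler_wpM2r//; apply: (le_trans (ler_norm _)).
  by rewrite /D lerDr !addr_ge0.
have {}HP : `|theta m.+1 - h ^+ s *: picard_step S g N (h, m%:R * h, X (m%:R * h, h), h)|
    <= C' * h ^+ N.+1.
  apply: (HP h (m%:R * h) h _ (theta m) _ z
    (fun nu i => Gact h nu (m%:R * h + ark_c S nu i * h) (z i))) => //.
  - rewrite ger0_norm//; apply: (@le_trans _ _ M%:R).
      by apply: (le_trans mh); rewrite ler_piMr.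
    by rewrite /D -!addrA lerDl !addr_ge0.
  - rewrite gtr0_norm//; apply: (le_trans h1).
    by rewrite /D -!addrA addrCA lerDl !addr_ge0.
  - apply: (le_trans (XK _ (boxh m (ltnW mM)))).
    by rewrite /D; move: C0 AB0 (normr_ge0 B2) (ler0n R M); lra.
  - apply: (le_trans (hC m (leqnn m))); rewrite ler_wpM2r//.
    by rewrite /D; move: KX0 AB0 (normr_ge0 B2) (ler0n R M); lra.
  - move=> i; apply: (le_trans (zth i)); rewrite ler_wpM2r ?(ltW h0)//.
    by rewrite /D; move: C0 KX0 (normr_ge0 B2) (ler0n R M); lra.
apply: (le_trans (ler_distD (h ^+ s *: picard_step S g N (h, m%:R * h, X (m%:R * h, h), h)) _ _)).
rewrite addrC mulrDl -[leLHS]addrC ler_wpDl ?mulr_ge0// mulrDl; apply: lerD => //.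
rewrite -scalerBr normrZ ger0_norm// distrC.
apply: (@le_trans _ _ (`|X (m.+1%:R * h, h) -
  picard_step S g N (h, m%:R * h, X (m%:R * h, h), h)|)); first by rewrite ler_piMl.
by apply: hX => //; exact: ltnW.
Unshelve. all: by end_near. Qed.

End NumericalExpansion.

(** * Taylor expansions *)

Section Taylor.
Context {R : realType}.

Lemma is_derive_first_order (g : R -> R) (s d : R) :
  (forall eps, 0 < eps -> \forall x \near s, `|g x - g s - (x - s) * d| <= eps * `|x - s|) ->
  is_derive s 1 g d.
Proof.
move=> H.
suff cv : h^-1 *: (g (h *: 1 + s) - g s) @[h --> 0^'] --> d.
  by apply: DeriveDef; [apply/cvg_ex; exists d|exact: cvg_lim].
apply/cvgrPdist_le => eps eps0.
have := H _ eps0; rewrite (near_shift 0 s) => {}H.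
near=> h.
have h0 : h != 0 by near: h; exact: nbhs_dnbhs_neq.
have : `|g (h + s) - g s - h * d| <= eps * `|h|.
  near: h; apply: cvg_within; move: H; apply: filterS => h /=.
  by rewrite subr0 addrK.
rewrite /= /GRing.scale /= mulr1 => H1.
rewrite (_ : d - _ = - (h^-1 * (g (h + s) - g s - h * d))); last first.
  by rewrite [in RHS]mulrBr mulKf// opprB.
rewrite normrN normrM normfV ler_pdivrMl ?normr_gt0//.
by rewrite [leRHS]mulrC.
Unshelve. all: by end_near. Qed.

(** Replaces integration of derivatives known only relative to an interval. At interior points the
    one-sided expansions become two-sided, at the end points continuity suffices, and the mean value
    theorem applies to g - B. *)
Lemma mean_value_within (g dg B dB : R -> R) (b K : R) : 0 <= b ->
  (forall s, 0 <= s <= b -> forall eps, 0 < eps ->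
     \forall x \near s, 0 <= x <= b -> `|g x - g s - (x - s) * dg s| <= eps * `|x - s|) ->
  (forall s : R, is_derive s 1 B (dB s)) ->
  (forall s, 0 < s < b -> `|dg s - dB s| <= K) -> 0 <= K ->
  `|(g b - B b) - (g 0 - B 0)| <= K * b.
Proof.
move=> b0 gd Bd dK K0.
have [->|bN0] := eqVneq b 0; first by rewrite subrr normr0 mulr0.
have {}b0 : 0 < b by rewrite lt_neqAle eq_sym bN0.
have [||c cab E] := @MVT R (g \- B) (fun s => dg s - dB s) 0 b b0.
- move=> s; rewrite in_itv /= => /andP[s0 sb].
  suff gs : is_derive s 1 g (dg s) by exact: (is_deriveB gs (Bd s)).
  apply: is_derive_first_order => eps eps0.
  near=> x.
  have : 0 <= x <= b -> `|g x - g s - (x - s) * dg s| <= eps * `|x - s|.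
    by near: x; apply: gd => //; rewrite !ltW.
  have : x \in `]0, b[ by near: x; apply: near_in_itvoo; rewrite in_itv /= s0.
  by rewrite in_itv /= => /andP[/ltW -> /ltW ->]; apply.
- apply/subspace_continuousP => s; rewrite /= in_itv /= => sb.
  apply: cvgB; last first.
    apply: cvg_within_filter; apply: differentiable_continuous.
    by apply/derivable1_diffP; exact: (@ex_derive _ _ _ _ _ _ _ (Bd s)).
  apply/cvgrPdist_le => eps eps0.
  pose e1 := eps / (1 + `|dg s|).
  have d0 : 0 < 1 + `|dg s| by rewrite ltr_pwDl.
  have e10 : 0 < e1 by rewrite divr_gt0.
  near=> x => /=.
  have [xb|xb] := boolP (0 <= x <= b); last first.
    by exfalso; move/negP: xb; apply; near: x; exact: withinT.
  have gx : `|g x - g s - (x - s) * dg s| <= 1 * `|x - s|.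
    move: xb; near: x; apply: cvg_within; exact: gd.
  have xs : `|x - s| <= e1.
    near: x; apply: cvg_within; exact: (@cvgr_distC_le _ R _ (nbhs s) _ id s (@cvg_id _ _) e1 e10).
  rewrite distrC; rewrite (_ : g x - g s = (g x - g s - (x - s) * dg s) + (x - s) * dg s).
    apply: (le_trans (ler_normD _ _)); apply: (le_trans (lerD gx (lexx _))).
    rewrite normrM [`|x - s| * _]mulrC -mulrDl -[leRHS](divfK (lt0r_neq0 d0)) mulrC.
    by rewrite ler_wpM2r// ltW.
  by rewrite subrK.
- move: E; rewrite subr0 /= => ->.
  rewrite normrM (gtr0_norm b0) ler_wpM2r ?(ltW b0)// dK//.
Unshelve. all: by end_near. Qed.

End Taylor.

Section TaylorExpansion.
Context {R : realType} {d n : nat}.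
Notation V := (R^o * 'rV[R]_d)%type.
Notation D := [set x : V | 0 <= x.1].
Implicit Types (f : V -> 'rV[R]_n) (a y : 'rV[R]_d).

Lemma norm_pair_le (t : R) y : `|((t, y) : V)| <= `|t| + `|y|.
Proof. by rewrite prod_normE /= ge_max lerDl lerDr !normr_ge0. Qed.

Lemma diff_within_eps f (a : V) (df : {linear V -> 'rV[R]_n}) (eps : R) :
  has_diff_within D f a df -> 0 < eps ->
  exists2 del : R, 0 < del & forall y : V, 0 <= y.1 -> `|y - a| < del ->
    `|f y - f a - df (y - a)| <= eps * `|y - a|.
Proof.
move=> [_ /eqoP H] eps0.
have /nbhs_normP[del /= del0 Hd] := H _ eps0.
by exists del => // y y1 ya; apply: Hd => //=; rewrite distrC.
Qed.

Lemma linear_time_state (df : {linear V -> 'rV[R]_n}) (t : R) y :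
  df (t, y) = t *: df (1, 0) + \sum_j y 0 j *: df (0, delta_mx 0 j).
Proof.
rewrite -linearZ; under eq_bigr => j _ do rewrite -linearZ.
rewrite -linear_sum -linearD; congr (df _).
rewrite [in LHS](matrix_sum_delta y) big_ord1.
have E : forall (s : seq 'I_d), \sum_(j <- s) (y 0 j *: ((0, delta_mx 0 j) : V)) =
   (0, \sum_(j <- s) y 0 j *: delta_mx 0 j).
  elim=> [|j s IH]; first by rewrite !big_nil.
  by rewrite !big_cons IH; congr (_, _); rewrite /= /GRing.scale /= mulr0 addr0.
rewrite E; congr (_, _); last by rewrite /= scaler0 add0r.
by rewrite /= /GRing.scale /= mulr1 addr0.
Qed.

(** The polynomial is built recursively: with P_v approximating the derivative in direction v, it is
    f(0, a) plus the integral over s in [0, 1] of t P_(1,0)(st, sy) + sum_j y_j P_(0,e_j)(st, sy).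
    No symmetry of higher derivatives is used, and the segment from (0, a) to (t, a + y) stays in
    the region t >= 0. *)
Lemma taylor_expansion k f a : times_differentiable k.+1 D f ->
  exists P : R * 'rV[R]_d -> 'rV[R]_n, polymap P /\
  exists C del, [/\ 0 <= C, 0 < del & forall t y, 0 <= t -> t + `|y| < del ->
    `|f (t, a + y) - P (t, y)| <= C * (t + `|y|) ^+ k.+1].
Proof.
elim: k f => [|k IH] f.
  move=> [df [dfP _]]; exists (fun=> f (0, a)); split; first exact: polymap_cst.
  have dfa := dfP (0, a) (lexx _).
  have [del del0 H] := diff_within_eps dfa ltr01.
  have [K K0 KP] := linear_lipschitz (proj1 dfa).
  exists (1 + K), del; split=> //; first by rewrite addr_ge0// ltW.
  move=> t y t0 ty.
  have nty : `|(t, a + y) - (0, a) : V| <= t + `|y|.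
    rewrite (_ : (t, a + y) - (0, a) = (t, y) :> V).
      by apply: (le_trans (norm_pair_le t y)); rewrite ger0_norm.
    by congr (_, _) => /=; [rewrite subr0|rewrite addrC addKr].
  have := H (t, a + y) t0 (le_lt_trans nty ty).
  set w := _ - _ : V; move=> Hw.
  rewrite (_ : f _ - _ = (f (t, a + y) - f (0, a) - df (0, a) w) + df (0, a) w); last by rewrite subrK.
  apply: (le_trans (ler_normD _ _)); rewrite mulrDl expr1; apply: lerD.
    by apply: (le_trans Hw); rewrite !mul1r.
  by apply: (le_trans (KP _)); rewrite ler_wpM2l// ltW.
move=> [df [dfP dfk]].
have /choice[P PP] := fun v => IH _ (dfk v).
pose e0 : V := (1, 0).
pose e (j : 'I_d) : V := (0, delta_mx 0 j).
have PPol v : polymap (P v) by case: (PP v).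
pose A (z : R * (R * 'rV[R]_d)) : 'rV[R]_n :=
  z.2.1 *: P e0 (z.1 * z.2.1, z.1 *: z.2.2) +
  \sum_j z.2.2 0 j *: P (e j) (z.1 * z.2.1, z.1 *: z.2.2).
have AP : polymap A.
  apply: polymapDv.
    by have Pe := PPol e0; polymap_tac.
  by apply: polymap_sumv => j _; have Pe := PPol (e j); polymap_tac.
have [B [BP B0 dB]] := polymap_primitive AP.
exists (fun z => f (0, a) + B (1, z)); split; first by polymap_tac.
have /choice[C CP] : forall v, exists C, 0 <= C /\ exists2 del, 0 < del &
    forall t y, 0 <= t -> t + `|y| < del ->
    `|df (t, a + y) v - P v (t, y)| <= C * (t + `|y|) ^+ k.+1.
  by move=> v; case: (PP v) => _ [C [del [C0 del0 H]]]; exists C; split=> //; exists del.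
have /choice[del delP] : forall v, exists del, 0 < del /\
    forall t y, 0 <= t -> t + `|y| < del ->
    `|df (t, a + y) v - P v (t, y)| <= C v * (t + `|y|) ^+ k.+1.
  by move=> v; case: (CP v) => _ [del del0 H]; exists del.
have C0 v : 0 <= C v by case: (CP v).
(* The radius of validity depends on the direction, but only the time direction and the [d]
   coordinate directions occur, so a finite minimum is enough. *)
have [de [de0 dee0 dee]] : exists de, [/\ 0 < de, de <= del e0 & forall j, de <= del (e j)].
  exists (\big[Num.min/del e0]_j del (e j)); split.
  - apply: lt_bigmin => [|j _]; [by case: (delP e0)|by case: (delP (e j))].
  - exact: bigmin_le_id.
  - by move=> j; exact: bigmin_le_cond.
pose K := C e0 + \sum_j C (e j).
have K0 : 0 <= K by rewrite addr_ge0// sumr_ge0.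
exists K, de; split => // t y t0 ty.
set N := t + `|y|.
have N0 : 0 <= N by rewrite addr_ge0.
apply: norm_row_le => [|c]; first by rewrite mulr_ge0// exprn_ge0.
have dfA s : 0 <= s <= 1 -> `|df (s * t, a + s *: y) (t, y) - A (s, (t, y))| <= K * N ^+ k.+2.
  move=> /andP[s0 s1].
  have st0 : 0 <= s * t by rewrite mulr_ge0.
  have sN : s * t + `|s *: y| <= N.
    by rewrite normrZ (ger0_norm s0) -mulrDr ler_piMl.
  have sN0 : 0 <= s * t + `|s *: y| by rewrite addr_ge0.
  have bnd v : de <= del v ->
      `|df (s * t, a + s *: y) v - P v (s * t, s *: y)| <= C v * N ^+ k.+1.
    move=> dev; case: (delP v) => _ /(_ (s * t) (s *: y) st0) H.
    apply: (le_trans (H _)); first by apply: (le_lt_trans sN); exact: lt_le_trans dev.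
    by rewrite ler_wpM2l// lerXn2r ?nnegrE.
  rewrite linear_time_state /A /= opprD addrACA -scalerBr -sumrB.
  rewrite /K mulrDl; apply: (le_trans (ler_normD _ _)); apply: lerD.
    rewrite normrZ (ger0_norm t0) exprS mulrCA ler_pM//; first by rewrite lerDl.
    exact: (bnd e0 dee0).
  rewrite mulr_suml; apply: (le_trans (ler_norm_sum _ _ _)); apply: ler_sum => j _.
  rewrite -scalerBr normrZ exprS mulrCA ler_pM//; last exact: (bnd (e j) (dee j)).
  by apply: (le_trans (norm_entry_le _ _)); rewrite /N lerDr.
have M : `|(f (1 * t, a + 1 *: y) 0 c - B (1, (t, y)) 0 c) -
    (f (0 * t, a + 0 *: y) 0 c - B (0, (t, y)) 0 c)| <= K * N ^+ k.+2 * 1.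
  apply: (@mean_value_within R (fun s => f (s * t, a + s *: y) 0 c)
    (fun s => df (s * t, a + s *: y) (t, y) 0 c) (fun s => B (s, (t, y)) 0 c)
    (fun s => A (s, (t, y)) 0 c)) => //.
  - move=> s /andP[s0 s1] eps eps0.
    have st0 : 0 <= s * t by rewrite mulr_ge0.
    have eN0 : 0 < eps / (1 + N) by rewrite divr_gt0// ltr_pwDl.
    have [dl dl0 Hd] := diff_within_eps (dfP (s * t, a + s *: y) st0) eN0.
    have dN : 0 < dl / (1 + N) by rewrite divr_gt0// ltr_pwDl.
    near=> x => /andP[x0 x1].
    have xs : `|x - s| < dl / (1 + N).
      near: x; exact: (@cvgr_distC_lt _ R _ (nbhs s) _ id s (@cvg_id _ _) _ dN).
    have E : (x * t, a + x *: y) - (s * t, a + s *: y) = (x - s) *: ((t, y) : V) :> V.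
      congr (_, _); first by rewrite /= /GRing.scale /= mulrBl.
      by rewrite /= opprD addrACA subrr add0r scalerBl.
    have En : `|(x - s) *: ((t, y) : V)| <= `|x - s| * (1 + N).
      rewrite normrZ ler_wpM2l//; apply: (le_trans (norm_pair_le t y)).
      by rewrite ger0_norm// -/N lerDr.
    have := Hd (x * t, a + x *: y); rewrite /= mulr_ge0// E => /(_ isT).
    have -> : `|(x - s) *: ((t, y) : V)| < dl.
      by apply: (le_lt_trans En); rewrite -ltr_pdivlMr// ltr_pwDl.
    move=> /(_ isT) H.
    rewrite (_ : _ - _ = (f (x * t, a + x *: y) - f (s * t, a + s *: y) -
      df (s * t, a + s *: y) ((x - s) *: ((t, y) : V))) 0 c); last by rewrite [in RHS]linearZ !mxE.
    apply: (le_trans (norm_entry_le _ _)); apply: (le_trans H).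
    apply: (le_trans (ler_wpM2l (ltW eN0) En)).
    by rewrite mulrCA divfK ?lt0r_neq0 ?ltr_pwDl// mulrC.
  - move=> s /andP[s0 s1]; have := dfA s; rewrite (ltW s0) (ltW s1) => /(_ isT).
    by apply: le_trans; have := norm_entry_le (df (s * t, a + s *: y) (t, y) - A (s, (t, y))) c; rewrite !mxE.
  - by rewrite mulr_ge0// exprn_ge0.
move: M; rewrite !mul1r !mulr1 !scale1r !mul0r !scale0r !addr0 B0.
apply: le_trans; rewrite le_eqVlt; apply/orP; left; apply/eqP; congr `|_|.
by rewrite !mxE; ring.
Unshelve. all: by end_near. Qed.

End TaylorExpansion.

Section PolynomialModel.
Context {R : realType} {n : nat}.
Notation V := (R^o * 'rV[R]_n)%type.

(** Supplies the crude bound on whole balls, beyond the neighbourhood where the Taylor polynomial is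
    accurate: differentiability relative to t >= 0 gives continuity on a compact cylinder. *)
Lemma field_bounded k (g : R -> 'rV[R]_n -> 'rV[R]_n) :
  field_times_differentiable k.+1 g -> forall C : R, exists2 B, 0 <= B &
    forall t x, 0 <= t <= C -> `|x| <= C -> `|g t x| <= B.
Proof.
move=> [df [dfP _]] C.
pose A : set V := (`[0, C] : set R^o) `*` closed_ball_ Num.norm (0 : 'rV[R]_n) C.
have cA : compact A.
  apply: compact_setX; first exact: segment_compact.
  apply: bounded_closed_compact; last exact: closed_closed_ball_.
  exists C; split; first exact: num_real.
  move=> y Cy x; rewrite /closed_ball_ /= sub0r normrN => /le_trans; apply.
  exact: ltW.
have gc : {within A, continuous (fun x : V => g x.1 x.2)}.
  apply/subspace_continuousP => x [/=]; rewrite in_itv /= => /andP[x0 _] _.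
  have [del del0 H] := diff_within_eps (dfP x x0) ltr01.
  have [K K0 KP] := linear_lipschitz (proj1 (dfP x x0)).
  apply/cvgrPdist_le => eps eps0.
  have e0 : 0 < eps / (1 + K) by rewrite divr_gt0// addr_gt0.
  near=> y.
  have y1 : 0 <= y.1.
    have : A y by near: y; exact: withinT.
    by move=> [/=]; rewrite in_itv /= => /andP[].
  have yx : `|y - x| < del.
    near: y; apply: cvg_within.
    exact: (@cvgr_distC_lt _ V _ (nbhs x) _ id x (@cvg_id _ _) _ del0).
  have yx' : `|y - x| <= eps / (1 + K).
    near: y; apply: cvg_within.
    exact: (@cvgr_distC_le _ V _ (nbhs x) _ id x (@cvg_id _ _) _ e0).
  rewrite distrC (_ : _ - _ = (g y.1 y.2 - g x.1 x.2 - df x (y - x)) + df x (y - x)); last by rewrite subrK.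
  apply: (le_trans (ler_normD _ _)); apply: (le_trans (lerD (H y y1 yx) (KP _))).
  by rewrite -mulrDl mulrC -ler_pdivlMr// addr_gt0.
have [B [Breal BP]] := compact_bounded (continuous_compact gc cA).
exists (`|B| + 1) => [|t x tC xC]; first by rewrite addr_ge0.
apply: (BP (`|B| + 1)); first by rewrite (le_lt_trans (ler_norm B))// ltrDl.
exists (t, x) => //; split; first by rewrite /= in_itv.
by rewrite /closed_ball_ /= sub0r normrN.
Unshelve. all: by end_near. Qed.

Context {L : nat}.

Section Solution.
Variables (M : nat) (T : R) (f : R -> 'rV[R]_n -> 'rV[R]_n)
  (fnu : 'I_L -> R -> 'rV[R]_n -> 'rV[R]_n) (u0 : 'rV[R]_n) (u : R -> 'rV[R]_n)
  (P : 'I_L -> R * 'rV[R]_n -> 'rV[R]_n) (C del : R).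
Hypotheses (T0 : 0 < T) (C0 : 0 <= C) (del0 : 0 < del).
Hypothesis hf : forall t x, 0 <= t -> f t x = \sum_(nu < L) fnu nu t x.
Hypothesis hu : solves_ivp f 0 T u0 u.
Hypothesis PP : forall nu, polymap (P nu).
Hypothesis fP : forall nu t x, 0 <= t -> t + `|x - u0| < del ->
  `|fnu nu t x - P nu (t, x)| <= C * (t + `|x - u0|) ^+ M.+1.

Lemma solution_first_order s : 0 <= s <= T -> forall eps, 0 < eps ->
  \forall x \near s, 0 <= x <= T ->
    `|u x - u s - (x - s) *: f s (u s)| <= eps * `|x - s|.
Proof.
move=> sT eps eps0; have [_ H] := hu.
have := H s; rewrite add0r => /(_ sT) /eqoP /(_ _ eps0) Hs.
have {}Hs : nbhs s [set x : R | `[0, T]%classic x ->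
    `|u x - u s - (x - s) *: f s (u s)| <= eps * `|x - s|] := Hs.
by apply: filterS Hs => x /= Hx xT; apply: Hx; rewrite in_itv.
Qed.

Lemma solution_lipschitz_at0 : exists K eta, [/\ 0 <= K, 0 < eta, eta <= T &
  forall t, 0 <= t < eta -> `|u t - u0| <= K * t].
Proof.
have [u00 _] := hu.
have [|eta /= eta0 H] := solution_first_order (s := 0) _ ltr01.
  by rewrite lexx ltW.
exists (1 + `|f 0 u0|), (Num.min eta T); split => //.
- by rewrite lt_min eta0 T0.
- by rewrite ge_min lexx orbT.
move=> t /andP[t0]; rewrite lt_min => /andP[te tT].
have := H t; rewrite /= sub0r normrN ger0_norm// => /(_ te).
rewrite t0 ltW// => /(_ isT); rewrite subr0 u00 => Ht.
rewrite (_ : u t - u0 = (u t - u0 - t *: f 0 u0) + t *: f 0 u0); last by rewrite subrK.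
apply: (le_trans (ler_normD _ _)); rewrite mulrDl; apply: lerD.
  by apply: (le_trans Ht); rewrite ger0_norm.
by rewrite normrZ ger0_norm// mulrC.
Qed.

(** Integrating the model field along U gains one power of t. The limit k <= M reflects the model
    error O(t^(M+1)), which integrates to t^(M+2). *)
Lemma solution_picard k (U : R -> 'rV[R]_n) : (k <= M)%N -> polymap U -> U 0 = u0 ->
  (exists K eta, [/\ 0 <= K, 0 < eta & forall t, 0 <= t < eta ->
    `|u t - U t| <= K * t ^+ k.+1]) ->
  exists U1 : R -> 'rV[R]_n, [/\ polymap U1, U1 0 = u0,
    forall (t : R) j, is_derive t 1 (fun s => U1 s 0 j)
      ((\sum_(nu < L) P nu (t, U t)) 0 j) &
    exists K eta, [/\ 0 <= K, 0 < eta & forall t, 0 <= t < eta ->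
      `|u t - U1 t| <= K * t ^+ k.+2]].
Proof.
move=> kM UP U0 [K [eta [K0 eta0 HU]]].
have [Ku [etau [Ku0 etau0 etauT Hu]]] := solution_lipschitz_at0.
have AP : polymap (fun z : R * R => \sum_(nu < L) P nu (z.1, U z.1)).
  by apply: polymap_sumv => nu _; polymap_tac.
have [B [BP B0 dB]] := polymap_primitive AP.
exists (fun t => u0 + B (t, 0)); split.
- by polymap_tac.
- by rewrite B0 addr0.
- move=> t j; have := dB t 0 j.
  have -> : (fun s => (u0 + B (s, 0)) 0 j) = cst (u0 0 j) + (fun s => B (s, 0) 0 j).
    by apply/funext => s; rewrite !mxE.
  by move=> Bj; rewrite -[X in is_derive _ _ _ X]add0r; exact: is_deriveD.
have [KU KU0 HKU] := polymap_bounded 1 UP.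
pose D := 1 + Ku + `|u0| + KU.
have D0 : 0 <= D by rewrite !addr_ge0.
have /choice[lip lipP] : forall nu, exists lip, 0 <= lip /\ forall x y e, box D x -> box D y ->
    0 <= e -> close e x y -> `|P nu x - P nu y| <= lip * e.
  by move=> nu; have [l l0 lP] := polymap_lipschitz D (PP nu); exists l.
have lip0 nu : 0 <= lip nu by case: (lipP nu).
(* The first term is the Taylor remainder along the solution, where t + |u(t) - u0| <= (1 + Ku) t;
   the second transports the error of U through the model field. *)
pose K1 := \sum_nu (C * (1 + Ku) ^+ M.+1 + lip nu * K).
have K10 : 0 <= K1.
  by rewrite sumr_ge0// => nu _; rewrite addr_ge0 ?mulr_ge0// exprn_ge0// addr_ge0.
pose eta1 := Num.min (Num.min eta etau) (Num.min (del / (1 + Ku)) 1).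
have dKu0 : 0 < 1 + Ku by rewrite ltr_pwDl.
exists K1, eta1; split => //.
  by rewrite !lt_min eta0 etau0 ltr01 divr_gt0.
move=> t /andP[t0]; rewrite !lt_min => /andP[/andP[te teu] /andP[td t1]].
apply: norm_row_le => [|j]; first by rewrite mulr_ge0// exprn_ge0.
have [u00 _] := hu.
have dfs s : 0 <= s <= t -> `|f s (u s) - \sum_(nu < L) P nu (s, U s)| <= K1 * t ^+ k.+1.
  move=> /andP[s0 st]; rewrite hf// -sumrB mulr_suml.
  have su : `|u s - u0| <= Ku * s by apply: Hu; rewrite s0 (le_lt_trans st).
  have s1 : s <= 1 by apply: (le_trans st); exact: ltW.
  have ssu : s + `|u s - u0| <= (1 + Ku) * s by rewrite mulrDl mul1r lerD2l.
  apply: (le_trans (ler_norm_sum _ _ _)); apply: ler_sum => nu _.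
  apply: (le_trans (ler_distD (P nu (s, u s)) _ _)); rewrite mulrDl; apply: lerD.
    apply: (le_trans (fP _ s0 _)).
      apply: (le_lt_trans ssu); rewrite mulrC -ltr_pdivlMr//.
      exact: le_lt_trans td.
    rewrite -mulrA ler_wpM2l//; apply: (@le_trans _ _ (((1 + Ku) * s) ^+ M.+1)).
      by rewrite lerXn2r ?nnegrE ?addr_ge0 ?mulr_ge0 ?(ltW dKu0).
    rewrite exprMn ler_wpM2l ?exprn_ge0 ?(ltW dKu0)//.
    apply: (@le_trans _ _ (t ^+ M.+1)); first by rewrite lerXn2r ?nnegrE.
    by rewrite ler_wiXn2l// ltW.
  case: (lipP nu) => _ lipnu; apply: (@le_trans _ _ (lip nu * (K * s ^+ k.+1))).
    have ss : box D s.
      apply: box_scalar; rewrite ger0_norm//; apply: (le_trans s1).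
      by rewrite /D -!addrA lerDl !addr_ge0.
    apply: lipnu.
    - apply: box_pair => //; apply: box_row.
      rewrite -[u s](subrK u0); apply: (le_trans (ler_normD _ _)).
      apply: (@le_trans _ _ (Ku + `|u0|)).
        by rewrite lerD2r; apply: (le_trans su); rewrite ler_piMr.
      by rewrite /D; move: KU0; lra.
    - apply: box_pair => //; apply: box_row; apply: (le_trans (HKU _ _)).
        by apply: box_scalar; rewrite ger0_norm.
      by rewrite /D lerDr !addr_ge0.
    - by rewrite mulr_ge0// exprn_ge0.
    - apply: close_pair; first by apply: close_refl; rewrite mulr_ge0// exprn_ge0.
      by apply: close_row; apply: HU; rewrite s0 (le_lt_trans st).
  rewrite -mulrA ler_wpM2l// ler_wpM2l//.
  by rewrite lerXn2r ?nnegrE.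
have := @mean_value_within R (fun s => u s 0 j) (fun s => f s (u s) 0 j)
  (fun s => B (s, 0) 0 j) (fun s => (\sum_(nu < L) P nu (s, U s)) 0 j) t
  (K1 * t ^+ k.+1) t0.
rewrite u00 B0 => H.
rewrite [t ^+ _]exprSr mulrA (_ : (u t - (u0 + B (t, 0))) 0 j = u t 0 j - B (t, 0) 0 j - (u0 0 j - (0 : 'rV[R]_n) 0 j)).
  apply: H.
  - move=> s /andP[s0 st] eps eps0.
    have sT : 0 <= s <= T.
      by rewrite s0 (le_trans st)// ltW// (lt_le_trans teu).
    apply: filterS (solution_first_order sT eps0) => x H /andP[x0 xt].
    have := H; rewrite x0 (le_trans xt) ?(ltW (lt_le_trans teu etauT))// => /(_ isT).
    apply: le_trans.
    by have := norm_entry_le (u x - u s - (x - s) *: f s (u s)) j; rewrite !mxE.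
  - move=> s /andP[s0 st]; have := dfs s; rewrite (ltW s0) (ltW st) => /(_ isT).
    apply: le_trans.
    by have := norm_entry_le (f s (u s) - \sum_(nu < L) P nu (s, U s)) j; rewrite mxE [X in _ + X]mxE.
  - by rewrite mulr_ge0// exprn_ge0.
by rewrite !mxE; ring.
Qed.

End Solution.

Lemma polynomial_field_model sigma M (fnu : 'I_L -> R -> 'rV[R]_n -> 'rV[R]_n) u0 :
  (M.+2 <= sigma)%N -> (forall nu, field_times_differentiable sigma (fnu nu)) ->
  exists (P : 'I_L -> R * 'rV[R]_n -> 'rV[R]_n) (C del : R),
    [/\ forall nu, polymap (P nu), 0 <= C, 0 < del &
    forall nu t x, 0 <= t -> t + `|x - u0| < del ->
      `|fnu nu t x - P nu (t, x)| <= C * (t + `|x - u0|) ^+ M.+1].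
Proof.
case: sigma => // k Mk fd.
have /choice[P PP] := fun nu => taylor_expansion u0 (fd nu).
have /choice[C CP] : forall nu, exists C, 0 <= C /\ exists2 del, 0 < del &
    forall t y, 0 <= t -> t + `|y| < del ->
    `|fnu nu t (u0 + y) - P nu (t, y)| <= C * (t + `|y|) ^+ k.+1.
  by move=> nu; case: (PP nu) => _ [C [del [C0 del0 H]]]; exists C; split=> //;
     exists del => // t y t0 ty; exact: H.
have /choice[del delP] : forall nu, exists del, 0 < del /\
    forall t y, 0 <= t -> t + `|y| < del ->
    `|fnu nu t (u0 + y) - P nu (t, y)| <= C nu * (t + `|y|) ^+ k.+1.
  by move=> nu; case: (CP nu) => _ [del del0 H]; exists del.
have C0 nu : 0 <= C nu by case: (CP nu).
(* A radius of at most 1 allows the remainder exponent to be lowered from [sigma] to [M.+1]. *)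
exists (fun nu z => P nu (z.1, z.2 - u0)), (\sum_nu C nu), (\big[Num.min/1]_nu del nu).
split.
- by move=> nu /=; have Pnu : polymap (P nu) := proj1 (PP nu); polymap_tac.
- by rewrite sumr_ge0.
- by apply: lt_bigmin => // nu _; case: (delP nu).
move=> nu t x t0 tx; case: (delP nu) => _ /(_ t (x - u0) t0).
rewrite [u0 + _]addrC subrK => H.
have tx1 : t + `|x - u0| <= 1.
  by apply: (le_trans (ltW tx)); exact: bigmin_le_id.
apply: (le_trans (H _)); first by apply: (lt_le_trans tx); exact: bigmin_le_cond.
apply: ler_pM => //.
- by rewrite exprn_ge0// addr_ge0 ?normr_ge0.
- by rewrite (bigD1 nu)//= lerDl sumr_ge0.
- by rewrite ler_wiXn2l ?addr_ge0//; exact: ltnW.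
Qed.

(* The Taylor polynomial [U] of the solution solves the Taylor polynomial of the
   problem up to a small defect; spreading the defect over the [L] fields makes
   [U] an exact solution without spoiling the approximation. *)
Lemma polynomial_model sigma M T f (fnu : 'I_L -> R -> 'rV[R]_n -> 'rV[R]_n) u0 u :
  0 < T -> (forall t x, 0 <= t -> f t x = \sum_(nu < L) fnu nu t x) ->
  solves_ivp f 0 T u0 u ->
  (M.+2 <= sigma)%N -> (forall nu, field_times_differentiable sigma (fnu nu)) ->
  exists (P : 'I_L -> R * 'rV[R]_n -> 'rV[R]_n) (U : R -> 'rV[R]_n) (C del : R),
    [/\ forall nu, polymap (P nu), polymap U, U 0 = u0,
      forall (t : R) j, is_derive t 1 (fun s => U s 0 j)
        ((\sum_(nu < L) P nu (t, U t)) 0 j) &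
      [/\ 0 <= C, 0 < del,
        forall nu t x, 0 <= t -> t + `|x - u0| < del ->
          `|fnu nu t x - P nu (t, x)| <= C * (t + `|x - u0|) ^+ M.+1 &
        forall t, 0 <= t < del -> `|u t - U t| <= C * t ^+ M.+2]].
Proof.
move=> T0 hf hu Msigma fd.
have [P [C [del [PP C0 del0 fP]]]] := polynomial_field_model u0 Msigma fd.
have picard k U := @solution_picard M T f fnu u0 u P C del T0 C0 del0 hf hu PP fP k U.
have [UM [UMP UM0 [KM [etaM [KM0 etaM0 HM]]]]] : exists U : R -> 'rV[R]_n,
    [/\ polymap U, U 0 = u0 & exists K eta, [/\ 0 <= K, 0 < eta &
      forall t, 0 <= t < eta -> `|u t - U t| <= K * t ^+ M.+1]].
  have H k : (k <= M)%N -> exists U : R -> 'rV[R]_n,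
      [/\ polymap U, U 0 = u0 & exists K eta, [/\ 0 <= K, 0 < eta &
      forall t, 0 <= t < eta -> `|u t - U t| <= K * t ^+ k.+1]]; last exact: H.
  elim: k => [|k IH] kM.
    have [K [eta [K0 eta0 _ H]]] := solution_lipschitz_at0 T0 hu.
    exists (fun=> u0); split => //; first exact: polymap_cst.
    by exists K, eta; split=> //.
  have [U [UP U0 UH]] := IH (ltnW kM).
  have [U1 [U1P U10 _ U1H]] := picard k U (ltnW kM) UP U0 UH.
  by exists U1; split.
have [|U [UP U0 dU [K [eta [K0 eta0 HU]]]]] := picard M UM (leqnn M) UMP UM0.
  by exists KM, etaM; split.
(* The derivative of U is the model field evaluated at [UM], so [d] is exactly its defect. Since
   [UM] and U differ by O(t^(M+1)), adding [d] to the fields is an error of the size already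
   committed. *)
pose d t := \sum_(nu < L) P nu (t, UM t) - \sum_(nu < L) P nu (t, U t).
have dP : polymap d.
  by apply: polymapBv; apply: polymap_sumv => nu _; polymap_tac.
have [B1 B10 UMB] := polymap_bounded 1 UMP.
have [B2 B20 UB] := polymap_bounded 1 UP.
have /choice[lip lipP] : forall nu, exists lip, 0 <= lip /\
    forall x y e, box (1 + B1 + B2) x -> box (1 + B1 + B2) y ->
    0 <= e -> close e x y -> `|P nu x - P nu y| <= lip * e.
  by move=> nu; have [l l0 lP] := polymap_lipschitz (1 + B1 + B2) (PP nu); exists l.
have lip0 nu : 0 <= lip nu by case: (lipP nu).
pose Kd := (\sum_nu lip nu) * (KM + K).
have Kd0 : 0 <= Kd by rewrite mulr_ge0 ?addr_ge0// sumr_ge0.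
have dle t : 0 <= t -> t < etaM -> t < eta -> t <= 1 -> `|d t| <= Kd * t ^+ M.+1.
  move=> t0 tM te t1.
  have bt : box (1 + B1 + B2) t.
    by apply: box_scalar; rewrite ger0_norm// (le_trans t1)// -addrA lerDl addr_ge0.
  have bt1 : box 1 t by apply: box_scalar; rewrite ger0_norm.
  have UMU : `|UM t - U t| <= (KM + K) * t ^+ M.+1.
    apply: (le_trans (ler_distD (u t) _ _)); rewrite mulrDl; apply: lerD.
      by rewrite distrC HM ?t0.
    apply: (le_trans (HU t _)); first by rewrite t0.
    by rewrite ler_wpM2l// ler_wiXn2l.
  rewrite /d -sumrB /Kd -mulrA mulr_suml; apply: (le_trans (ler_norm_sum _ _ _)).
  apply: ler_sum => nu _; case: (lipP nu) => _; apply.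
  - apply: box_pair => //; apply: box_row; apply: (le_trans (UMB _ bt1)).
    by rewrite addrAC lerDr addr_ge0.
  - apply: box_pair => //; apply: box_row; apply: (le_trans (UB _ bt1)).
    by rewrite lerDr addr_ge0.
  - by rewrite mulr_ge0 ?exprn_ge0// addr_ge0.
  - apply: close_pair; last exact: close_row.
    by apply: close_refl; rewrite mulr_ge0 ?exprn_ge0// addr_ge0.
exists (fun nu z => P nu z + L%:R^-1 *: d z.1), U, (C + L%:R^-1 * Kd + K),
  (Num.min (Num.min del 1) (Num.min etaM eta)).
have Li0 : 0 <= L%:R^-1 :> R by rewrite invr_ge0.
split => //.
- by move=> nu /=; have Pnu := PP nu; polymap_tac.
- move=> t j; rewrite big_split /= sumr_const card_ord -scaler_nat scalerA.
  (* Without any field there is nothing to carry the defect, but then every sum is empty and the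
     derivative of U is 0. *)
  have [L0|LN0] := eqVneq (L%:R : R) 0.
    have noI (nu : 'I_L) : False.
      by move: L0 => /eqP; rewrite pnatr_eq0 => /eqP E; case: nu => m; rewrite E.
    rewrite L0 mul0r scale0r addr0 big1 => [|nu]; last by case: (noI nu).
    by have := dU t j; rewrite big1 => [|nu] //; case: (noI nu).
  by rewrite mulfV// scale1r /d addrC subrK.
- split.
  + by rewrite !addr_ge0// mulr_ge0.
  + by rewrite !lt_min del0 ltr01 etaM0 eta0.
  + move=> nu t x t0; rewrite !lt_min => /andP[/andP[txd tx1] /andP[txM txe]].
    have ttx : t <= t + `|x - u0| by rewrite lerDl.
    have tx0 : 0 <= t + `|x - u0| by rewrite addr_ge0.
    rewrite opprD addrA; apply: (le_trans (ler_normB _ _)).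
    rewrite mulrDl ler_wpDr ?mulr_ge0 ?exprn_ge0// mulrDl; apply: lerD; first exact: fP.
    rewrite normrZ ger0_norm// -mulrA ler_wpM2l//.
    apply: (le_trans (dle t t0 _ _ _)); try exact: le_lt_trans ttx _.
      by apply: (le_trans ttx); exact: ltW.
    by rewrite ler_wpM2l// lerXn2r ?nnegrE.
  + move=> t /andP[t0]; rewrite !lt_min => /andP[_ /andP[_ te]].
    apply: (le_trans (HU t _)); first by rewrite t0.
    by rewrite ler_wpM2r ?exprn_ge0// lerDr addr_ge0// mulr_ge0.
Qed.

End PolynomialModel.

(** * Interpolation and quadrature *)

Section Quadrature.
Context {R : realType} (M : nat).
Implicit Types (h t : R) (j : 'I_M.+1).

Definition lagrange_poly h j : {poly R} :=
  \prod_(i < M.+1 | i != j)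
    ((idc_node h j - idc_node h i)^-1 *: ('X - (idc_node h i)%:P)).

Lemma horner_lagrange_poly h j t : (lagrange_poly h j).[t] = lagrange_basis h j t.
Proof.
rewrite horner_prod; apply: eq_bigr => i _.
by rewrite hornerZ hornerXsubC mulrC.
Qed.

Lemma size_lagrange_poly h j : (size (lagrange_poly h j) <= M.+1)%N.
Proof.
apply: (leq_trans (size_prod_leq _ _)) => /=.
rewrite leq_subLR.
apply: (@leq_trans (\sum_(i < M.+1 | i != j) 2).+1).
  rewrite ltnS; apply: leq_sum => i _.
  by apply: (leq_trans (size_scale_leq _ _)); rewrite size_XsubC.
rewrite sum_nat_const.
have -> : #|[pred i | i != j]| = M by rewrite cardC1 card_ord.
by rewrite addnC muln2 -addnn addSn.
Qed.

(** The difference of the two sides has size at most [M.+1] as a polynomial in t and vanishes at the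
    [M.+1] distinct nodes. *)
Lemma lagrange_exact h a t : h != 0 -> (a <= M)%N ->
  \sum_(j < M.+1) lagrange_basis h j t * idc_node h j ^+ a = t ^+ a.
Proof.
move=> h0 aM.
pose P := \sum_(j < M.+1) (idc_node h j ^+ a) *: lagrange_poly h j.
have PE s : P.[s] = \sum_(j < M.+1) lagrange_basis h j s * idc_node h j ^+ a.
  by rewrite horner_sum; apply: eq_bigr => j _; rewrite hornerZ horner_lagrange_poly mulrC.
have Pnode j : P.[idc_node h j] = idc_node h j ^+ a.
  have := @interpolant_node R 1 M h (fun m => const_mx (idc_node h m ^+ a)) j h0 (ltn_ord j).
  move=> /(congr1 (fun v : 'rV[R]_1 => v 0 0)); rewrite [X in _ = X]mxE PE => <-.
  by rewrite summxE; apply: eq_bigr => i _; rewrite !mxE.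
rewrite -PE -[RHS]hornerXn; congr (_.[t]).
apply/eqP; rewrite -subr_eq0; apply/negPn/negP => D0.
have := max_poly_roots D0 (rs := [seq idc_node h j | j : 'I_M.+1]).
rewrite size_map size_enum_ord.
have -> : all (root (P - 'X^a)) [seq idc_node h j | j : 'I_M.+1].
  by apply/allP => _ /mapP[j _ ->]; rewrite rootE hornerD hornerN Pnode hornerXn subrr.
have -> : uniq [seq idc_node h j | j : 'I_M.+1].
  rewrite map_inj_uniq ?enum_uniq// => i j /(mulIf h0) /eqP.
  by rewrite eqr_nat => /eqP /val_inj.
move=> /(_ isT isT); apply/negP; rewrite -leqNgt.
apply: (leq_trans (size_polyD _ _)); rewrite geq_max size_polyN size_polyXn ltnS aM andbT.
apply: (leq_trans (size_sum _ _ _)); apply/bigmax_leqP => j _.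
exact: (leq_trans (size_scale_leq _ _) (size_lagrange_poly h j)).
Qed.

(** Numerators are at most (C + M) h and denominators at least h, so h drops out. The range [C * h]
    may go beyond the last node, as abscissae are not confined to the step. *)
Lemma lagrange_bounded (C : R) : 0 <= C ->
  exists2 K, 0 <= K & forall h t j, 0 < h -> 0 <= t <= C * h ->
    `|lagrange_basis h j t| <= K.
Proof.
move=> C0; exists (\sum_(j < M.+1) \prod_(i < M.+1 | i != j) (C + M%:R)).
  by rewrite sumr_ge0// => j _; rewrite prodr_ge0// => i _; rewrite addr_ge0.
move=> h t j h0 /andP[t0 tC].
apply: (@le_trans _ _ (\prod_(i < M.+1 | i != j) (C + M%:R))); last first.
  rewrite [leRHS](bigD1 j)//= lerDl sumr_ge0// => k _.
  by rewrite prodr_ge0// => i _; rewrite addr_ge0.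
rewrite /lagrange_basis normr_prod; apply: ler_prod => i ij; rewrite normr_ge0/=.
rewrite normrM normfV /idc_node -mulrBl normrM (gtr0_norm h0).
have ji : 1 <= `|j%:R - i%:R : R|.
  have ijn : (i : nat) != j by apply: contra ij => /eqP/val_inj/eqP.
  have [lt|lt|E] := ltngtP i j; last by rewrite E eqxx in ijn.
    by rewrite -natrB 1?ltnW// normr_nat ler1n subn_gt0.
  by rewrite distrC -natrB 1?ltnW// normr_nat ler1n subn_gt0.
rewrite ler_pdivrMr ?mulr_gt0 ?(lt_le_trans ltr01 ji)//.
apply: (@le_trans _ _ ((C + M%:R) * h)); last first.
  rewrite [_ * h in leRHS]mulrC mulrA ler_peMr// mulr_ge0 ?(ltW h0)// addr_ge0//.
apply: (le_trans (ler_normB _ _)); rewrite mulrDl (ger0_norm t0) lerD//.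
rewrite ger0_norm ?mulr_ge0 ?(ltW h0)// ler_wpM2r ?(ltW h0)// ler_nat.
by rewrite -ltnS.
Qed.

Lemma lagrange_integral h j t : 0 <= t ->
  \int[lebesgue_measure]_(x in `[0, t]) lagrange_basis h j x =
  (primitive_poly (lagrange_poly h j)).[t].
Proof.
rewrite le_eqVlt => /predU1P[<-|t0].
  by rewrite primitive_poly0 set_itv1 Rintegral_set1.
have E : (fun x => lagrange_basis h j x) = horner (lagrange_poly h j).
  by apply/funext => x; rewrite horner_lagrange_poly.
rewrite E /Rintegral (@continuous_FTC2 _ _ (horner (primitive_poly (lagrange_poly h j))))//.
- by rewrite /= primitive_poly0 subr0.
- by apply: continuous_subspaceT; exact: continuous_horner.
- split=> [x _||]; first exact: derivable_horner.
    by apply: cvg_at_right_filter; exact: continuous_horner.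
  by apply: cvg_at_left_filter; exact: continuous_horner.
- by move=> x _; rewrite -derivE deriv_primitive_poly.
Qed.

Context {n : nat}.

(** Powers t^a with a <= M are reproduced exactly; on [0, C h] each higher power and its interpolant
    are O(h^a), hence O(h^(M+1)). This bounds the error without derivatives, also outside the
    nodes. *)
Lemma interpolation_error (Y : R * R -> 'rV[R]_n) (C : R) : polymap Y -> 0 <= C ->
  exists2 K, 0 <= K & forall h t (v : nat -> 'rV[R]_n) (e : R),
    0 < h <= 1 -> 0 <= t <= C * h ->
    (forall m, (m <= M)%N -> `|v m - Y (idc_node h m, h)| <= e) ->
    `|interpolant M h v t - Y (t, h)| <= K * (h ^+ M.+1 + e).
Proof.
move=> YP C0; have [K K0 HK] := lagrange_bounded C0.
have Yc c : exists2 K', 0 <= K' & forall h t, 0 < h <= 1 -> 0 <= t <= C * h ->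
    `|\sum_(j < M.+1) lagrange_basis h j t * Y (idc_node h j, h) 0 c - Y (t, h) 0 c| <= K' * h ^+ M.+1.
  have [m [G [GP E]]] := polyfun_expand (YP c).
  have /choice[B BP] : forall a, exists B, 0 <= B /\ forall h, box 1 h -> `|G a h| <= B.
    by move=> a; have [B B0 HB] := polyfun_bounded 1 (GP a); exists B.
  have B0 a : 0 <= B a by case: (BP a).
  pose D a := M.+1%:R * (K * M%:R ^+ a) + C ^+ a.
  have D0 a : 0 <= D a by rewrite addr_ge0 ?mulr_ge0 ?exprn_ge0.
  exists (\sum_(a < m) B a * D a) => [|h t /andP[h0 h1] tC].
    by rewrite sumr_ge0// => a _; rewrite mulr_ge0.
  have /andP[t0 tCh] := tC.
  have -> : \sum_(j < M.+1) lagrange_basis h j t * Y (idc_node h j, h) 0 c - Y (t, h) 0 c =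
      \sum_(a < m) G a h * (\sum_(j < M.+1) lagrange_basis h j t * idc_node h j ^+ a - t ^+ a).
    have -> : Y (t, h) 0 c = \sum_(a < m) t ^+ a * G a h by exact: E.
    under eq_bigr => j _ do rewrite (E (idc_node h j) h : Y _ 0 c = _) mulr_sumr.
    rewrite exchange_big /= -sumrB; apply: eq_bigr => a _.
    rewrite mulrBr mulr_sumr [t ^+ a * _]mulrC; congr (_ - _).
    by apply: eq_bigr => j _; ring.
  rewrite mulr_suml; apply: (le_trans (ler_norm_sum _ _ _)); apply: ler_sum => a _.
  rewrite normrM -mulrA; apply: ler_pM => //.
    by case: (BP a) => _; apply; apply: box_scalar; rewrite gtr0_norm.
  have [aM|Ma] := leqP a M.
    rewrite lagrange_exact ?(lt0r_neq0 h0)// subrr normr0.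
    by rewrite mulr_ge0// exprn_ge0// ltW.
  apply: (@le_trans _ _ (D a * h ^+ a)); last first.
    by rewrite ler_wpM2l// ler_wiXn2l// ltW.
  rewrite /D mulrDl -exprMn; apply: (le_trans (ler_normB _ _)); apply: lerD; last first.
    by rewrite ger0_norm ?exprn_ge0// lerXn2r ?nnegrE// mulr_ge0// ltW.
  apply: (le_trans (ler_norm_sum _ _ _)).
  apply: (@le_trans _ _ (\sum_(j < M.+1) K * M%:R ^+ a * h ^+ a)); last first.
    by rewrite sumr_const card_ord -[leLHS]mulr_natl !mulrA.
  apply: ler_sum => j _; rewrite normrM -mulrA; apply: ler_pM => //; first exact: HK.
  rewrite -exprMn normrX lerXn2r ?nnegrE ?mulr_ge0 ?(ltW h0)//.
  rewrite /idc_node ger0_norm ?mulr_ge0 ?(ltW h0)// ler_wpM2r ?(ltW h0)// ler_nat.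
  by rewrite -ltnS.
have /choice[K' K'P] : forall c, exists K', 0 <= K' /\ forall h t, 0 < h <= 1 -> 0 <= t <= C * h ->
    `|\sum_(j < M.+1) lagrange_basis h j t * Y (idc_node h j, h) 0 c - Y (t, h) 0 c| <= K' * h ^+ M.+1.
  by move=> c; have [k k0 kP] := Yc c; exists k.
have K'0 c : 0 <= K' c by case: (K'P c).
have S0 : 0 <= \sum_c K' c by rewrite sumr_ge0.
have S1 : 0 <= \sum_(j < M.+1) K by rewrite sumr_ge0.
exists (\sum_c K' c + \sum_(j < M.+1) K) => [|h t v e h01 tC ve]; first by rewrite addr_ge0.
have /andP[h0 h1] := h01.
have e0 : 0 <= e by apply: le_trans (ve 0%N (leq0n M)).
have hM : 0 <= h ^+ M.+1 by rewrite exprn_ge0// ltW.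
have -> : interpolant M h v t - Y (t, h) =
   (\sum_(j < M.+1) lagrange_basis h j t *: Y (idc_node h j, h) - Y (t, h)) +
   \sum_(j < M.+1) lagrange_basis h j t *: (v j - Y (idc_node h j, h)).
  rewrite /interpolant addrAC -big_split /=; congr (_ - _); apply: eq_bigr => j _.
  by rewrite -scalerDr addrC subrK.
apply: (le_trans (ler_normD _ _)); rewrite mulrDl; apply: lerD.
  apply: (@le_trans _ _ ((\sum_c K' c) * h ^+ M.+1)); last by rewrite ler_wpM2l// lerDl.
  apply: norm_row_le => [|c]; first by rewrite mulr_ge0.
  rewrite !mxE summxE; under eq_bigr => j _ do rewrite mxE.
  case: (K'P c) => _ /(_ h t h01 tC) /le_trans; apply.
  by rewrite ler_wpM2r// (bigD1 c)//= lerDl sumr_ge0.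
rewrite mulr_suml; apply: (le_trans (ler_norm_sum _ _ _)); apply: ler_sum => j _.
rewrite normrZ; apply: ler_pM => //; first exact: HK.
by apply: (le_trans (ve j _)); rewrite ?lerDr// -ltnS.
Qed.

(** The integrand error is that of interpolation, and integrating over a length at most [C * h]
    yields the extra factor h. *)
Lemma quadrature_error (A B : R * R -> 'rV[R]_n) (C : R) : polymap A -> 0 <= C ->
  (forall h, B (0, h) = 0) ->
  (forall t h c, is_derive t 1 (fun s : R => B (s, h) 0 c) (A (t, h) 0 c)) ->
  exists2 K, 0 <= K & forall h t (w : 'I_M.+1 -> 'rV[R]_n) (e : R),
    0 < h <= 1 -> 0 <= t <= C * h ->
    (forall j, `|w j - A (idc_node h j, h)| <= e) ->
    `|\sum_(j < M.+1) (\int[lebesgue_measure]_(x in `[0, t]) lagrange_basis h j x) *: w j - B (t, h)|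
      <= K * (h ^+ M.+1 + e) * h.
Proof.
move=> AP C0 B0 dB.
have [K K0 HK] := interpolation_error AP C0.
exists (K * C) => [|h t w e h01 /andP[t0 tC] we]; first by rewrite mulr_ge0.
have e0 : 0 <= e by apply: le_trans (we ord0).
have /andP[h0 h1] := h01.
have hM : 0 <= h ^+ M.+1 + e by rewrite addr_ge0// exprn_ge0// ltW.
apply: norm_row_le => [|c]; first by rewrite !mulr_ge0// ltW.
pose Q := \sum_j w j 0 c *: lagrange_poly h j.
pose prim := \sum_j w j 0 c *: primitive_poly (lagrange_poly h j).
have dprim (s : R) : is_derive s 1 (horner prim : R -> R) Q.[s].
  have -> : Q = prim^`().
    rewrite raddf_sum; apply: eq_bigr => j _.
    by rewrite /= derivZ deriv_primitive_poly.
  exact: is_derive_horner.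
have bnd s : 0 <= s <= t -> `|Q.[s] - A (s, h) 0 c| <= K * (h ^+ M.+1 + e).
  move=> /andP[s0 st].
  have sC : 0 <= s <= C * h by rewrite s0 (le_trans st).
  (* Extension to all naturals to match [interpolation_error]; the default 0 is never read at a
     node. *)
  pose v m := if insub m is Some j then w j else 0.
  have ve m : (m <= M)%N -> `|v m - A (idc_node h m, h)| <= e.
    by rewrite -ltnS => mM; rewrite /v insubT.
  apply: le_trans (HK h s v e h01 sC ve).
  apply: le_trans (norm_entry_le _ c); rewrite !mxE summxE horner_sum.
  rewrite le_eqVlt; apply/orP; left; apply/eqP; congr (`|_ - _|).
  apply: eq_bigr => j _; rewrite hornerZ horner_lagrange_poly mxE mulrC.
  by rewrite /v valK.
(* The whole difference is put on the smooth side of the comparison, the other function being 0. *)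
have := @mean_value_within R (fun=> 0) (fun=> 0) (fun s => prim.[s] - B (s, h) 0 c)
  (fun s => Q.[s] - A (s, h) 0 c) t (K * (h ^+ M.+1 + e)) t0.
have prim0 : prim.[0] = 0.
  by rewrite horner_sum big1// => j _; rewrite hornerZ primitive_poly0 mulr0.
rewrite prim0 B0 mxE !subr0 sub0r normrN.
have -> : prim.[t] - B (t, h) 0 c =
    (\sum_(j < M.+1) (\int[lebesgue_measure]_(x in `[0, t]) lagrange_basis h j x) *: w j - B (t, h)) 0 c.
  rewrite !mxE summxE horner_sum; congr (_ - _); apply: eq_bigr => j _.
  by rewrite hornerZ mxE lagrange_integral// mulrC.
move=> H; apply: (le_trans (H _ _ _ _)).
- by move=> s _ eps eps0; near=> x => _; rewrite /= mulr0 !subr0 normr0 mulr_ge0// ltW.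
- move=> s /andP[s0 st]; rewrite sub0r normrN; apply: bnd.
  by rewrite (ltW s0) (ltW st).
- by rewrite mulr_ge0.
- rewrite (_ : K * C * _ * h = K * (h ^+ M.+1 + e) * (C * h)); last by ring.
  by rewrite ler_wpM2l// mulr_ge0.
Unshelve. all: by end_near. Qed.

End Quadrature.

(** * Prediction and correction steps *)

Lemma polymap_time_lipschitz (R : realType) n (F : R * R -> 'rV[R]_n) (C : R) :
  polymap F -> 0 <= C -> exists2 K, 0 <= K & forall h t, 0 < h <= 1 -> 0 <= t <= C * h ->
    `|F (t, h) - F (0, h)| <= K * h.
Proof.
move=> FP C0; have [K K0 HK] := polymap_lipschitz (C + 1) FP.
exists (K * C) => [|h t /andP[h0 h1] /andP[t0 tC]]; first by rewrite mulr_ge0.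
have hb : box (C + 1) h by apply: box_scalar; rewrite gtr0_norm// (le_trans h1)// lerDr.
have Ch0 : 0 <= C * h by rewrite mulr_ge0// ltW.
rewrite -mulrA; apply: HK => //.
- apply: box_pair => //; apply: box_scalar; rewrite ger0_norm// (le_trans tC)//.
  by rewrite (@le_trans _ _ C)// ?ler_piMr// lerDl.
- by apply: box_pair => //; apply: box_scalar; rewrite normr0 addr_ge0.
- apply: close_pair; last exact: close_refl.
  by apply: close_scalar; rewrite subr0 ger0_norm.
Qed.

Section DeferredCorrection.
Context {R : realType} {n L : nat}.
Variables (M : nat) (rho : R) (f : R -> 'rV[R]_n -> 'rV[R]_n)
  (fnu : 'I_L -> R -> 'rV[R]_n -> 'rV[R]_n) (u0 : 'rV[R]_n)
  (P : 'I_L -> R * 'rV[R]_n -> 'rV[R]_n) (U : R -> 'rV[R]_n) (Cf del : R).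
Hypotheses (PP : forall nu, polymap (P nu)) (UP : polymap U) (U0 : U 0 = u0)
  (Cf0 : 0 <= Cf) (del0 : 0 < del).
Hypothesis dU : forall (t : R) j, is_derive t 1 (fun s => U s 0 j)
  ((\sum_(nu < L) P nu (t, U t)) 0 j).
Hypothesis hf : forall t x, 0 <= t -> f t x = \sum_(nu < L) fnu nu t x.
Hypothesis fbounded : forall nu (C : R), exists2 B, 0 <= B &
  forall t x, 0 <= t <= C -> `|x| <= C -> `|fnu nu t x| <= B.
Hypothesis fP : forall nu t x, 0 <= t -> t + `|x - u0| < del ->
  `|fnu nu t x - P nu (t, x)| <= Cf * (t + `|x - u0|) ^+ M.+1.

Lemma fields_bounded (C : R) : exists2 B, 0 <= B &
  forall nu t x, 0 <= t <= C -> `|x| <= C -> `|fnu nu t x| <= B.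
Proof.
have /choice[B BP] : forall nu, exists B, 0 <= B /\
    forall t x, 0 <= t <= C -> `|x| <= C -> `|fnu nu t x| <= B.
  by move=> nu; have [B B0 HB] := fbounded nu C; exists B.
have B0 nu : 0 <= B nu by case: (BP nu).
exists (\sum_nu B nu) => [|nu t x tC xC]; first by rewrite sumr_ge0.
case: (BP nu) => _ /(_ t x tC xC) /le_trans; apply.
by rewrite (bigD1 nu)//= lerDl sumr_ge0.
Qed.

(** Times and states within O(h) of (0, u0) enter the Taylor neighbourhood for small h, where the
    remainder is O(h^(M+1)); the Lipschitz constant of the model accounts for x - y. *)
Lemma fields_approx (C : R) : 0 <= C -> exists2 K, 0 <= K & \forall h \near 0^'+,
  forall nu t x y, 0 <= t <= C * h -> `|x - u0| <= C * h -> `|y - u0| <= C * h ->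
    `|fnu nu t x - P nu (t, y)| <= K * (h ^+ M.+1 + `|x - y|).
Proof.
move=> C0.
have /choice[lip lipP] : forall nu, exists lip, 0 <= lip /\ forall x y e,
    box (C + `|u0|) x -> box (C + `|u0|) y -> 0 <= e -> close e x y ->
    `|P nu x - P nu y| <= lip * e.
  by move=> nu; have [l l0 lP] := polymap_lipschitz (C + `|u0|) (PP nu); exists l.
have lip0 nu : 0 <= lip nu by case: (lipP nu).
pose K := Cf * (C + C) ^+ M.+1 + \sum_nu lip nu.
have K1 : 0 <= Cf * (C + C) ^+ M.+1 by rewrite mulr_ge0// exprn_ge0// addr_ge0.
have K2 : 0 <= \sum_nu lip nu by rewrite sumr_ge0.
exists K; first by rewrite addr_ge0.
have dC : 0 < del / (1 + C + C) by rewrite divr_gt0// -addrA ltr_pwDl// addr_ge0.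
near=> h => nu t x y /andP[t0 tC] xC yC.
have h0 : 0 < h by near: h; exact: nbhs_right_gt.
have h1 : h <= 1 by near: h; exact: nbhs_right_le.
have hd : h < del / (1 + C + C) by near: h; exact: nbhs_right_lt.
have ChC : C * h <= C by rewrite ler_piMr.
have txh : t + `|x - u0| <= (C + C) * h by rewrite mulrDl lerD.
have boxx z : `|z - u0| <= C * h -> box (C + `|u0|) (t, z).
  move=> zC; apply: box_pair.
    by apply: box_scalar; rewrite ger0_norm// (le_trans tC)// (le_trans ChC)// lerDl.
  apply: box_row; rewrite -[z](subrK u0); apply: (le_trans (ler_normD _ _)).
  by rewrite lerD2r (le_trans zC).
apply: (le_trans (ler_distD (P nu (t, x)) _ _)).
apply: (@le_trans _ _ (Cf * (C + C) ^+ M.+1 * h ^+ M.+1 + (\sum_nu lip nu) * `|x - y|)); last first.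
  rewrite /K mulrDr; apply: lerD; rewrite ler_wpM2r ?exprn_ge0 ?(ltW h0)//.
    by rewrite lerDl.
  by rewrite lerDr.
apply: lerD.
  apply: (le_trans (fP _ t0 _)).
    apply: (le_lt_trans txh); move: hd; rewrite ltr_pdivlMr; last first.
      by rewrite -addrA ltr_pwDl// addr_ge0.
    apply: le_lt_trans; rewrite [leRHS]mulrC ler_wpM2r ?(ltW h0)//.
    by rewrite -addrA lerDr.
  rewrite -mulrA ler_wpM2l// -exprMn lerXn2r ?nnegrE ?addr_ge0//.
  by rewrite mulr_ge0 ?addr_ge0// ltW.
case: (lipP nu) => _ lipnu; apply: (@le_trans _ _ (lip nu * `|x - y|)).
  apply: lipnu => //; [exact: boxx|exact: boxx|].
  by apply: close_pair; [exact: close_refl|exact: close_row].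
by rewrite ler_wpM2r// (bigD1 nu)//= lerDl sumr_ge0.
Unshelve. all: by end_near. Qed.

(** The remainder h^(M+2) is the accuracy of the Taylor model and is the same at every level; only
    the exponent of the structured part grows. It stays negligible as long as s + 1 <= M + 2. *)
Definition expansion s (eta : R * R -> 'rV[R]_n) (v : R -> nat -> 'rV[R]_n) : Prop :=
  exists2 C, 0 <= C & \forall h \near 0^'+, forall m, (m <= M)%N ->
    `|v h m - (U (m%:R * h) + h ^+ s *: eta (m%:R * h, h))| <= C * h ^+ M.+2.

(** The case without scaling: exponent 0 and model fields that ignore the parameter. Taking N = M +
    1 produces the remainder h^(M+2). *)
Lemma prediction_expansion S r v :
  ark_has_order S r -> (forall nu i, 0 <= ark_c S nu i) -> (r <= M.+1)%N ->
  (\forall h \near 0^'+, ark_run S rho fnu h M u0 (v h)) ->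
  exists eta, [/\ polymap eta, forall h, eta (0, h) = 0 & expansion r eta v].
Proof.
move=> Sr c0 rM run.
pose g nu (z : R * 'rV[R]_n * R) := P nu z.1.
have gP nu : polymap (g nu) by have Pnu := PP nu; rewrite /g; polymap_tac.
have qP : polymap (fun z : R * R => U z.1) by polymap_tac.
have [eta [etaP eta0 hX]] := ark_expansion M Sr c0 gP qP (fun t _ j _ => dU t j) rM.
exists eta; split => //.
pose X (z : R * R) : 'rV[R]_n := U z.1 + z.2 ^+ r *: eta z.
have XP : polymap X by rewrite /X; polymap_tac.
have gg nu (t : R) (x : 'rV[R]_n) (e : R) : g nu (t, e ^+ 0 *: x, e) = e ^+ 0 *: g nu (t, x, e).
  by rewrite !expr0 !scale1r.
have [||| C C0 HC] := @ark_run_expansion R L S n 0 M.+1 M rho (fun=> fnu) g g X u0 gP gP XP gg hX.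
- by move=> h _; rewrite /X /= U0 eta0 scaler0 addr0 expr0 scale1r.
- move=> C; have [B B0 HB] := fields_bounded (`|C| + `|u0|).
  exists B; near=> h => nu t z /andP[t0 tC] zC; apply: HB.
    rewrite t0/=; apply: (le_trans tC); apply: (le_trans (ler_norm _)).
    have h0 : 0 < h by near: h; exact: nbhs_right_gt.
    have h1 : h <= 1 by near: h; exact: nbhs_right_le.
    by rewrite normrM (gtr0_norm h0) (@le_trans _ _ `|C|)// ?lerDl// ler_piMr.
  rewrite -[z](subrK u0); apply: (le_trans (ler_normD _ _)).
  by rewrite lerD2r (le_trans zC)// ler_norm.
- move=> C; have [K K0 HK] := fields_approx (normr_ge0 C).
  exists K; near=> h => nu t z /andP[t0 tC] zC.
  have h0 : 0 < h by near: h; exact: nbhs_right_gt.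
  have CC : C * h <= `|C| * h by rewrite ler_wpM2r ?ler_norm// ltW.
  have HKh : forall nu t x y, 0 <= t <= `|C| * h -> `|x - u0| <= `|C| * h ->
    `|y - u0| <= `|C| * h -> `|fnu nu t x - P nu (t, y)| <= K * (h ^+ M.+1 + `|x - y|).
    by near: h.
  have := HKh nu t z z; rewrite subrr normr0 addr0 t0 (le_trans tC)// (le_trans zC)//.
  by apply.
exists C => //; near=> h => m mM.
have HCh : forall theta, ark_run S rho fnu h M u0 theta -> forall m, (m <= M)%N ->
   `|theta m - h ^+ 0 *: X (m%:R * h, h)| <= C * h ^+ M.+2 by near: h.
have runh : ark_run S rho fnu h M u0 (v h) by near: h.
by have := HCh _ runh m mM; rewrite expr0 scale1r.
Unshelve. all: by end_near. Qed.

Lemma correction_expansion S r s eta v v' :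
  ark_has_order S r -> (forall nu i, 0 <= ark_c S nu i) -> (r <= M.+1)%N ->
  polymap eta -> (forall h, eta (0, h) = 0) -> expansion s eta v ->
  (\forall h \near 0^'+, exists theta : nat -> 'rV[R]_n,
    ark_run S rho (error_field M h f fnu u0 (v h)) h M 0 theta /\
    forall m, (m <= M)%N -> v' h m = v h m +
      (theta m - residual_quadrature M h f u0 (v h) (idc_node h m))) ->
  exists eta', [/\ polymap eta', forall h, eta' (0, h) = 0 & expansion (s + r) eta' v'].
Proof.
move=> Sr c0 rM etaP eta0 [Cv Cv0 Hv] run.

(* Model of the current approximation and of its integrated residual *)
pose p (z : R * 'rV[R]_n) : 'rV[R]_n := \sum_(nu < L) P nu z.
have pP : polymap p by apply: polymap_sumv => nu _; exact: PP.
pose Y (z : R * R) : 'rV[R]_n := U z.1 + z.2 ^+ s *: eta z.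
have YP : polymap Y by rewrite /Y; polymap_tac.
have Y0 h : Y (0, h) = u0 by rewrite /Y /= U0 eta0 scaler0 addr0.
have [D [DP DE]] : exists D : R * R -> 'rV[R]_n, polymap D /\
    forall z, p (z.1, Y z) - p (z.1, U z.1) = z.2 ^+ s *: D z.
  pose a (z : R * R) : R * 'rV[R]_n := (z.1, U z.1).
  pose b (z : R * R) : R * 'rV[R]_n := (z.1, Y z).
  pose c (i : coord_ix (T := R * 'rV[R]_n)) (z : R * R) : R :=
    if i is inr j then eta z 0 j else 0.
  have aP : polymap a by rewrite /a; polymap_tac.
  have bP : polymap b by rewrite /b; polymap_tac.
  have dP : polymap (fun z : R * R => z.2 ^+ s) by polymap_tac.
  have cP i : polyfun (c i).
    case: i => [i|j] /=; first exact: Polyfun_cst.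
    by apply/polymapP; rewrite /c; polymap_tac.
  apply: (polymap_increment pP aP bP dP cP) => -[[]|j] z /=.
    by rewrite subrr mulr0.
  by rewrite !mxE addrAC subrr add0r.
have [ID [IDP ID0 dID]] := polymap_primitive DP.
pose Ibar (z : R * R) : 'rV[R]_n := eta z - ID z.
have IbarP : polymap Ibar by rewrite /Ibar; polymap_tac.
pose q (z : R * R) : 'rV[R]_n := -1 *: ID z.
have qP : polymap q by rewrite /q; polymap_tac.
pose J (z : R * R) : 'rV[R]_n := z.2 ^+ s *: Ibar z.
have JP : polymap J by rewrite /J; polymap_tac.
have J0 h : J (0, h) = 0 by rewrite /J /Ibar /= eta0 ID0 subrr scaler0.
(* This is the primitive of p along [Y], because U - u0 is the primitive of p along U. So [J], equal
   to Y - u0 - B, is the integrated residual of [Y]. *)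
pose B (z : R * R) : 'rV[R]_n := (U z.1 - u0) + z.2 ^+ s *: ID z.
have BJ z : J z = Y z - u0 - B z.
  by rewrite /J /B /Y /Ibar; apply/rowP => j; rewrite !mxE; ring.
have B0 h : B (0, h) = 0 by rewrite /B /= U0 subrr add0r ID0 scaler0.
pose A (z : R * R) : 'rV[R]_n := p (z.1, Y z).
have AP : polymap A by rewrite /A; polymap_tac.
have dB (t h : R) j : is_derive t 1 (fun x => B (x, h) 0 j) (A (t, h) 0 j).
  have -> : (fun x => B (x, h) 0 j) =
      (fun x => U x 0 j) + (cst (- u0 0 j) + h ^+ s *: (fun x => ID (x, h) 0 j)).
    by apply/funext => x; rewrite /B !fctE /= !mxE /= /GRing.scale /= addrA.
  have -> : A (t, h) 0 j = p (t, U t) 0 j + (0 + h ^+ s *: D (t, h) 0 j).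
    have /(congr1 (fun x : 'rV[R]_n => x 0 j)) := DE (t, h).
    rewrite mxE [in X in _ + X]mxE [in RHS]mxE /= => E.
    by rewrite add0r [X in _ = _ + X]/GRing.scale /= -E [RHS]addrC subrK.
  exact: is_deriveD.

(* The scaled error equation and its exact solution *)
pose G nu (z : R * 'rV[R]_n * R) : 'rV[R]_n :=
  P nu (z.1.1, Y (z.1.1, z.2) + z.1.2 - z.2 ^+ s *: Ibar (z.1.1, z.2)) -
  P nu (z.1.1, Y (z.1.1, z.2)).
have GP nu : polymap (G nu) by have Pnu := PP nu; rewrite /G; polymap_tac.
have /choice[g gPE] : forall nu, exists g : R * 'rV[R]_n * R -> 'rV[R]_n,
    polymap g /\ forall z, P nu (z.1.1, Y (z.1.1, z.2) + z.2 ^+ s *: (z.1.2 - Ibar (z.1.1, z.2))) -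
      P nu (z.1.1, Y (z.1.1, z.2)) = z.2 ^+ s *: g z.
  move=> nu.
  pose a (z : R * 'rV[R]_n * R) : R * 'rV[R]_n := (z.1.1, Y (z.1.1, z.2)).
  pose b (z : R * 'rV[R]_n * R) : R * 'rV[R]_n :=
    (z.1.1, Y (z.1.1, z.2) + z.2 ^+ s *: (z.1.2 - Ibar (z.1.1, z.2))).
  pose c (i : coord_ix (T := R * 'rV[R]_n)) (z : R * 'rV[R]_n * R) : R :=
    if i is inr j then (z.1.2 - Ibar (z.1.1, z.2)) 0 j else 0.
  have aP : polymap a by rewrite /a; polymap_tac.
  have bP : polymap b by rewrite /b; polymap_tac.
  have dP : polymap (fun z : R * 'rV[R]_n * R => z.2 ^+ s) by polymap_tac.
  have cP i : polyfun (c i).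
    case: i => [i|j] /=; first exact: Polyfun_cst.
    by apply/polymapP; rewrite /c; polymap_tac.
  apply: (polymap_increment (PP nu) aP bP dP cP) => -[[]|j] z /=.
    by rewrite subrr mulr0.
  rewrite /b /a /= [X in X - _]mxE addrAC subrr add0r [LHS]mxE.
  by [].
have gP nu : polymap (g nu) by case: (gPE nu).
have gE nu : forall z, P nu (z.1.1, Y (z.1.1, z.2) + z.2 ^+ s *: (z.1.2 - Ibar (z.1.1, z.2))) -
      P nu (z.1.1, Y (z.1.1, z.2)) = z.2 ^+ s *: g nu z by case: (gPE nu).
have Gg nu (t : R) (x : 'rV[R]_n) (e : R) : G nu (t, e ^+ s *: x, e) = e ^+ s *: g nu (t, x, e).
  by have := gE nu (t, x, e); rewrite /= => <-; rewrite /G /=;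
    congr (P nu (_, _) - _); apply/rowP => i; rewrite !mxE; ring.
have qd (t e : R) j : 0 < e -> is_derive t 1 (fun x => q (x, e) 0 j)
    ((\sum_(nu < L) g nu (t, q (t, e), e)) 0 j).
  move=> e0.
  have -> : \sum_(nu < L) g nu (t, q (t, e), e) = -1 *: D (t, e).
    (* At x = q = -ID the shift q - Ibar equals -eta, which brings the argument Y + e^s (q - Ibar)
       back to U; the scaled fields then sum to -D. Cancelling e^s is where e > 0 is needed. *)
    apply: (@scalerI _ _ (e ^+ s)); first by rewrite expf_neq0// lt0r_neq0.
    rewrite scaler_sumr scalerA mulrC -scalerA.
    have := DE (t, e); rewrite /= => <-.
    rewrite scaleN1r opprB /p -sumrB; apply: eq_bigr => nu _.
    have := gE nu (t, q (t, e), e); rewrite /= => <-; congr (P nu (_, _) - _).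
    by rewrite /Y /q /Ibar /=; apply/rowP => i; rewrite !mxE; ring.
  have -> : (fun x => q (x, e) 0 j) = -1 *: (fun x => ID (x, e) 0 j).
    by apply/funext => x; rewrite /q mxE.
  by rewrite mxE; exact: is_deriveZ.
have [eta' [eta'P eta'0 hX]] := ark_expansion M Sr c0 gP qP qd rM.
exists eta'; split => //.
pose X (z : R * R) : 'rV[R]_n := q z + z.2 ^+ r *: eta' z.
have XP : polymap X by rewrite /X; polymap_tac.

(* Interpolant, quadrature and residual compared with their models *)
have approx (C : R) : 0 <= C -> exists2 K, 0 <= K & \forall h \near 0^'+,
    forall t, 0 <= t <= C * h ->
    [/\ `|interpolant M h (v h) t - Y (t, h)| <= K * h ^+ M.+1,
        `|\sum_(j < M.+1) (\int[lebesgue_measure]_(x in `[0, t]) lagrange_basis h j x)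
          *: f (idc_node h j) (v h j) - B (t, h)| <= K * h ^+ M.+2,
        `|Y (t, h) - u0| <= K * h & `|J (t, h)| <= K * h].
  move=> C0.
  have [K1 K10 H1] := interpolation_error M YP C0.
  have [K2 K20 H2] := quadrature_error M AP C0 B0 dB.
  have [K3 K30 H3] := polymap_time_lipschitz YP C0.
  have [K4 K40 H4] := polymap_time_lipschitz JP C0.
  have [K5 K50 H5] := polymap_time_lipschitz YP (ler0n R M).
  (* The radius covers the nodes: times up to M h, [Y] within [K5 * h] of [u0], and computed values
     within [Cv * h] of [Y]. *)
  have [K6 K60 H6] := fields_approx (addr_ge0 (addr_ge0 (ler0n R M) K50) Cv0).
  pose K7 := \sum_(nu < L) K6 * (1 + Cv).
  have K70 : 0 <= K7 by rewrite sumr_ge0// => nu _; rewrite mulr_ge0// addr_ge0.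
  have K10' : 0 <= K1 * (1 + Cv) by rewrite mulr_ge0// addr_ge0.
  have K20' : 0 <= K2 * (1 + K7) by rewrite mulr_ge0// addr_ge0.
  exists (K1 * (1 + Cv) + K2 * (1 + K7) + K3 + K4); first by rewrite !addr_ge0.
  near=> h => t tC.
  have h0 : 0 < h by near: h; exact: nbhs_right_gt.
  have h1 : h <= 1 by near: h; exact: nbhs_right_le.
  have h01 : 0 < h <= 1 by rewrite h0.
  have hp k : 0 <= h ^+ k by rewrite exprn_ge0// ltW.
  have hS : h ^+ M.+2 <= h ^+ M.+1 by rewrite ler_wiXn2l// ltW.
  have hS1 : h ^+ M.+2 <= h by rewrite exprS ler_piMr ?(ltW h0)// exprn_ile1// ltW.
  have Hvh : forall m, (m <= M)%N -> `|v h m - Y (idc_node h m, h)| <= Cv * h ^+ M.+2.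
    by near: h.
  have H6h : forall nu t x y, 0 <= t <= (M%:R + K5 + Cv) * h -> `|x - u0| <= (M%:R + K5 + Cv) * h ->
     `|y - u0| <= (M%:R + K5 + Cv) * h ->
    `|fnu nu t x - P nu (t, y)| <= K6 * (h ^+ M.+1 + `|x - y|) by near: h.
  have node0 m : 0 <= idc_node h m by rewrite mulr_ge0// ltW.
  have nodeM m : (m <= M)%N -> idc_node h m <= M%:R * h.
    by move=> mM; rewrite ler_wpM2r ?(ltW h0)// ler_nat.
  have fA (j : 'I_M.+1) : `|f (idc_node h j) (v h j) - A (idc_node h j, h)| <= K7 * h ^+ M.+1.
    have jM : (j <= M)%N by rewrite -ltnS.
    have YK5 : `|Y (idc_node h j, h) - u0| <= K5 * h.
      by rewrite -(Y0 h); apply: H5 => //; rewrite node0 nodeM.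
    rewrite hf// /A /p -sumrB mulr_suml; apply: (le_trans (ler_norm_sum _ _ _)).
    apply: ler_sum => nu _; apply: (le_trans (H6h _ _ _ _ _ _ _)).
    - rewrite node0/=; apply: (le_trans (nodeM _ jM)).
      by rewrite ler_wpM2r ?(ltW h0)// -addrA lerDl addr_ge0.
    - apply: (le_trans (ler_distD (Y (idc_node h j, h)) _ _)).
      apply: (@le_trans _ _ (Cv * h + K5 * h)).
        by rewrite lerD// (le_trans (Hvh _ jM))// ler_wpM2l.
      by rewrite -mulrDl ler_wpM2r ?(ltW h0)//; move: (ler0n R M); lra.
    - apply: (le_trans YK5); rewrite ler_wpM2r ?(ltW h0)//.
      by rewrite -addrA addrCA lerDl addr_ge0.
    - rewrite -mulrA ler_wpM2l// mulrDl mul1r lerD2l.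
      by apply: (le_trans (Hvh _ jM)); rewrite ler_wpM2l.
  have h1' : h ^+ M.+1 + Cv * h ^+ M.+2 <= (1 + Cv) * h ^+ M.+1.
    by rewrite mulrDl mul1r lerD2l ler_wpM2l.
  split.
  - apply: (le_trans (H1 h t (v h) _ h01 tC Hvh)).
    apply: (@le_trans _ _ (K1 * (1 + Cv) * h ^+ M.+1)).
      by rewrite -mulrA ler_wpM2l.
    by rewrite ler_wpM2r// -!addrA lerDl !addr_ge0.
  - apply: (le_trans (H2 h t _ _ h01 tC fA)).
    apply: (@le_trans _ _ (K2 * (1 + K7) * h ^+ M.+2)).
      by rewrite [h ^+ M.+2]exprSr !mulrA ler_wpM2r ?(ltW h0)// -mulrA mulrDl mul1r.
    by rewrite ler_wpM2r// -!addrA addrCA lerDl !addr_ge0.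
  - rewrite -(Y0 h); apply: (le_trans (H3 h t h01 tC)).
    by rewrite ler_wpM2r ?(ltW h0)// -addrA addrCA lerDl !addr_ge0.
  - rewrite -[J _]subr0 -(J0 h); apply: (le_trans (H4 h t h01 tC)).
    by rewrite ler_wpM2r ?(ltW h0)// lerDr !addr_ge0.
have rqE h t : residual_quadrature M h f u0 (v h) t - J (t, h) =
   (interpolant M h (v h) t - Y (t, h)) -
   (\sum_(j < M.+1) (\int[lebesgue_measure]_(x in `[0, t]) lagrange_basis h j x)
          *: f (idc_node h j) (v h j) - B (t, h)).
  by rewrite BJ /residual_quadrature; apply/rowP => j; rewrite !mxE; ring.
have rqJ (C : R) : 0 <= C -> exists2 K, 0 <= K & \forall h \near 0^'+,
    forall t, 0 <= t <= C * h ->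
    [/\ `|interpolant M h (v h) t - Y (t, h)| <= K * h ^+ M.+1,
        `|residual_quadrature M h f u0 (v h) t - J (t, h)| <= K * h ^+ M.+1,
        `|Y (t, h) - u0| <= K * h & `|J (t, h)| <= K * h].
  move=> C0; have [K K0 HK] := approx C C0.
  exists (K + K); first exact: addr_ge0.
  near=> h => t tC.
  have h0 : 0 < h by near: h; exact: nbhs_right_gt.
  have h1 : h <= 1 by near: h; exact: nbhs_right_le.
  have HKh : forall t, 0 <= t <= C * h ->
    [/\ `|interpolant M h (v h) t - Y (t, h)| <= K * h ^+ M.+1,
        `|\sum_(j < M.+1) (\int[lebesgue_measure]_(x in `[0, t]) lagrange_basis h j x)
          *: f (idc_node h j) (v h j) - B (t, h)| <= K * h ^+ M.+2,
        `|Y (t, h) - u0| <= K * h & `|J (t, h)| <= K * h] by near: h.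
  have [H1 H2 H3 H4] := HKh t tC.
  have hM0 : 0 <= h ^+ M.+1 by rewrite exprn_ge0// ltW.
  split.
  - by apply: (le_trans H1); rewrite ler_wpM2r// lerDl.
  - rewrite rqE; apply: (le_trans (ler_normB _ _)); rewrite mulrDl lerD//.
    by apply: (le_trans H2); rewrite ler_wpM2l// ler_wiXn2l// ltW.
  - by apply: (le_trans H3); rewrite ler_wpM2r ?(ltW h0)// lerDl.
  - by apply: (le_trans H4); rewrite ler_wpM2r ?(ltW h0)// lerDl.

(* The computed solution of the error equation *)
have [||| Cr Cr0 HCr] := @ark_run_expansion R L S n s M.+1 M rho
  (fun h => error_field M h f fnu u0 (v h)) G g X 0 GP gP XP Gg hX.
- by move=> h _; rewrite /X /q /= ID0 eta'0 !scaler0 addr0 scaler0.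
- move=> C; have [K K0 HK] := rqJ `|C| (normr_ge0 C).
  (* The fields are evaluated at x + z - w, where the interpolant x is bounded by |u0| + 2K and the
     quadrature value w by 2K. *)
  have [Bf Bf0 HB] := fields_bounded (`|C| + `|u0| + 4 * K).
  exists (Bf + Bf); near=> h => nu t z /andP[t0 tC]; rewrite subr0 => zC.
  have h0 : 0 < h by near: h; exact: nbhs_right_gt.
  have h1 : h <= 1 by near: h; exact: nbhs_right_le.
  have HKh : forall t, 0 <= t <= `|C| * h ->
    [/\ `|interpolant M h (v h) t - Y (t, h)| <= K * h ^+ M.+1,
        `|residual_quadrature M h f u0 (v h) t - J (t, h)| <= K * h ^+ M.+1,
        `|Y (t, h) - u0| <= K * h & `|J (t, h)| <= K * h] by near: h.
  have tC' : 0 <= t <= `|C| * h.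
    by rewrite t0 (le_trans tC)// ler_wpM2r ?ler_norm// ltW.
  have [H1 H2 H3 H4] := HKh t tC'.
  have Kh : K * h <= K by rewrite ler_piMr.
  have KhM : K * h ^+ M.+1 <= K by rewrite ler_piMr// exprn_ile1// ltW.
  have tD : 0 <= t <= `|C| + `|u0| + 4 * K.
    rewrite t0/=; case/andP: tC' => _ /le_trans; apply.
    apply: (@le_trans _ _ `|C|); first by rewrite ler_piMr.
    by rewrite -addrA lerDl addr_ge0// mulr_ge0.
  set x := interpolant _ _ _ _ in H1; set w := residual_quadrature _ _ _ _ _ _ in H2.
  have xb : `|x| <= `|u0| + 2 * K.
    rewrite (_ : x = (x - Y (t, h)) + (Y (t, h) - u0) + u0); last by rewrite addrA !subrK.
    have N1 := ler_normD (x - Y (t, h) + (Y (t, h) - u0)) u0.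
    have N2 := ler_normD (x - Y (t, h)) (Y (t, h) - u0).
    by move: N1 N2 H1 H3 Kh KhM; lra.
  have wb : `|w| <= 2 * K.
    rewrite -[w](subrK (J (t, h))).
    have N1 := ler_normD (w - J (t, h)) (J (t, h)).
    by move: N1 H2 H4 Kh KhM; lra.
  have zC' : `|z| <= `|C| by rewrite (le_trans zC)// ler_norm.
  apply: (le_trans (ler_normB _ _)); apply: lerD; apply: HB => //.
    have N1 := ler_normB (x + z) w; have N2 := ler_normD x z.
    by move: N1 N2 xb wb zC'; lra.
  by move: xb K0 (normr_ge0 C); lra.
- move=> C; have [K K0 HK] := rqJ `|C| (normr_ge0 C).
  have C1 : 0 <= `|C| + 4 * K by rewrite addr_ge0// mulr_ge0.
  have [K6 K60 HK6] := fields_approx C1.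
  (* The argument x + z - w misses its model by at most 2K h^(M+1), one K for the interpolant and
     one for the residual; the subtracted field only has the error of the interpolant. *)
  exists (K6 * (1 + 2 * K) + K6 * (1 + K)); near=> h => nu t z /andP[t0 tC].
  rewrite subr0 => zC.
  have h0 : 0 < h by near: h; exact: nbhs_right_gt.
  have h1 : h <= 1 by near: h; exact: nbhs_right_le.
  have HKh : forall t, 0 <= t <= `|C| * h ->
    [/\ `|interpolant M h (v h) t - Y (t, h)| <= K * h ^+ M.+1,
        `|residual_quadrature M h f u0 (v h) t - J (t, h)| <= K * h ^+ M.+1,
        `|Y (t, h) - u0| <= K * h & `|J (t, h)| <= K * h] by near: h.
  have HK6h : forall nu t x y, 0 <= t <= (`|C| + 4 * K) * h ->
    `|x - u0| <= (`|C| + 4 * K) * h -> `|y - u0| <= (`|C| + 4 * K) * h ->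
    `|fnu nu t x - P nu (t, y)| <= K6 * (h ^+ M.+1 + `|x - y|) by near: h.
  have CC : C * h <= `|C| * h by rewrite ler_wpM2r ?ler_norm// ltW.
  have tC' : 0 <= t <= `|C| * h by rewrite t0 (le_trans tC).
  have [H1 H2 H3 H4] := HKh t tC'.
  have KhM : K * h ^+ M.+1 <= K * h.
    by rewrite ler_wpM2l// exprS ler_piMr ?(ltW h0)// exprn_ile1// ltW.
  have Kh0 : 0 <= K * h by rewrite mulr_ge0// ltW.
  have Ch0 : 0 <= `|C| * h by rewrite mulr_ge0// ltW.
  have zC' : `|z| <= `|C| * h by rewrite (le_trans zC).
  have DE' : (`|C| + 4 * K) * h = `|C| * h + 4 * (K * h) by ring.
  have tD : 0 <= t <= (`|C| + 4 * K) * h.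
    by rewrite t0/= DE'; case/andP: tC' => _; move: Kh0; lra.
  rewrite /G /error_field /= -/(J (t, h)).
  set x := interpolant _ _ _ _ in H1 *; set w := residual_quadrature _ _ _ _ _ _ in H2 *.
  have xY : `|x - u0| <= 2 * (K * h).
    rewrite (_ : x - u0 = (x - Y (t, h)) + (Y (t, h) - u0)); last by rewrite addrA subrK.
    have N2 := ler_normD (x - Y (t, h)) (Y (t, h) - u0).
    by move: N2 H1 H3 KhM; lra.
  have wb : `|w| <= 2 * (K * h).
    rewrite -[w](subrK (J (t, h))).
    have N1 := ler_normD (w - J (t, h)) (J (t, h)).
    by move: N1 H2 H4 KhM; lra.
  have A1 : `|fnu nu t (x + z - w) - P nu (t, Y (t, h) + z - J (t, h))| <=
      K6 * (1 + 2 * K) * h ^+ M.+1.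
    apply: (le_trans (HK6h nu t _ _ tD _ _)).
    - rewrite (_ : _ - u0 = (x - u0) + z - w); last by apply/rowP => i; rewrite !mxE; ring.
      have N1 := ler_normB (x - u0 + z) w; have N2 := ler_normD (x - u0) z.
      by rewrite DE'; move: N1 N2 xY wb zC'; lra.
    - rewrite (_ : _ - u0 = (Y (t, h) - u0) + z - J (t, h)); last first.
        by apply/rowP => i; rewrite !mxE; ring.
      have N1 := ler_normB (Y (t, h) - u0 + z) (J (t, h)).
      have N2 := ler_normD (Y (t, h) - u0) z.
      by rewrite DE'; move: N1 N2 H3 H4 zC' Kh0; lra.
    - rewrite -mulrA ler_wpM2l// mulrDl mul1r lerD2l.
      rewrite (_ : _ - _ = (x - Y (t, h)) - (w - J (t, h))); last first.
        by apply/rowP => i; rewrite !mxE; ring.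
      have N1 := ler_normB (x - Y (t, h)) (w - J (t, h)).
      by rewrite -mulrA; move: N1 H1 H2; lra.
  have A2 : `|fnu nu t x - P nu (t, Y (t, h))| <= K6 * (1 + K) * h ^+ M.+1.
    apply: (le_trans (HK6h nu t _ _ tD _ _)).
    - by rewrite DE'; move: xY Kh0 Ch0; lra.
    - by rewrite DE'; move: H3 Kh0 Ch0; lra.
    - by rewrite -mulrA ler_wpM2l// mulrDl mul1r lerD2l.
  have swap (a b c d : 'rV[R]_n) : a - b - (c - d) = (a - c) - (b - d).
    by apply/rowP => i; rewrite !mxE; ring.
  rewrite swap mulrDl.
  by apply: (le_trans (ler_normB _ _)); exact: lerD.

(* Assembly of the corrected values *)
have [K K0 HK] := approx M%:R (ler0n R M).
exists (Cv + Cr + (Cv + K)); first by rewrite !addr_ge0.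
near=> h => m mM.
have h0 : 0 < h by near: h; exact: nbhs_right_gt.
have HKh : forall t, 0 <= t <= M%:R * h ->
    [/\ `|interpolant M h (v h) t - Y (t, h)| <= K * h ^+ M.+1,
        `|\sum_(j < M.+1) (\int[lebesgue_measure]_(x in `[0, t]) lagrange_basis h j x)
          *: f (idc_node h j) (v h j) - B (t, h)| <= K * h ^+ M.+2,
        `|Y (t, h) - u0| <= K * h & `|J (t, h)| <= K * h] by near: h.
have Hvh : forall m, (m <= M)%N -> `|v h m - Y (idc_node h m, h)| <= Cv * h ^+ M.+2 by near: h.
have HCrh : forall theta, ark_run S rho (error_field M h f fnu u0 (v h)) h M 0 theta ->
  forall m, (m <= M)%N -> `|theta m - h ^+ s *: X (m%:R * h, h)| <= Cr * h ^+ M.+2 by near: h.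
have [theta [runth v'E]] : exists theta : nat -> 'rV[R]_n,
    ark_run S rho (error_field M h f fnu u0 (v h)) h M 0 theta /\
    forall m, (m <= M)%N -> v' h m = v h m +
      (theta m - residual_quadrature M h f u0 (v h) (idc_node h m)) by near: h.
have th := HCrh theta runth m mM.
have tM : 0 <= idc_node h m <= M%:R * h.
  by rewrite mulr_ge0 ?(ltW h0)//= ler_wpM2r ?(ltW h0)// ler_nat.
have [_ H2 _ _] := HKh _ tM.
have vY := Hvh m mM.
have rq : `|residual_quadrature M h f u0 (v h) (idc_node h m) - J (idc_node h m, h)| <=
    (Cv + K) * h ^+ M.+2.
  (* At a node the interpolant is the computed value itself, so the interpolation error O(h^(M+1))
     is absent and the residual is accurate to O(h^(M+2)). Here no factor h from a step would
     compensate for it. *)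
  rewrite rqE interpolant_node ?lt0r_neq0// mulrDl.
  by apply: (le_trans (ler_normB _ _)); exact: lerD.
rewrite v'E//; move: rq th vY H2; rewrite -/(idc_node h m).
set w := residual_quadrature _ _ _ _ _ _; set t := idc_node h m => rq th vY H2.
(* The model terms satisfy Y + h^s X - J = U + h^(s+r) eta', since eta and ID cancel; only the three
   remainders survive. *)
rewrite (_ : _ - _ = (v h m - Y (t, h)) + (theta m - h ^+ s *: X (t, h)) - (w - J (t, h))).
  rewrite 2!mulrDl; apply: (le_trans (ler_normB _ _)); apply: lerD => //.
  by apply: (le_trans (ler_normD _ _)); exact: lerD.
by rewrite /Y /X /J /q /Ibar /= exprD; apply/rowP => i; rewrite !mxE; ring.
Unshelve. all: by end_near. Qed.

End DeferredCorrection.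

(** The first step of each sweep starts at time 0, where the requirement that abscissae lie in R^+
    reads 0 <= c h. That step exists because M > 0. *)
Lemma idc_abscissa_ge0 (R : realType) (n L M cs : nat) (meth : nat -> ark_method R L)
    rho f (fnu : 'I_L -> R -> 'rV[R]_n -> 'rV[R]_n) u0 h ups k :
  (0 < M)%N -> 0 < h -> idc_run M cs meth rho f fnu u0 h ups -> (k <= cs)%N ->
  forall nu i, 0 <= ark_c (meth k) nu i.
Proof.
move=> M0 h0 [run0 runS] kcs nu i.
have stepP S g w w' : ark_step S rho g h (0%:R * h) (w : 'rV[R]_n) w' ->
    forall nu i, 0 <= ark_c S nu i.
  by move=> [z [+ _ _ _]] mu j => /(_ mu j); rewrite mul0r add0r pmulr_lge0.
move: nu i; case: k kcs => [_|k kcs].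
  by have [_ /(_ 0%N M0)] := run0; exact: stepP.
by have [theta [[_ /(_ 0%N M0) th] _]] := runS k kcs; exact: stepP th.
Qed.

Theorem theorem4p7 (R : realType) (n L M cs sigma : nat) (T : R)
  (f : R -> 'rV[R]_n -> 'rV[R]_n) (fnu : 'I_L -> R -> 'rV[R]_n -> 'rV[R]_n)
  (u0 : 'rV[R]_n) (u : R -> 'rV[R]_n)
  (meth : nat -> ark_method R L) (r : nat -> nat)
  (rho : R) (ups : R -> nat -> nat -> 'rV[R]_n)
  (hM : (0 < M)%N) (hT : 0 < T)
  (hf : forall t x, 0 <= t -> f t x = \sum_(nu < L) fnu nu t x)
  (hu : solves_ivp f 0 T u0 u)
  (hsigma : (M + 2 <= sigma)%N)
  (hu_diff : times_differentiable sigma (`[0, T] : set R^o) u)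
  (hf_diff : field_times_differentiable sigma f)
  (hfnu_diff : forall nu, field_times_differentiable sigma (fnu nu))
  (horder : forall k, (k <= cs)%N -> ark_has_order (meth k) (r k))
  (hs : (\sum_(j < cs.+1) r j <= M + 1)%N)
  (hups : \forall h \near 0^'+, idc_run M cs meth rho f fnu u0 h (ups h)) :
  (fun h : R => `|u (M%:R * h) - ups h cs M| : R^o)
    =O_ (0^'+) (fun h : R => h ^+ (\sum_(j < cs.+1) r j).+1 : R^o).
Proof.
move: hsigma; rewrite addn2 => Msigma.
have [P [U [C [del [PP UP U0 dU [C0 del0 fP uU]]]]]] :=
  polynomial_model hT hf hu Msigma hfnu_diff.
have fb nu (B : R) : exists2 K, 0 <= K &
    forall t x, 0 <= t <= B -> `|x| <= B -> `|fnu nu t x| <= K.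
  by move: (hfnu_diff nu) Msigma; case: (sigma) => // m fd _; exact: (field_bounded fd).
(* The coefficients do not depend on h, so a single positive h with a completed run determines the
   sign of all abscissae. *)
have c0 k : (k <= cs)%N -> forall nu i, 0 <= ark_c (meth k) nu i.
  move=> kcs.
  have [h [h0 runh]] : exists h, 0 < h /\ idc_run M cs meth rho f fnu u0 h (ups h).
    apply: (@filter_ex _ (0 : R)^'+); near=> h; split; first by near: h; exact: nbhs_right_gt.
    by near: h.
  exact: idc_abscissa_ge0 hM h0 runh kcs.
have rM k : (k <= cs)%N -> (r k <= M.+1)%N.
  rewrite -ltnS => kcs; rewrite -addn1; apply: leq_trans hs.
  by rewrite (bigD1 (Ordinal kcs))//= leq_addr.
have exp k : (k <= cs)%N -> exists eta, [/\ polymap eta, forall h, eta (0, h) = 0 &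
    expansion M U (\sum_(j < k.+1) r j) eta (fun h => ups h k)].
  elim: k => [_|k IH kcs].
    rewrite big_ord1; apply: (prediction_expansion (rho := rho) PP UP U0 C0 del0 dU fb fP) => //.
    - exact: horder.
    - exact: c0.
    - exact: rM.
    - by apply: filterS hups => h [].
  have [eta [etaP eta0 etaE]] := IH (ltnW kcs).
  rewrite big_ord_recr /=.
  apply: (correction_expansion (rho := rho) PP UP U0 C0 del0 dU hf fb fP _ _ _ etaP eta0 etaE).
  - exact: horder.
  - exact: c0.
  - exact: rM.
  - by apply: filterS hups => h [_ /(_ k kcs)].
have [eta [etaP eta0 [K K0 HK]]] := exp cs (leqnn cs).
have [E E0 HE] := polymap_time_lipschitz etaP (ler0n R M).
set s := \sum_(j < cs.+1) r j in HK hs *.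
have s2 : (s.+1 <= M.+2)%N by rewrite ltnS -addn1.
(* In order: Taylor error of U at time M h, remainder of the expansion, and the structured error,
   where [eta] at time 0 is 0 and gives the additional h. The summand 1 makes the constant
   positive. *)
apply/eqO_exP; exists (C * M%:R ^+ M.+2 + K + E + 1).
  by rewrite ltr_pwDr// !addr_ge0// mulr_ge0// exprn_ge0.
near=> h.
have h0 : 0 < h by near: h; exact: nbhs_right_gt.
have h1 : h <= 1 by near: h; exact: nbhs_right_le.
have hd : h < del / M%:R by near: h; apply: nbhs_right_lt; rewrite divr_gt0// ltr0n.
have HKh : forall m, (m <= M)%N ->
    `|ups h cs m - (U (m%:R * h) + h ^+ s *: eta (m%:R * h, h))| <= K * h ^+ M.+2.
  by near: h.
have Mh0 : 0 <= M%:R * h by rewrite mulr_ge0// ltW.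
have hs0 : h ^+ M.+2 <= h ^+ s.+1 by rewrite ler_wiXn2l// ltW.
have H1 : `|u (M%:R * h) - U (M%:R * h)| <= C * (M%:R * h) ^+ M.+2.
  by apply: uU; rewrite Mh0 mulrC -ltr_pdivlMr ?ltr0n.
have H2 := HKh M (leqnn M).
have H3 : `|h ^+ s *: eta (M%:R * h, h)| <= E * h ^+ s.+1.
  rewrite normrZ ger0_norm ?exprn_ge0 ?(ltW h0)// exprSr mulrCA ler_wpM2l ?exprn_ge0 ?(ltW h0)//.
  by rewrite -[eta _]subr0 -(eta0 h); apply: HE; rewrite ?h0 ?Mh0 /=.
rewrite normr_id [`|h ^+ _|]gtr0_norm ?exprn_gt0//.
rewrite (_ : u (M%:R * h) - ups h cs M = (u (M%:R * h) - U (M%:R * h)) -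
   (ups h cs M - (U (M%:R * h) + h ^+ s *: eta (M%:R * h, h))) -
   h ^+ s *: eta (M%:R * h, h)); last by apply/rowP => i; rewrite !mxE; ring.
rewrite mulrDl mul1r ler_wpDr ?exprn_ge0 ?(ltW h0)// 2!mulrDl.
apply: (le_trans (ler_normB _ _)); apply: lerD => //.
apply: (le_trans (ler_normB _ _)); apply: lerD.
  apply: (le_trans H1); rewrite exprMn mulrA.
  by rewrite ler_wpM2l// mulr_ge0// exprn_ge0.
by apply: (le_trans H2); rewrite ler_wpM2l.
Unshelve. all: by end_near. Qed.
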